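(* Consider a wave group $\eta(x,t)=A(\xi,\tau)e^{i(k_0x-\omega_0t)}+\text{c.c.}$ (c.c. denotes the complex conjugate of the preceding term), with $\xi=x$, $\tau=t-x/V_0$, whose complex amplitude $A$ satisfies the spatial nonlinear Schrödinger equation $$\partial_\xi A+i\beta\,\partial_\tau^2A+i\gamma|A|^2A=0 ,$$ where $\gamma=0$ (the linear equation) is allowed. A necessary condition for this wave field to have a wavefront dislocation is that the Chu-Mei quotient $\partial_t^2a/a$ is unbounded at a singular point, where $a=|A|$ is the real amplitude regarded as a function of $(x,t)$.
   Context: Setting: the wave group is the lowest-order description of waves with carrier frequency $\omega_0$ in a dispersive wave equation (linear or weakly nonlinear) with real, invertible linear dispersion relation $\omega=\Omega(k)$. Here $\omega_0=\Omega(k_0)$, $V_0=\Omega'(k_0)$ is the group velocity, $\beta=-\Omega''(k_0)/(2[\Omega'(k_0)]^3)$ is the dispersion coefficient, and $\gamma\in\mathbb{R}$ is the nonlinear coefficient. Write $A(x,t-x/V_0)\,e^{i(k_0x-\omega_0t)}=a(x,t)e^{i\Phi(x,t)}$ with real amplitude $a$ and real phase $\Phi$, the phase being defined where $a\neq0$. The local wavenumber and local frequency are $k=\partial_x\Phi$ and $\omega=-\partial_t\Phi$. A singular point is a point $(\hat x,\hat t)\in\mathbb{R}^2$ with $a(\hat x,\hat t)=0$; singular points are not assumed to be isolated. The wave field has a wavefront dislocation (of strength $n\neq0$) in the area of the $(x,t)$-plane enclosed by a contour if $\oint d\Phi=\oint(k\,dx-\omega\,dt)=2n\pi$ with $n$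 a nonzero integer. The strength of an individual singular point is found by taking the contour to be a circle $C(\epsilon)$ of radius $\epsilon$ around it and letting the radius shrink: with $I=\lim_{\epsilon\to0}\oint_{C(\epsilon)}d\Phi$, there is no wavefront dislocation at the point if $I=0$, and there is one if $I=\pm2\pi$. The Chu-Mei quotient is $\partial_t^2a/a$. Its boundedness at a singular point $(\hat x,\hat t)$ is judged by its behaviour there, evaluated as $\lim_{t\to\hat t}\frac{\partial_t^2a}{a}(\hat x,t)$.
   Formalization: ''Unbounded at a singular point'' means unbounded on every (x,t)-neighbourhood of it; the limit in t along x = x̂ can be finite at a dislocation and is shown to be infinite (in absolute value) only if the zero of the complex field is transverse. *)

(* Defs.v *)
(* Stdlib real numbers with Coquelicot. *)
From Stdlib Require Import Reals Lra.
From Coquelicot Require Import Coquelicot.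
Open Scope R_scope.

Definition expi (theta : R) : C := (cos theta, sin theta).

(* A real dispersion relation omega = Omega(k) invertible onto its range, for
   which the group velocity and the dispersion coefficient at k0 make sense. *)
Definition dispersion_relation (Omega : R -> R) (k0 : R) : Prop :=
  (exists K : R -> R, forall k, K (Omega k) = k) /\
  locally k0 (fun k => ex_derive Omega k) /\
  ex_derive (Derive Omega) k0 /\
  Derive Omega k0 <> 0.

Definition group_velocity (Omega : R -> R) (k0 : R) : R := Derive Omega k0.

Definition dispersion_coefficient (Omega : R -> R) (k0 : R) : R :=
  - Derive_n Omega 2 k0 / (2 * Derive Omega k0 ^ 3).

Definition jointly_continuous (f : R -> R -> C) : Prop :=
  forall p : R * R, continuous (fun q : R * R => f (fst q) (snd q) : C_R_NormedModule) p.

(* Classical solutions on the whole (xi, tau)-plane: every derivative in the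
   equation, together with d_tau A, exists and is jointly continuous. *)
Definition spatial_NLS (beta gamma : R) (A : R -> R -> C) : Prop :=
  exists A_xi A_tau A_tautau : R -> R -> C,
    (forall xi tau,
       is_derive (K := R_AbsRing) (V := C_R_NormedModule)
         (fun y => A y tau) xi (A_xi xi tau)) /\
    (forall xi tau,
       is_derive (K := R_AbsRing) (V := C_R_NormedModule)
         (fun s => A xi s) tau (A_tau xi tau)) /\
    (forall xi tau,
       is_derive (K := R_AbsRing) (V := C_R_NormedModule)
         (fun s => A_tau xi s) tau (A_tautau xi tau)) /\
    jointly_continuous A_xi /\
    jointly_continuous A_tau /\
    jointly_continuous A_tautau /\
    (forall xi tau,
       (A_xi xi tau + Ci * RtoC beta * A_tautau xi tau
        + Ci * RtoC gamma * RtoC (Cmod (A xi tau) ^ 2) * A xi tau = 0)%C).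

(* The complex field A(x, t - x/V0) e^{i (k0 x - omega0 t)}. *)
Definition complex_field (A : R -> R -> C) (V0 k0 omega0 : R) (x t : R) : C :=
  Cmult (A x (t - x / V0)) (expi (k0 * x - omega0 * t)).

Definition wave_group (A : R -> R -> C) (V0 k0 omega0 : R)
    (eta : R -> R -> R) : Prop :=
  forall x t,
    RtoC (eta x t) =
      (complex_field A V0 k0 omega0 x t
       + Cconj (complex_field A V0 k0 omega0 x t))%C.

Definition amplitude (A : R -> R -> C) (V0 : R) (x t : R) : R :=
  Cmod (A x (t - x / V0)).

Definition singular_point (a : R -> R -> R) (x t : R) : Prop := a x t = 0.

(* A phase is in general only available locally (globally it is multivalued):
   B = |B| e^{i Phi} with Phi continuous, on a neighbourhood of (x, t). *)
Definition local_phase (B : R -> R -> C) (Phi : R -> R -> R) (x t : R) : Prop :=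
  locally_2d
    (fun y s =>
       B y s = (RtoC (Cmod (B y s)) * expi (Phi y s))%C /\
       continuity_2d_pt Phi y s) x t.

(* k = d_x Phi and omega = - d_t Phi at (x, t).  Where B <> 0, two local phases
   differ by a constant near (x, t), so that k and omega are unique. *)
Definition local_wavenumber_frequency (B : R -> R -> C) (x t k omega : R) : Prop :=
  exists Phi : R -> R -> R,
    local_phase B Phi x t /\
    is_derive (fun y => Phi y t) x k /\
    is_derive (fun s => Phi x s) t (- omega).

Definition C1 (f : R -> R) : Prop :=
  forall s, ex_derive f s /\ continuous (Derive f) s.

Definition piecewise_C1_curve (X T : R -> R) : Prop :=
  exists (N : nat) (sigma : nat -> R),
    sigma 0%nat = 0 /\ sigma N = 1 /\
    (forall i, (i < N)%nat -> sigma i < sigma (S i)) /\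
    (forall i, (i < N)%nat ->
       exists Xi Ti : R -> R,
         C1 Xi /\ C1 Ti /\
         forall s, sigma i <= s <= sigma (S i) -> X s = Xi s /\ T s = Ti s).

(* A contour: a piecewise C^1 simple closed curve s |-> (X s, T s), s in [0, 1]. *)
Definition contour (X T : R -> R) : Prop :=
  piecewise_C1_curve X T /\
  X 0 = X 1 /\ T 0 = T 1 /\
  (forall s s', 0 <= s < 1 -> 0 <= s' < 1 ->
     X s = X s' -> T s = T s' -> s = s').

(* (x, t) is in the area enclosed by the contour: it is off the contour and in
   a bounded component of the complement, i.e. paths that start at (x, t) and
   go far enough must meet the contour. *)
Definition enclosed (X T : R -> R) (x t : R) : Prop :=
  (forall s, 0 <= s <= 1 -> (X s, T s) <> (x, t)) /\
  exists M : R,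
    forall P Q : R -> R,
      (forall s, continuous P s) -> (forall s, continuous Q s) ->
      P 0 = x -> Q 0 = t ->
      M < Rabs (P 1) + Rabs (Q 1) ->
      exists r s, 0 <= r <= 1 /\ 0 <= s <= 1 /\ P r = X s /\ Q r = T s.

(* The contour integral of dPhi = k dx - omega dt equals I.  At the finitely
   many corners Derive is arbitrary, which does not affect the integral. *)
Definition phase_circulation (B : R -> R -> C) (X T : R -> R) (I : R) : Prop :=
  exists k omega : R -> R -> R,
    (forall s, 0 <= s <= 1 ->
       local_wavenumber_frequency B (X s) (T s)
         (k (X s) (T s)) (omega (X s) (T s))) /\
    is_RInt
      (fun s => k (X s) (T s) * Derive X s - omega (X s) (T s) * Derive T s)
      0 1 I.

Definition wavefront_dislocation (B : R -> R -> C) (X T : R -> R) (n : Z) : Prop :=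
  contour X T /\
  (forall s, 0 <= s <= 1 -> B (X s) (T s) <> RtoC 0) /\
  n <> 0%Z /\
  phase_circulation B X T (2 * IZR n * PI).

(* Only meaningful where a <> 0. *)
Definition chu_mei (a : R -> R -> R) (x t : R) : R :=
  Derive_n (fun s => a x s) 2 t / a x t.

(* Boundedness near (x, t) of the function d_t^2 a / a, which lives on a <> 0. *)
Definition chu_mei_bounded_at (a : R -> R -> R) (x t : R) : Prop :=
  exists M : R,
    locally_2d (fun y s => a y s <> 0 -> Rabs (chu_mei a y s) <= M) x t.

(* The zero of B at (x, t) is transverse: the gradients of Re B and Im B are
   linearly independent there. *)
Definition transverse_zero (B : R -> R -> C) (x t : R) : Prop :=
  B x t = RtoC 0 /\
  exists Bx Bt : C,
    is_derive (K := R_AbsRing) (V := C_R_NormedModule) (fun y => B y t) x Bx /\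
    is_derive (K := R_AbsRing) (V := C_R_NormedModule) (fun s => B x s) t Bt /\
    Im (Cconj Bx * Bt)%C <> 0.

(* Main.v *)
(** If the field had no zero inside the contour, it would not wind along it: on
    a fine grid, the winding is the sum over grid squares of the circulation of
    the phase around the square times the number of turns of the contour around
    its centre.  The first factor vanishes near the contour and its interior, the
    second one at points that can escape to infinity without meeting the contour.

    Among the enclosed zeros, a compact set, take the topmost of the leftmost
    ones.  If the time derivative of the field vanishes there, a bounded Chu-Mei
    quotient makes the amplitude above it vanish by Gronwall's lemma, against
    topmostness.  Otherwise rotate the field to [u + i v] with [u_t > 0]: just to
    the left there are zeros of [u], where the Chu-Mei quotient is
    [u_t^2 / v^2 + v_tt / v] with [v] small but, by leftmostness, nonzero.

    At a transverse zero the equation gives [A_xi = - i beta A_tautau], so that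
    transversality says [Re (conj A_tau A_tautau) <> 0], which is the coefficient
    of the pole of the quotient in time. *)

(* Zeros of the field are not assumed isolated, so there is no index of an individual zero to work
   with. This is why one extremal zero is chosen: its position alone supplies the zero-free points
   needed on its left and straight above it. The interior is known only through [enclosed], that is,
   through paths of escape: a point off the contour that is not enclosed comes with such a path, and
   the winding of the contour seen from a point moving along it is constant and finally zero. The
   phase is local as well, so the circulation is first turned into a continuous function [theta] of
   the curve parameter that follows the argument of the field; a nonzero strength says that [theta]
   does not return to its initial value. Angles are determined only modulo 2 pi, and each congruence
   is made an equality by a bound: [near] keeps angles below pi/4, so that the few angles of one
   comparison cannot add up to a full turn. The winding concerns the field with its carrier, the
   quotient only the modulus of [A]; since the carrier has modulus one, both fields have the same
   zeros and the same modulus. *)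
Require Import Defs.
From Stdlib Require Import Reals Lra Lia Psatz Arith Classical ClassicalEpsilon.
From Coquelicot Require Import Coquelicot.
Open Scope R_scope.

(** * Oriented angles *)

(** The real and imaginary parts of [conj z * w], whose argument is the oriented angle from [z] to
    [w]. *)
Definition cdot (z w : C) : R := fst z * fst w + snd z * snd w.
Definition cdet (z w : C) : R := fst z * snd w - snd z * fst w.

Definition is_angle (z w : C) (theta : R) : Prop :=
  exists r, 0 < r /\ cdot z w = r * cos theta /\ cdet z w = r * sin theta.
(** An oriented angle of absolute value below pi/4. A sum of up to five such angles stays below 2
    pi, so that [is_angle_unique] turns congruences into equalities. *)
Definition near (z w : C) : Prop := Rabs (cdet z w) < cdot z w.

(* Junk unless [0 < cdot z w]; the argument on the grid tolerates junk on the
   squares that the contour does not turn around. *)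
Definition ang (z w : C) : R := atan (cdet z w / cdot z w).

Lemma cdot_cdet_sqr z w :
  cdot z w * cdot z w + cdet z w * cdet z w = cdot z z * cdot w w.
Proof. unfold cdot, cdet; ring. Qed.

Lemma cdot_ge0 z : 0 <= cdot z z.
Proof. unfold cdot; nra. Qed.

Lemma is_angle_norm_pos z w a : is_angle z w a -> 0 < cdot z z /\ 0 < cdot w w.
Proof.
intros (r & Hr & H1 & H2).
assert (H := cdot_cdet_sqr z w); rewrite H1, H2 in H.
assert (S := sin2_cos2 a); unfold Rsqr in S.
assert (r * r = cdot z z * cdot w w) by nra.
assert (0 < cdot z z * cdot w w) by nra.
assert (Hz := cdot_ge0 z); assert (Hw := cdot_ge0 w).
split; nra.
Qed.

(** The product of [conj x * y] and [conj y * z] is [|y|^2] times [conj x * z]; the addition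
    formulas for cosine and sine express this product. *)
Lemma is_angle_trans x y z a b :
  is_angle x y a -> is_angle y z b -> is_angle x z (a + b).
Proof.
intros Ha Hb.
assert (Hy : 0 < cdot y y) by apply (is_angle_norm_pos _ _ _ Ha).
destruct Ha as (r & Hr & H1 & H2), Hb as (q & Hq & H3 & H4).
exists (r * q / cdot y y); split; [|split].
- apply Rdiv_lt_0_compat; nra.
- rewrite cos_plus.
  assert (E : cdot x z * cdot y y = cdot x y * cdot y z - cdet x y * cdet y z)
    by (unfold cdot, cdet; ring).
  rewrite H1, H2, H3, H4 in E.
  apply Rmult_eq_reg_r with (cdot y y); [|lra]. rewrite E. field; lra.
- rewrite sin_plus.
  assert (E : cdet x z * cdot y y = cdet x y * cdot y z + cdot x y * cdet y z)
    by (unfold cdot, cdet; ring).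
  rewrite H1, H2, H3, H4 in E.
  apply Rmult_eq_reg_r with (cdot y y); [|lra]. rewrite E. field; lra.
Qed.

Lemma is_angle_sym x y a : is_angle x y a -> is_angle y x (- a).
Proof.
intros (r & Hr & H1 & H2); exists r; rewrite cos_neg, sin_neg.
unfold cdot, cdet in *; repeat split; lra.
Qed.

Lemma cos_eq_1_small x : cos x = 1 -> Rabs x < 2 * PI -> x = 0.
Proof.
intros Hc Hx.
assert (S : sin (x / 2) = 0).
{ replace x with (2 * (x / 2)) in Hc by field. rewrite cos_2a_sin in Hc. nra. }
apply Rabs_def2 in Hx.
destruct (Rtotal_order x 0) as [H|[H|H]]; auto.
- assert (P : 0 < sin (- (x / 2))) by (apply sin_gt_0; lra).
  rewrite sin_neg in P; lra.
- assert (P : 0 < sin (x / 2)) by (apply sin_gt_0; lra). lra.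
Qed.

(** Composing one angle with the reverse of the other gives an angle from [z] to itself, whose
    cosine must be 1. *)
Lemma is_angle_unique z w a b :
  is_angle z w a -> is_angle z w b -> Rabs (a - b) < 2 * PI -> a = b.
Proof.
intros Ha Hb Hab.
assert (Z : is_angle z z (a - b)).
{ apply is_angle_trans with w; auto. now apply is_angle_sym. }
destruct Z as (r & Hr & H1 & H2).
enough (a - b = 0) by lra. apply cos_eq_1_small; auto.
assert (sin (a - b) = 0).
{ unfold cdet in H2. apply Rmult_eq_reg_l with r; [|lra]. rewrite <- H2; ring. }
assert (S := sin2_cos2 (a - b)); unfold Rsqr in S.
assert (0 <= cos (a - b)) by (generalize (cdot_ge0 z); nra).
nra.
Qed.

Lemma is_angle_ang z w : 0 < cdot z w -> is_angle z w (ang z w).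
Proof.
intros H. unfold ang. set (q := cdet z w / cdot z w).
assert (Hc : 0 < cos (atan q)) by (generalize (atan_bound q); intros; apply cos_gt_0; lra).
exists (cdot z w / cos (atan q)); repeat split.
- now apply Rdiv_lt_0_compat.
- field; lra.
- assert (T := tan_atan q). unfold tan in T.
  assert (cdet z w = cdot z w * q) by (unfold q; field; lra).
  rewrite H0; transitivity (cdot z w * (sin (atan q) / cos (atan q))).
  { now rewrite T. }
  field; lra.
Qed.

Lemma ang_bound z w : - (PI / 2) < ang z w < PI / 2.
Proof. generalize (atan_bound (cdet z w / cdot z w)); unfold ang; lra. Qed.

Lemma near_pos z w : near z w -> 0 < cdot z w.
Proof. unfold near; generalize (Rabs_pos (cdet z w)); lra. Qed.

Lemma near_ang z w : near z w -> - (PI / 4) < ang z w < PI / 4.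
Proof.
intros H; assert (P := near_pos _ _ H); unfold near in H; apply Rabs_def2 in H.
unfold ang; split.
- rewrite <- atan_1, <- atan_opp. apply atan_increasing.
  apply Rmult_lt_reg_r with (cdot z w); auto. unfold Rdiv.
  rewrite Rmult_assoc, Rinv_l; lra.
- rewrite <- atan_1. apply atan_increasing.
  apply Rmult_lt_reg_r with (cdot z w); auto. unfold Rdiv.
  rewrite Rmult_assoc, Rinv_l; lra.
Qed.

(** The bound 7 pi/4 is 2 pi minus the pi/4 granted by [near_ang]. *)
Lemma is_angle_ang_unique z w a :
  near z w -> is_angle z w a -> Rabs a < 7 * PI / 4 -> a = ang z w.
Proof.
intros N H Ha. apply is_angle_unique with z w; auto.
- apply is_angle_ang, near_pos, N.
- apply near_ang in N. apply Rabs_def2 in Ha. apply Rabs_def1; lra.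
Qed.

(** * Closed paths on a grid *)

Fixpoint rsum (n : nat) (f : nat -> R) : R :=
  match n with 0%nat => 0 | S m => rsum m f + f m end.

Lemma rsum_ext n f g :
  (forall k, (k < n)%nat -> f k = g k) -> rsum n f = rsum n g.
Proof.
induction n as [|n IH]; intros H; simpl; auto.
rewrite IH, H; auto.
Qed.

Lemma rsum_plus n f g : rsum n (fun k => f k + g k) = rsum n f + rsum n g.
Proof. induction n as [|n IH]; simpl; lra. Qed.

Lemma rsum_scal n c f : rsum n (fun k => c * f k) = c * rsum n f.
Proof. induction n as [|n IH]; simpl; lra. Qed.

Lemma rsum_zero n f : (forall k, (k < n)%nat -> f k = 0) -> rsum n f = 0.
Proof.
intros H; rewrite (rsum_ext n f (fun _ => 0 * 0)).
- rewrite rsum_scal; lra.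
- intros k Hk; rewrite H; auto; lra.
Qed.

Lemma rsum_telescope n g : rsum n (fun k => g (S k) - g k) = g n - g 0%nat.
Proof. induction n as [|n IH]; simpl; lra. Qed.

Lemma rsum_exchange n m f :
  rsum n (fun k => rsum m (fun q => f k q)) = rsum m (fun q => rsum n (fun k => f k q)).
Proof.
induction n as [|n IH]; simpl.
- symmetry; apply rsum_zero; auto.
- now rewrite IH, rsum_plus.
Qed.

Lemma rsum_single n f q :
  (q < n)%nat -> (forall k, (k < n)%nat -> k <> q -> f k = 0) -> rsum n f = f q.
Proof.
induction n as [|n IH]; intros Hq H; simpl; [lia|].
destruct (Nat.eq_dec q n) as [->|Hn].
- rewrite rsum_zero; [lra|]. intros k Hk; apply H; lia.
- rewrite IH; [|lia|intros; apply H; lia]. rewrite (H n); [lra|lia|lia].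
Qed.

Definition below (b j : nat) : R := if (b <? j)%nat then 1 else 0.

Lemma rsum_below n j f :
  (j <= n)%nat -> rsum n (fun b => below b j * f b) = rsum j f.
Proof.
induction n as [|n IH]; intros H.
- now replace j with 0%nat by lia.
- simpl. destruct (Nat.eq_dec j (S n)) as [->|Hj].
  + simpl. unfold below at 2. rewrite (proj2 (Nat.ltb_lt n (S n))) by lia.
    rewrite (rsum_ext n (fun b => below b (S n) * f b) f); [lra|].
    intros k Hk; unfold below. rewrite (proj2 (Nat.ltb_lt k (S n))) by lia; lra.
  + rewrite IH by lia. unfold below. rewrite (proj2 (Nat.ltb_ge n j)) by lia; lra.
Qed.

Definition cross (i i' q : nat) : R :=
  if andb (i =? q)%nat (i' =? S q)%nat then 1
  else if andb (i =? S q)%nat (i' =? q)%nat then -1 else 0.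

(** Equality is allowed, because consecutive samples of a loop may fall into the same grid column or
    row. *)
Definition adjacent (i i' : nat) : Prop := (i' <= S i /\ i <= S i')%nat.

(** A diagonal move is split into a horizontal leg at the old height [j] and then a vertical leg;
    this is why [crossings] tests the height [J k] and not [J (S k)]. *)
Definition grid_step (b : nat -> nat -> C) (i j i' j' : nat) : R :=
  ang (b i j) (b i' j) + ang (b i' j) (b i' j').

Definition curl (b : nat -> nat -> C) (i j : nat) : R :=
  ang (b i j) (b (S i) j) + ang (b (S i) j) (b (S i) (S j))
  - ang (b i (S j)) (b (S i) (S j)) - ang (b i j) (b i (S j)).

(* Signed number of crossings, by the closed grid path (I, J), of the vertical
   ray going up from the centre of the square (q, p). *)
Definition crossings (m : nat) (I J : nat -> nat) (q p : nat) : R :=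
  rsum m (fun k => cross (I k) (I (S k)) q * below p (J k)).

(** Holds for junk values too, since [atan] is odd. Hence the discrete Stokes formula built on it is
    an algebraic identity that also covers junk angles. *)
Lemma ang_antisym z w : ang w z = - ang z w.
Proof.
unfold ang. rewrite <- atan_opp. f_equal.
replace (cdet w z) with (- cdet z w) by (unfold cdet; ring).
replace (cdot w z) with (cdot z w) by (unfold cdot; ring).
unfold Rdiv; ring.
Qed.

Lemma ang_refl z : ang z z = 0.
Proof.
unfold ang. replace (cdet z z) with 0 by (unfold cdet; ring).
unfold Rdiv; rewrite Rmult_0_l; apply atan_0.
Qed.

(** Angles summed along the bottom row to column [i] and then up that column. It is exact on
    vertical steps by construction; on horizontal steps the curls of the squares beneath appear as
    the defect. *)
Definition potential (b : nat -> nat -> C) (i j : nat) : R :=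
  rsum i (fun a => ang (b a 0%nat) (b (S a) 0%nat))
  + rsum j (fun c => ang (b i c) (b i (S c))).

Lemma potential_vertical b i j j' : adjacent j j' ->
  potential b i j' - potential b i j = ang (b i j) (b i j').
Proof.
intros [H1 H2]. unfold potential.
destruct (Compare_dec.lt_eq_lt_dec j j') as [[H|H]|H].
- replace j' with (S j) by lia; simpl; lra.
- subst; rewrite ang_refl; lra.
- replace j with (S j') by lia; simpl. rewrite (ang_antisym (b i j') (b i (S j'))); lra.
Qed.

(** Discrete Stokes on the strip between two columns: each further square replaces its lower edge by
    its upper one. *)
Lemma potential_right b i j :
  potential b (S i) j - potential b i j =
    ang (b i j) (b (S i) j) + rsum j (fun c => curl b i c).
Proof.
unfold potential; simpl. induction j as [|j IH]; simpl; [lra|].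
unfold curl at 2. lra.
Qed.

Lemma cross_right i : cross i (S i) i = 1.
Proof. unfold cross; now rewrite !Nat.eqb_refl. Qed.

Lemma cross_left i : cross (S i) i i = -1.
Proof.
unfold cross. rewrite (proj2 (Nat.eqb_neq (S i) i)) by lia.
now rewrite !Nat.eqb_refl.
Qed.

Lemma cross_other i i' q :
  ~ (i = q /\ i' = S q) -> ~ (i = S q /\ i' = q) -> cross i i' q = 0.
Proof.
intros H1 H2; unfold cross.
destruct (andb (i =? q)%nat (i' =? S q)%nat) eqn:E1.
- apply andb_prop in E1; rewrite !Nat.eqb_eq in E1; tauto.
- destruct (andb (i =? S q)%nat (i' =? q)%nat) eqn:E2; auto.
  apply andb_prop in E2; rewrite !Nat.eqb_eq in E2; tauto.
Qed.

Lemma cross_sum n i i' f : (i <= n)%nat -> (i' <= n)%nat -> adjacent i i' ->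
  rsum n (fun q => cross i i' q * f q) =
    if (i <? i')%nat then f i else if (i' <? i)%nat then - f i' else 0.
Proof.
intros H1 H2 [H3 H4].
destruct (Compare_dec.lt_eq_lt_dec i i') as [[H|H]|H].
- rewrite (proj2 (Nat.ltb_lt _ _) H).
  replace i' with (S i) in * by lia.
  rewrite (rsum_single _ _ i); [rewrite cross_right; lra|lia|].
  intros k Hk Hki; rewrite cross_other; [lra| |]; lia.
- subst. rewrite Nat.ltb_irrefl. apply rsum_zero; intros k Hk.
  rewrite cross_other; [lra| |]; lia.
- rewrite (proj2 (Nat.ltb_ge i i')) by lia. rewrite (proj2 (Nat.ltb_lt _ _) H).
  replace i with (S i') in * by lia.
  rewrite (rsum_single _ _ i'); [rewrite cross_left; lra|lia|].
  intros k Hk Hki; rewrite cross_other; [lra| |]; lia.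
Qed.

(** The double sum runs over the whole grid, with [cross] and [below] selecting the squares beneath
    the horizontal leg. Its range is thus the same for all steps, and [grid_stokes] can exchange
    sums. *)
Lemma potential_step b n i j i' j' :
  (i <= n)%nat -> (i' <= n)%nat -> (j <= n)%nat ->
  adjacent i i' -> adjacent j j' ->
  grid_step b i j i' j' =
    potential b i' j' - potential b i j
    - rsum n (fun q => cross i i' q * rsum n (fun p => below p j * curl b q p)).
Proof.
intros Hi Hi' Hj Ai Aj.
rewrite (rsum_ext n _ (fun q => cross i i' q * rsum j (fun p => curl b q p))).
2:{ intros k Hk; now rewrite rsum_below. }
rewrite (cross_sum n i i' (fun q => rsum j (fun p => curl b q p))); auto.
unfold grid_step. rewrite <- (potential_vertical b i' j j' Aj).
destruct Ai as [A1 A2]. destruct (Compare_dec.lt_eq_lt_dec i i') as [[H|H]|H].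
- rewrite (proj2 (Nat.ltb_lt _ _) H). replace i' with (S i) in * by lia.
  assert (P := potential_right b i j). lra.
- subst; rewrite Nat.ltb_irrefl, ang_refl; lra.
- rewrite (proj2 (Nat.ltb_ge i i')) by lia. rewrite (proj2 (Nat.ltb_lt _ _) H).
  replace i with (S i') in * by lia.
  rewrite (ang_antisym (b i' j)). assert (P := potential_right b i' j). lra.
Qed.

(** Around a closed path the potential telescopes to zero, and exchanging the sums collects, for
    each square, its curl times [crossings]. The alternative in the last hypothesis tolerates any
    curl at squares with crossing number zero. *)
Lemma grid_stokes b n m (I J : nat -> nat) :
  (forall k, (k <= m)%nat -> (I k <= n)%nat /\ (J k <= n)%nat) ->
  (forall k, (k < m)%nat -> adjacent (I k) (I (S k)) /\ adjacent (J k) (J (S k))) ->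
  I m = I 0%nat -> J m = J 0%nat ->
  (forall q p, (q < n)%nat -> (p < n)%nat -> curl b q p = 0 \/ crossings m I J q p = 0) ->
  rsum m (fun k => grid_step b (I k) (J k) (I (S k)) (J (S k))) = 0.
Proof.
intros Hb Ha HI HJ Hc.
rewrite (rsum_ext m _ (fun k =>
  (potential b (I (S k)) (J (S k)) - potential b (I k) (J k)) +
  (-1) * rsum n (fun q => rsum n (fun p =>
     cross (I k) (I (S k)) q * below p (J k) * curl b q p)))).
2:{ intros k Hk. destruct (Ha k Hk) as [A1 A2].
    rewrite (potential_step b n); auto; try apply Hb; try lia.
    rewrite (rsum_ext n (fun q => rsum n (fun p =>
      cross (I k) (I (S k)) q * below p (J k) * curl b q p))
      (fun q => cross (I k) (I (S k)) q * rsum n (fun p => below p (J k) * curl b q p))).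
    - lra.
    - intros q Hq. rewrite <- rsum_scal. apply rsum_ext; intros; ring. }
rewrite rsum_plus, (rsum_telescope m (fun k => potential b (I k) (J k))), rsum_scal.
rewrite HI, HJ. rewrite rsum_exchange.
rewrite rsum_zero; [lra|]. intros q Hq. rewrite rsum_exchange.
apply rsum_zero; intros p Hp.
rewrite (rsum_ext m _ (fun k => curl b q p * (cross (I k) (I (S k)) q * below p (J k))))
  by (intros; ring).
rewrite rsum_scal. fold (crossings m I J q p).
destruct (Hc q p Hq Hp) as [-> | ->]; lra.
Qed.

(** The argument measured from the downward direction [(0, -1)]. Its jump by 2 pi then lies on the
    upward vertical ray, the one whose crossings are counted. The value at [x = 0] is junk and never
    arises at grid vertices seen from the centre of a square. *)
Definition cut_arg (x y : R) : R :=
  (if Rlt_dec 0 x then PI / 2 else - (PI / 2)) + atan (y / x).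

Lemma is_angle_cut_arg x y : x <> 0 -> is_angle (0, -1) (x, y) (cut_arg x y).
Proof.
intros Hx. unfold cut_arg.
set (q := y / x). assert (Hy : y = x * q) by (unfold q; field; auto).
clearbody q; subst y.
assert (Hc : 0 < cos (atan q)) by (generalize (atan_bound q); intros; apply cos_gt_0; lra).
assert (T := tan_atan q); unfold tan in T.
assert (Sq : sin (atan q) = q * cos (atan q)) by (rewrite <- T at 2; field; lra).
unfold is_angle, cdot, cdet; simpl.
destruct (Rlt_dec 0 x).
- exists (x / cos (atan q)); repeat split.
  + now apply Rdiv_lt_0_compat.
  + rewrite cos_plus, cos_PI2, sin_PI2, Sq; field; lra.
  + rewrite sin_plus, cos_PI2, sin_PI2; field; lra.
- exists (- x / cos (atan q)); repeat split.
  + apply Rdiv_lt_0_compat; lra.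
  + rewrite cos_plus, cos_neg, sin_neg, cos_PI2, sin_PI2, Sq; field; lra.
  + rewrite sin_plus, cos_neg, sin_neg, cos_PI2, sin_PI2; field; lra.
Qed.

Lemma ang_cut_same_side x y x' y' : 0 < x * x' -> 0 < cdot (x, y) (x', y') ->
  ang (x, y) (x', y') = cut_arg x' y' - cut_arg x y.
Proof.
intros Hx Hd.
assert (x <> 0) by nra. assert (x' <> 0) by nra.
apply is_angle_unique with (x, y) (x', y').
- now apply is_angle_ang.
- replace (cut_arg x' y' - cut_arg x y) with (- cut_arg x y + cut_arg x' y') by ring.
  apply is_angle_trans with (0, -1); [apply is_angle_sym|]; now apply is_angle_cut_arg.
- generalize (ang_bound (x, y) (x', y')), (atan_bound (y / x)), (atan_bound (y' / x')).
  unfold cut_arg; intros; apply Rabs_def1; destruct (Rlt_dec 0 x), (Rlt_dec 0 x'); nra || lra.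
Qed.

(* Going right above the branch point crosses the cut, going right below it
   does not. *)
Lemma ang_cut_right x y x' : x < 0 < x' -> y <> 0 -> 0 < cdot (x, y) (x', y) ->
  ang (x, y) (x', y) =
    cut_arg x' y - cut_arg x y - (if Rlt_dec 0 y then 2 * PI else 0).
Proof.
intros Hx Hy Hd.
apply is_angle_unique with (x, y) (x', y).
- now apply is_angle_ang.
- assert (H : is_angle (x, y) (x', y) (- cut_arg x y + cut_arg x' y)).
  { apply is_angle_trans with (0, -1); [apply is_angle_sym|]; apply is_angle_cut_arg; lra. }
  destruct H as (r & Hr & H1 & H2). exists r; repeat split; auto.
  + rewrite H1; f_equal. destruct (Rlt_dec 0 y).
    * replace (- cut_arg x y + cut_arg x' y)
        with (cut_arg x' y - cut_arg x y - 2 * PI + 2 * INR 1 * PI) by (simpl; ring).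
      apply cos_period.
    * f_equal; ring.
  + rewrite H2; f_equal. destruct (Rlt_dec 0 y).
    * replace (- cut_arg x y + cut_arg x' y)
        with (cut_arg x' y - cut_arg x y - 2 * PI + 2 * INR 1 * PI) by (simpl; ring).
      apply sin_period.
    * f_equal; ring.
- assert (B := ang_bound (x, y) (x', y)).
  assert (B1 := atan_bound (y / x)); assert (B2 := atan_bound (y / x')).
  assert (I1 : 0 < / x') by (apply Rinv_0_lt_compat; lra).
  assert (I2 : / x < 0) by (apply Rinv_lt_0_compat; lra).
  unfold cut_arg. destruct (Rlt_dec 0 x); [lra|]. destruct (Rlt_dec 0 x'); [|lra].
  destruct (Rlt_dec 0 y).
  + assert (0 < atan (y / x')) by (rewrite <- atan_0; apply atan_increasing; unfold Rdiv; nra).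
    assert (atan (y / x) < 0) by (rewrite <- atan_0; apply atan_increasing; unfold Rdiv; nra).
    apply Rabs_def1; lra.
  + assert (atan (y / x') < 0) by (rewrite <- atan_0; apply atan_increasing; unfold Rdiv; nra).
    assert (0 < atan (y / x)) by (rewrite <- atan_0; apply atan_increasing; unfold Rdiv; nra).
    apply Rabs_def1; lra.
Qed.

(** The halves place the origin at the centre of the square, so that no vertex has a vanishing
    coordinate and none lies on the cut. *)
Definition from_centre (h : R) (q p i j : nat) : C :=
  (h * (INR i - INR q - / 2), h * (INR j - INR p - / 2)).

Lemma half_shift_sign h i q : 0 < h ->
  ((i <= q)%nat -> h * (INR i - INR q - / 2) < 0) /\
  ((q < i)%nat -> 0 < h * (INR i - INR q - / 2)).
Proof.
intros Hh; split; intros H.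
- apply le_INR in H; nra.
- apply le_INR in H; rewrite S_INR in H; nra.
Qed.

(** The vertical leg keeps its horizontal coordinate, hence its side of the cut, so only the
    horizontal leg can produce a jump. *)
Lemma from_centre_step h q p i j i' j' :
  0 < h -> adjacent i i' -> adjacent j j' ->
  0 < cdot (from_centre h q p i j) (from_centre h q p i' j) ->
  0 < cdot (from_centre h q p i' j) (from_centre h q p i' j') ->
  grid_step (from_centre h q p) i j i' j' =
    cut_arg (h * (INR i' - INR q - / 2)) (h * (INR j' - INR p - / 2))
    - cut_arg (h * (INR i - INR q - / 2)) (h * (INR j - INR p - / 2))
    - 2 * PI * (cross i i' q * below p j).
Proof.
intros Hh Ai Aj H1 H2. unfold grid_step.
assert (Si := half_shift_sign h i q Hh); assert (Si' := half_shift_sign h i' q Hh).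
assert (Sj := half_shift_sign h j p Hh).
unfold from_centre in *.
set (x := h * (INR i - INR q - / 2)) in *.
set (x' := h * (INR i' - INR q - / 2)) in *.
set (y := h * (INR j - INR p - / 2)) in *.
set (y' := h * (INR j' - INR p - / 2)) in *.
rewrite (ang_cut_same_side x' y x' y'); [| |exact H2].
2:{ destruct (Nat.le_gt_cases i' q) as [L|L];
    [apply (proj1 Si') in L | apply (proj2 Si') in L]; nra. }
assert (Hy : (if Rlt_dec 0 y then 2 * PI else 0) = 2 * PI * below p j).
{ unfold below. destruct (Nat.ltb_spec p j) as [L|L].
  - apply (proj2 Sj) in L. destruct Rlt_dec; [ring|lra].
  - apply (proj1 Sj) in L. destruct Rlt_dec; [lra|ring]. }
assert (Hy0 : y <> 0).
{ destruct (Nat.le_gt_cases j p) as [L|L];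
  [apply (proj1 Sj) in L | apply (proj2 Sj) in L]; lra. }
assert (Cases : (i <= q /\ i' <= q \/ i = q /\ i' = S q \/ i = S q /\ i' = q
   \/ q < i /\ q < i')%nat) by (unfold adjacent in *; lia).
destruct Cases as [[L L']|[[L L']|[[L L']|[L L']]]].
- rewrite cross_other by lia.
  apply (proj1 Si) in L; apply (proj1 Si') in L'.
  rewrite ang_cut_same_side; auto; [lra|nra].
- assert (x < 0) by (apply Si; lia). assert (0 < x') by (apply Si'; lia).
  rewrite L, L', cross_right, ang_cut_right, Hy; auto; lra.
- assert (0 < x) by (apply Si; lia). assert (x' < 0) by (apply Si'; lia).
  rewrite L, L', cross_left, ang_antisym, ang_cut_right, Hy; auto; [lra|].
  unfold cdot in *; simpl in *; lra.
- rewrite cross_other by lia.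
  apply (proj2 Si) in L; apply (proj2 Si') in L'.
  rewrite ang_cut_same_side; auto; [lra|nra].
Qed.

(** The values of [cut_arg] telescope and only the jumps remain. The sign is negative because
    passing above the centre from left to right is clockwise. *)
Lemma crossings_winding h q p m (I J : nat -> nat) :
  0 < h ->
  (forall k, (k < m)%nat -> adjacent (I k) (I (S k)) /\ adjacent (J k) (J (S k))) ->
  I m = I 0%nat -> J m = J 0%nat ->
  (forall k, (k < m)%nat ->
     0 < cdot (from_centre h q p (I k) (J k)) (from_centre h q p (I (S k)) (J k)) /\
     0 < cdot (from_centre h q p (I (S k)) (J k))
              (from_centre h q p (I (S k)) (J (S k)))) ->
  rsum m (fun k => grid_step (from_centre h q p) (I k) (J k) (I (S k)) (J (S k)))
    = - (2 * PI) * crossings m I J q p.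
Proof.
intros Hh Ha HI HJ Hd.
set (g := fun k => cut_arg (h * (INR (I k) - INR q - / 2)) (h * (INR (J k) - INR p - / 2))).
rewrite (rsum_ext m _ (fun k => (g (S k) - g k)
   + - (2 * PI) * (cross (I k) (I (S k)) q * below p (J k)))).
2:{ intros k Hk. destruct (Ha k Hk), (Hd k Hk).
    rewrite from_centre_step; auto. unfold g; lra. }
rewrite rsum_plus, rsum_telescope, rsum_scal. unfold g; rewrite HI, HJ.
unfold crossings; lra.
Qed.

(** Only differences of [theta] are tied to [E], so no initial argument has to be chosen and a
    running integral that starts at 0 qualifies. Continuity is asked on the whole line, as the
    intermediate value theorem used below wants it. *)
Definition phase_lift (E : R -> C) (theta : R -> R) : Prop :=
  (forall s s', 0 <= s <= 1 -> 0 <= s' <= 1 ->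
     is_angle (E s) (E s') (theta s' - theta s)) /\
  (forall s, continuity_pt theta s).

(* An angle that stays within a cone of half-width pi/4 cannot wind. *)
Lemma phase_lift_near E theta a c :
  phase_lift E theta -> 0 <= a <= c -> c <= 1 ->
  (forall s, a <= s <= c -> near (E a) (E s)) ->
  theta c - theta a = ang (E a) (E c).
Proof.
intros [HE Hc] Ha Hc1 Hn.
assert (B : forall s, a <= s <= c -> Rabs (theta s - theta a) < PI / 2).
{ intros s Hs. destruct (Rlt_le_dec (Rabs (theta s - theta a)) (PI / 2)) as [L|L]; auto.
  exfalso.
  assert (Hcont : continuity (fun u => Rabs (theta u - theta a))).
  { intros u. apply (continuity_pt_comp (fun u => theta u - theta a) Rabs).
    - apply continuity_pt_minus; [apply Hc|]. apply continuity_pt_const; intros ? ?; auto.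
    - apply Rcontinuity_abs. }
  assert (PP := PI_RGT_0).
  (* Where the lift has moved by exactly pi/2 the cosine vanishes, against the positive [cdot] that
     [near] guarantees. *)
  destruct (IVT_gen _ a s (PI / 2) Hcont) as (u & Hu & Eu).
  { rewrite Rminus_diag, Rabs_R0 || (replace (theta a - theta a) with 0 by ring; rewrite Rabs_R0).
    rewrite Rmin_left, Rmax_right; lra. }
  rewrite Rmin_left, Rmax_right in Hu by lra.
  destruct (HE a u) as (r & Hr & H1 & H2); [lra|lra|].
  assert (Hp := near_pos _ _ (Hn u ltac:(lra))).
  rewrite H1 in Hp.
  assert (cos (theta u - theta a) = 0).
  { revert Eu; unfold Rabs; destruct Rcase_abs; intros Eu.
    - rewrite <- cos_neg, Eu; apply cos_PI2.
    - rewrite Eu; apply cos_PI2. }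
  rewrite H in Hp; lra. }
apply is_angle_ang_unique; [apply Hn; lra|apply HE; lra|].
assert (PP := PI_RGT_0). specialize (B c ltac:(lra)). lra.
Qed.

(** In the application [b k] is the field at the grid vertex assigned to the sample [k/m], and [c k]
    the field at the corner of the L-shaped step. Correcting [theta] by the angle from each sample
    to its vertex gives [phi], a lift along the vertices with the same total change, because the
    corrections at both ends agree. *)
Lemma winding_by_sampling E theta m (b c : nat -> C) :
  (0 < m)%nat ->
  phase_lift E theta ->
  (forall k s s', (k < m)%nat -> INR k / INR m <= s <= INR (S k) / INR m ->
     INR k / INR m <= s' <= INR (S k) / INR m -> near (E s) (E s')) ->
  (forall k, (k <= m)%nat -> near (E (INR k / INR m)) (b k)) ->
  (forall k, (k < m)%nat -> near (b k) (c k) /\ near (c k) (b (S k))) ->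
  E 1 = E 0 -> b m = b 0%nat ->
  rsum m (fun k => ang (b k) (c k) + ang (c k) (b (S k))) = theta 1 - theta 0.
Proof.
intros Hm HL HE Hb Hc HE1 Hbm.
assert (PP := PI_RGT_0).
assert (Mp : 0 < INR m) by (apply lt_0_INR; auto).
set (t := fun k => INR k / INR m).
assert (T01 : forall k, (k <= m)%nat -> 0 <= t k <= 1).
{ intros k Hk; unfold t; split.
  - apply Rdiv_le_0_compat; auto. apply pos_INR.
  - apply le_INR in Hk. apply Rmult_le_reg_r with (INR m); auto.
    unfold Rdiv; rewrite Rmult_assoc, Rinv_l; lra. }
set (phi := fun k => theta (t k) + ang (E (t k)) (b k)).
assert (St : forall k, t k <= t (S k)).
{ intros k; unfold t, Rdiv; apply Rmult_le_compat_r.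
  - left; now apply Rinv_0_lt_compat.
  - rewrite S_INR; lra. }
rewrite (rsum_ext m _ (fun k => phi (S k) - phi k)).
- rewrite rsum_telescope. unfold phi.
  assert (t m = 1) by (unfold t; field; lra).
  assert (t 0%nat = 0) by (unfold t; simpl; field; lra).
  rewrite H, H0, HE1, Hbm. ring.
- intros k Hk. destruct (Hc k Hk) as [N1 N2].
  assert (N0 := Hb k ltac:(lia)). assert (N3 := Hb (S k) ltac:(lia)).
  fold (t k) in N0; fold (t (S k)) in N3.
  assert (NE : near (E (t k)) (E (t (S k)))).
  { apply HE with k; auto; specialize (St k); unfold t in *; lra. }
  assert (D : theta (t (S k)) - theta (t k) = ang (E (t k)) (E (t (S k)))).
  { apply phase_lift_near; auto.
    - split; [apply T01; lia|apply St].
    - apply T01; lia.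
    - intros s Hs; apply HE with k; auto; specialize (St k); unfold t in *; lra. }
  symmetry.
  apply is_angle_unique with (b k) (b (S k)).
  + unfold phi.
    replace (theta (t (S k)) + ang (E (t (S k))) (b (S k))
              - (theta (t k) + ang (E (t k)) (b k)))
      with (- ang (E (t k)) (b k) + (ang (E (t k)) (E (t (S k)))
              + ang (E (t (S k))) (b (S k)))) by lra.
    apply is_angle_trans with (E (t k)); [apply is_angle_sym|];
      [|apply is_angle_trans with (E (t (S k)))]; apply is_angle_ang, near_pos; auto.
  + apply is_angle_trans with (c k); apply is_angle_ang, near_pos; auto.
  (* Three near angles make up the change of [phi] and two make up the step, so the two sides differ
     by less than 5 pi/4. *)
  + unfold phi.
    apply near_ang in N0, N1, N2, N3, NE. rewrite <- D in NE.
    apply Rabs_def1; lra.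
Qed.

(** * Loops that do not wind around an outer point *)

(** Connectedness of the unit interval, in the direction used later: from the far end of an escape
    path back to its start. *)
Lemma clopen_interval (S : R -> Prop) :
  (forall r, 0 <= r <= 1 -> exists d, 0 < d /\
     forall r', 0 <= r' <= 1 -> Rabs (r' - r) < d -> (S r <-> S r')) ->
  S 1 -> S 0.
Proof.
intros Hloc H1. apply NNPP; intros H0.
set (Z := fun r => 0 <= r <= 1 /\ ~ S r).
destruct (completeness Z) as (c & Hub & Hlub).
- exists 1; intros r [Hr _]; lra.
- exists 0; split; [lra|auto].
- assert (C0 : 0 <= c) by (apply Hub; split; [lra|auto]).
  assert (C1 : c <= 1) by (apply Hlub; intros r [Hr _]; lra).
  destruct (Hloc c ltac:(lra)) as (d & Hd & Hc).
  assert (Nc : ~ S c).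
  { intros Sc. assert (c <= c - d / 2); [|lra].
    apply Hlub; intros r [Hr Nr]. destruct (Rle_lt_dec r (c - d / 2)); auto.
    exfalso; apply Nr. apply (Hc r Hr); auto.
    assert (r <= c) by (apply Hub; split; auto).
    apply Rabs_def1; lra. }
  destruct (Req_dec c 1) as [->|E]; [tauto|].
  set (r := Rmin 1 (c + d / 2)).
  assert (Hr : c < r) by (unfold r; apply Rmin_glb_lt; lra).
  assert (R1 : r <= 1) by apply Rmin_l. assert (R2 : r <= c + d / 2) by apply Rmin_r.
  assert (~ S r).
  { intros Sr; apply Nc; apply (Hc r); auto; [lra|apply Rabs_def1; lra]. }
  assert (r <= c) by (apply Hub; split; auto; lra). lra.
Qed.

(** For [a <= b], the nearest point of the interval, written with absolute values so that continuity
    is immediate. It extends functions on the interval by constants, which makes them continuous on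
    the whole line. *)
Definition clamp (a b s : R) : R := (Rabs (s - a) - Rabs (s - b) + (a + b)) / 2.

Lemma clamp_id a b s : a <= s <= b -> clamp a b s = s.
Proof. intros H; unfold clamp, Rabs; destruct Rcase_abs, Rcase_abs; lra. Qed.

Lemma clamp_left a b s : a <= b -> s <= a -> clamp a b s = a.
Proof. intros; unfold clamp, Rabs; destruct Rcase_abs, Rcase_abs; lra. Qed.

Lemma clamp_right a b s : a <= b -> b <= s -> clamp a b s = b.
Proof. intros; unfold clamp, Rabs; destruct Rcase_abs, Rcase_abs; lra. Qed.

Lemma clamp_range a b s : a <= b -> a <= clamp a b s <= b.
Proof. intros; unfold clamp, Rabs; destruct Rcase_abs, Rcase_abs; lra. Qed.

Lemma continuity_pt_clamp a b s : continuity_pt (clamp a b) s.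
Proof.
assert (Ca : forall c, continuity_pt (fun u => Rabs (u - c)) s).
{ intros c. apply (continuity_pt_comp (fun u => u - c) Rabs); [reg|apply Rcontinuity_abs]. }
unfold clamp, Rdiv. apply continuity_pt_mult; [|apply continuity_pt_const; intros ? ?; auto].
apply continuity_pt_plus; [|apply continuity_pt_const; intros ? ?; auto].
apply continuity_pt_minus; auto.
Qed.

Lemma continuity_pt_cdot (E F : R -> C) s :
  continuity_pt (fun u => fst (E u)) s -> continuity_pt (fun u => snd (E u)) s ->
  continuity_pt (fun u => fst (F u)) s -> continuity_pt (fun u => snd (F u)) s ->
  continuity_pt (fun u => cdot (E u) (F u)) s.
Proof.
intros; unfold cdot; apply continuity_pt_plus; apply continuity_pt_mult; auto.
Qed.

Lemma continuity_pt_cdet (E F : R -> C) s :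
  continuity_pt (fun u => fst (E u)) s -> continuity_pt (fun u => snd (E u)) s ->
  continuity_pt (fun u => fst (F u)) s -> continuity_pt (fun u => snd (F u)) s ->
  continuity_pt (fun u => cdet (E u) (F u)) s.
Proof.
intros; unfold cdet; apply continuity_pt_minus; apply continuity_pt_mult; auto.
Qed.

(** [F] stays in the open half plane around [E], so adding the angle from [E] to [F] to the lift of
    [E] is unambiguous and continuous. For closed loops this correction is the same at both ends. *)
Lemma phase_lift_transfer (E F : R -> C) theta :
  (forall s, continuity_pt (fun u => fst (E u)) s) ->
  (forall s, continuity_pt (fun u => snd (E u)) s) ->
  (forall s, continuity_pt (fun u => fst (F u)) s) ->
  (forall s, continuity_pt (fun u => snd (F u)) s) ->
  (forall s, 0 < cdot (E s) (F s)) -> E 1 = E 0 -> F 1 = F 0 ->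
  phase_lift E theta ->
  exists theta', phase_lift F theta' /\ theta' 1 - theta' 0 = theta 1 - theta 0.
Proof.
intros E1 E2 F1 F2 Hd HE HF [HL Hc].
exists (fun s => theta s + ang (E s) (F s)); split; [split|].
- intros s s' Hs Hs'.
  replace (theta s' + ang (E s') (F s') - (theta s + ang (E s) (F s)))
    with (- ang (E s) (F s) + ((theta s' - theta s) + ang (E s') (F s'))) by ring.
  apply is_angle_trans with (E s); [apply is_angle_sym, is_angle_ang; auto|].
  apply is_angle_trans with (E s'); [auto|apply is_angle_ang; auto].
- intros s. apply continuity_pt_plus; auto.
  apply (continuity_pt_comp (fun u => cdet (E u) (F u) / cdot (E u) (F u)) atan).
  + apply continuity_pt_div; [apply continuity_pt_cdet; auto|apply continuity_pt_cdot; auto|].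
    specialize (Hd s); lra.
  + apply derivable_continuous_pt, derivable_pt_atan.
- rewrite HE, HF; ring.
Qed.

(** The clause with [clamp] freezes the curve outside the unit interval, so that bounds obtained
    there by compactness hold for all real parameters. *)
Definition continuous_loop (X T : R -> R) : Prop :=
  (forall s, continuity_pt X s) /\ (forall s, continuity_pt T s) /\
  (forall s, X s = X (clamp 0 1 s) /\ T s = T (clamp 0 1 s)) /\ X 1 = X 0 /\ T 1 = T 0.

Definition seen_from (X T : R -> R) (x t s : R) : C := (X s - x, T s - t).

Lemma loop_distance X T x t : continuous_loop X T ->
  (forall s, 0 <= s <= 1 -> (X s, T s) <> (x, t)) ->
  exists mu, 0 < mu /\ forall s, mu <= Rabs (X s - x) + Rabs (T s - t).
Proof.
intros (HX & HT & Hcl & _) Hoff.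
destruct (continuity_ab_min (fun s => Rabs (X s - x) + Rabs (T s - t)) 0 1)
  as (s0 & Hmin & Hs0); [lra| |].
- intros s _. apply continuity_pt_plus.
  + apply (continuity_pt_comp (fun u => X u - x) Rabs); [|apply Rcontinuity_abs].
    apply continuity_pt_minus; auto. apply continuity_pt_const; intros ? ?; auto.
  + apply (continuity_pt_comp (fun u => T u - t) Rabs); [|apply Rcontinuity_abs].
    apply continuity_pt_minus; auto. apply continuity_pt_const; intros ? ?; auto.
- exists (Rabs (X s0 - x) + Rabs (T s0 - t)); split.
  + assert (P1 := Rabs_pos (X s0 - x)); assert (P2 := Rabs_pos (T s0 - t)).
    destruct (Req_dec (X s0 - x) 0) as [Q1|Q1].
    * destruct (Req_dec (T s0 - t) 0) as [Q2|Q2].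
      -- exfalso; apply (Hoff s0 Hs0). f_equal; lra.
      -- apply Rabs_pos_lt in Q2; lra.
    * apply Rabs_pos_lt in Q1; lra.
  + intros s. destruct (Hcl s) as [-> ->]. apply Hmin, clamp_range; lra.
Qed.

Lemma loop_bounded X T : continuous_loop X T ->
  exists S, 0 <= S /\ forall s, Rabs (X s) + Rabs (T s) <= S.
Proof.
intros (HX & HT & Hcl & _).
destruct (continuity_ab_maj (fun s => Rabs (X s) + Rabs (T s)) 0 1)
  as (s0 & Hmax & Hs0); [lra| |].
- intros s _. apply continuity_pt_plus.
  + apply (continuity_pt_comp X Rabs); auto; apply Rcontinuity_abs.
  + apply (continuity_pt_comp T Rabs); auto; apply Rcontinuity_abs.
- exists (Rabs (X s0) + Rabs (T s0)); split.
  + generalize (Rabs_pos (X s0)), (Rabs_pos (T s0)); lra.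
  + intros s. destruct (Hcl s) as [-> ->]. apply Hmax, clamp_range; lra.
Qed.

Lemma seen_from_continuous X T x t : continuous_loop X T ->
  (forall s, continuity_pt (fun u => fst (seen_from X T x t u)) s) /\
  (forall s, continuity_pt (fun u => snd (seen_from X T x t u)) s) /\
  seen_from X T x t 1 = seen_from X T x t 0.
Proof.
intros (HX & HT & _ & E1 & E2); unfold seen_from; simpl; repeat split.
- intros s; apply continuity_pt_minus; auto; apply continuity_pt_const; intros ? ?; auto.
- intros s; apply continuity_pt_minus; auto; apply continuity_pt_const; intros ? ?; auto.
- now rewrite E1, E2.
Qed.

Lemma sqr_Rabs x : x * x = Rabs x * Rabs x.
Proof. symmetry; rewrite <- Rabs_mult; apply Rabs_pos_eq, Rle_0_sqr. Qed.

Lemma dot_bound a b u v mu :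
  mu <= Rabs u + Rabs v -> 0 < mu -> Rabs a + Rabs b < mu / 2 ->
  0 < u * (u - a) + v * (v - b).
Proof.
intros H1 H2 H3.
assert (A : u * a <= Rabs u * Rabs a) by (rewrite <- Rabs_mult; apply Rle_abs).
assert (B : v * b <= Rabs v * Rabs b) by (rewrite <- Rabs_mult; apply Rle_abs).
assert (U : u * u = Rabs u * Rabs u) by apply sqr_Rabs.
assert (V : v * v = Rabs v * Rabs v) by apply sqr_Rabs.
generalize (Rabs_pos u), (Rabs_pos v), (Rabs_pos a), (Rabs_pos b); intros.
set (U' := Rabs u) in *; set (V' := Rabs v) in *.
set (A' := Rabs a) in *; set (B' := Rabs b) in *.
assert (U' * A' + V' * B' <= (U' + V') * (A' + B')) by nra.
assert ((U' + V') * (A' + B') < (U' + V') * (mu / 2)) by (apply Rmult_lt_compat_l; lra).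
assert ((U' + V') * (mu / 2) <= (U' + V') * ((U' + V') / 2)) by (apply Rmult_le_compat_l; lra).
assert (D := Rle_0_sqr (U' - V')); unfold Rsqr in D.
assert ((U' + V') * ((U' + V') / 2) <= U' * U' + V' * V') by lra.
lra.
Qed.

(** Having a lift with equal ends is an open and closed condition along the escape path, because a
    small shift of the viewpoint allows [phase_lift_transfer] in both directions. It holds at the
    far end, so it holds at the start. *)
Lemma no_winding_from_outside X T (P Q : R -> R) S :
  continuous_loop X T ->
  (forall s, Rabs (X s) + Rabs (T s) <= S) -> 0 <= S ->
  (forall r, continuity_pt P r) -> (forall r, continuity_pt Q r) ->
  (forall r s, 0 <= r <= 1 -> 0 <= s <= 1 -> (X s, T s) <> (P r, Q r)) ->
  2 * S < Rabs (P 1) + Rabs (Q 1) ->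
  exists theta, phase_lift (seen_from X T (P 0) (Q 0)) theta /\ theta 1 = theta 0.
Proof.
intros HL HS S0 HP HQ Hoff Hfar.
apply (clopen_interval (fun r =>
  exists theta, phase_lift (seen_from X T (P r) (Q r)) theta /\ theta 1 = theta 0)).
- intros r Hr.
  destruct (loop_distance X T (P r) (Q r) HL) as (mu & Hmu & Hd); [auto|].
  destruct (HP r (mu / 4)) as (d1 & Hd1 & H1); [lra|].
  destruct (HQ r (mu / 4)) as (d2 & Hd2 & H2); [lra|].
  exists (Rmin d1 d2); split; [now apply Rmin_glb_lt|]. intros r' Hr' Hrr.
  assert (L1 := Rmin_l d1 d2); assert (L2 := Rmin_r d1 d2).
  assert (HPr : Rabs (P r' - P r) < mu / 4).
  { destruct (Req_dec r r') as [->|N]; [rewrite Rminus_diag, Rabs_R0; lra|].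
    apply (H1 r'); split; [split; [exact I|auto]|]. simpl; unfold Rdist; lra. }
  assert (HQr : Rabs (Q r' - Q r) < mu / 4).
  { destruct (Req_dec r r') as [->|N]; [rewrite Rminus_diag, Rabs_R0; lra|].
    apply (H2 r'); split; [split; [exact I|auto]|]. simpl; unfold Rdist; lra. }
  assert (Hpos : forall s, 0 < cdot (seen_from X T (P r) (Q r) s)
                                    (seen_from X T (P r') (Q r') s)).
  { intros s; unfold cdot, seen_from; simpl.
    replace (X s - P r') with ((X s - P r) - (P r' - P r)) by ring.
    replace (T s - Q r') with ((T s - Q r) - (Q r' - Q r)) by ring.
    apply dot_bound with mu; auto; lra. }
  destruct (seen_from_continuous X T (P r) (Q r) HL) as (A1 & A2 & A3).
  destruct (seen_from_continuous X T (P r') (Q r') HL) as (B1 & B2 & B3).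
  split; intros (th & Ht & Ht01).
  + destruct (phase_lift_transfer _ _ _ A1 A2 B1 B2 Hpos A3 B3 Ht) as (th' & Ht' & E').
    exists th'; split; auto; lra.
  + assert (Hpos' : forall s, 0 < cdot (seen_from X T (P r') (Q r') s)
                                    (seen_from X T (P r) (Q r) s)).
    { intros s; specialize (Hpos s); unfold cdot in *; lra. }
    destruct (phase_lift_transfer _ _ _ B1 B2 A1 A2 Hpos' B3 A3 Ht) as (th' & Ht' & E').
    exists th'; split; auto; lra.
- destruct (seen_from_continuous X T (P 1) (Q 1) HL) as (A1 & A2 & A3).
  (* From farther away than twice the size of the loop, the whole loop is seen in the open half
     plane around [c], the direction towards the origin; the constant lift is transferred. *)
  set (c := (- P 1, - Q 1) : C).
  assert (Hpos : forall s, 0 < cdot c (seen_from X T (P 1) (Q 1) s)).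
  { intros s; unfold cdot, seen_from, c; simpl.
    replace (X s - P 1) with (- P 1 - (- X s)) by ring.
    replace (T s - Q 1) with (- Q 1 - (- T s)) by ring.
    specialize (HS s).
    apply dot_bound with (Rabs (P 1) + Rabs (Q 1)); rewrite ?Rabs_Ropp; lra. }
  assert (Hc : phase_lift (fun _ => c) (fun _ => 0)).
  { split.
    - intros s s' _ _. rewrite Rminus_diag. exists (cdot c c).
      assert (Hcc := Hpos 0).
      rewrite cos_0, sin_0; repeat split; try (unfold cdet; simpl; ring).
      destruct (Req_dec (P 1) 0) as [Z1|Z1], (Req_dec (Q 1) 0) as [Z2|Z2];
        unfold cdot, c; simpl; try nra.
      exfalso; unfold cdot, c, seen_from in Hcc; simpl in Hcc; rewrite Z1, Z2 in Hcc; lra.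
    - intros s; apply continuity_pt_const; intros ? ?; auto. }
  destruct (fun h1 h2 => phase_lift_transfer (fun _ => c) _ _ h1 h2 A1 A2 Hpos eq_refl A3 Hc)
    as (th & Ht & E).
  + intros s; apply continuity_pt_const; intros ? ?; auto.
  + intros s; apply continuity_pt_const; intros ? ?; auto.
  + exists th; split; auto; lra.
Qed.

(** * Nonvanishing fields do not wind *)

Definition within (d x t x' t' : R) : Prop := Rabs (x' - x) < d /\ Rabs (t' - t) < d.

Definition continuous_field (B : R -> R -> C) : Prop :=
  forall x t, continuity_2d_pt (fun u v => fst (B u v)) x t /\
              continuity_2d_pt (fun u v => snd (B u v)) x t.

Lemma Rabs_mult_le a b c d : Rabs a <= c -> Rabs b <= d -> Rabs (a * b) <= c * d.
Proof.
intros; rewrite Rabs_mult; apply Rmult_le_compat; auto; apply Rabs_pos.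
Qed.

(** With [n = |u| + |v|], [cdot] is at least [n^2/2 - 2ne - 2e^2] and the determinant at most
    [2ne + 2e^2]; [16 e <= n] separates the two. *)
Lemma near_perturb (w z z' : C) e :
  0 < e -> 16 * e <= Rabs (fst w) + Rabs (snd w) ->
  within e (fst w) (snd w) (fst z) (snd z) ->
  within e (fst w) (snd w) (fst z') (snd z') -> near z z'.
Proof.
intros He Hn [A1 A2] [B1 B2]. unfold near, cdot, cdet.
destruct w as [u v], z as [z1 z2], z' as [y1 y2]; simpl in *.
set (a1 := z1 - u) in *. set (a2 := z2 - v) in *.
set (b1 := y1 - u) in *. set (b2 := y2 - v) in *.
replace z1 with (u + a1) by (unfold a1; ring). replace z2 with (v + a2) by (unfold a2; ring).
replace y1 with (u + b1) by (unfold b1; ring). replace y2 with (v + b2) by (unfold b2; ring).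
clearbody a1 a2 b1 b2.
assert (U : u * u = Rabs u * Rabs u) by apply sqr_Rabs.
assert (V : v * v = Rabs v * Rabs v) by apply sqr_Rabs.
set (n := Rabs u + Rabs v) in *.
assert (D := Rle_0_sqr (Rabs u - Rabs v)); unfold Rsqr in D.
assert (N2 : n * n <= 2 * (u * u + v * v)) by (rewrite U, V; unfold n; lra).
assert (T : forall p q r s, Rabs p < e -> Rabs q < e -> Rabs r < e -> Rabs s < e ->
  Rabs (u * p) <= Rabs u * e /\ Rabs (v * p) <= Rabs v * e /\ Rabs (p * q) <= e * e).
{ intros p q r s Hp Hq Hr Hs; repeat split; apply Rabs_mult_le; lra. }
destruct (T a1 b1 a1 b1 A1 B1 A1 B1) as (P1 & P2 & P3).
destruct (T a2 b2 a1 b1 A2 B2 A1 B1) as (P4 & P5 & P6).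
destruct (T b1 a2 a1 b1 B1 A2 A1 B1) as (P7 & P8 & P9).
destruct (T b2 a1 a1 b1 B2 A1 A1 B1) as (P10 & P11 & P12).
apply Rabs_le_between in P1, P2, P3, P4, P5, P6, P7, P8, P9, P10, P11, P12.
assert (Hne : n * (16 * e) <= n * n) by (apply Rmult_le_compat_l; lra).
assert (Hee : 16 * e * (16 * e) <= n * n) by (apply Rmult_le_compat; lra).
assert (Hep : 0 < e * e) by (apply Rmult_lt_0_compat; lra).
assert (En : Rabs u * e + Rabs v * e = n * e) by (unfold n; ring).
apply Rabs_def1; lra.
Qed.

Lemma field_near B x t : continuous_field B -> B x t <> RtoC 0 ->
  exists d, 0 < d /\ forall x1 t1 x2 t2,
    within d x t x1 t1 -> within d x t x2 t2 -> near (B x1 t1) (B x2 t2).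
Proof.
intros HB Hne. destruct (HB x t) as [H1 H2].
set (n := Rabs (fst (B x t)) + Rabs (snd (B x t))).
assert (Hn : 0 < n).
{ unfold n. assert (P1 := Rabs_pos (fst (B x t))); assert (P2 := Rabs_pos (snd (B x t))).
  destruct (Req_dec (fst (B x t)) 0) as [Q1|Q1].
  - destruct (Req_dec (snd (B x t)) 0) as [Q2|Q2].
    + exfalso; apply Hne. apply injective_projections; simpl; auto.
    + apply Rabs_pos_lt in Q2; lra.
  - apply Rabs_pos_lt in Q1; lra. }
assert (He : 0 < n / 16) by lra.
destruct (H1 (mkposreal _ He)) as (d1 & D1). destruct (H2 (mkposreal _ He)) as (d2 & D2).
simpl in D1, D2.
exists (Rmin d1 d2); split; [apply Rmin_glb_lt; [apply d1|apply d2]|].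
assert (L1 := Rmin_l d1 d2); assert (L2 := Rmin_r d1 d2).
intros x1 t1 x2 t2 [W1 W2] [W3 W4].
apply near_perturb with (B x t) (n / 16); auto.
- fold n; lra.
- split; [apply D1|apply D2]; lra.
- split; [apply D1|apply D2]; lra.
Qed.

(** * The area enclosed by a contour *)

Lemma continuous_of_pt f : (forall s : R, continuous f s) -> forall s, continuity_pt f s.
Proof. intros H s; apply continuity_pt_filterlim, H. Qed.

(** A path of escape from the new point, preceded by the segment, escapes from the old one. It must
    meet the contour, and cannot do so on the segment. *)
Lemma enclosed_along_segment X T x t x' t' :
  enclosed X T x t ->
  (forall r s, 0 <= r <= 1 -> 0 <= s <= 1 ->
     (X s, T s) <> (x + r * (x' - x), t + r * (t' - t))) ->
  enclosed X T x' t'.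
Proof.
intros [Hoff [M HM]] Hseg; split.
- intros s Hs E. apply (Hseg 1 s); [lra|auto|]. rewrite E; f_equal; ring.
- exists M. intros P Q HP HQ P0 Q0 Hfar.
  (* The positive part glues the two pieces in one formula: for [r <= 1/2] the argument of [P] and
     [Q] stays at 0 and the segment is run through, afterwards the segment term vanishes. *)
  set (pos := fun u => (u + Rabs u) / 2).
  assert (Cpos : forall s, continuity_pt pos s).
  { intros s; unfold pos, Rdiv; apply continuity_pt_mult;
      [|apply continuity_pt_const; intros ? ?; auto].
    apply continuity_pt_plus; [apply continuity_pt_id|apply Rcontinuity_abs]. }
  assert (pos_nonneg : forall u, 0 <= u -> pos u = u)
    by (intros u Hu; unfold pos; rewrite Rabs_pos_eq; lra).
  assert (pos_neg : forall u, u <= 0 -> pos u = 0)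
    by (intros u Hu; unfold pos; rewrite Rabs_left1; lra).
  assert (Cj : forall (F : R -> R) c, (forall s, continuous F s) -> forall s,
     continuous (fun r => F (pos (2 * r - 1)) + c * pos (1 - 2 * r)) s).
  { intros F c HF s. apply continuity_pt_filterlim.
    assert (CF := continuous_of_pt F HF).
    apply continuity_pt_plus.
    - apply (continuity_pt_comp (fun r => pos (2 * r - 1)) F); auto.
      apply (continuity_pt_comp (fun r => 2 * r - 1) pos); auto. reg.
    - apply continuity_pt_mult; [apply continuity_pt_const; intros ? ?; auto|].
      apply (continuity_pt_comp (fun r => 1 - 2 * r) pos); auto. reg. }
  destruct (HM (fun r => P (pos (2 * r - 1)) + (x - x') * pos (1 - 2 * r))
               (fun r => Q (pos (2 * r - 1)) + (t - t') * pos (1 - 2 * r)))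
    as (r & s & Hr & Hs & E1 & E2).
  + now apply Cj.
  + now apply Cj.
  + rewrite (pos_neg (2 * 0 - 1)), (pos_nonneg (1 - 2 * 0)), P0; lra.
  + rewrite (pos_neg (2 * 0 - 1)), (pos_nonneg (1 - 2 * 0)), Q0; lra.
  + rewrite (pos_nonneg (2 * 1 - 1)), (pos_neg (1 - 2 * 1)) by lra.
    replace (2 * 1 - 1) with 1 by ring. now rewrite !Rmult_0_r, !Rplus_0_r.
  + destruct (Rle_lt_dec r (/ 2)) as [L|L].
    * exfalso. rewrite (pos_neg (2 * r - 1)), (pos_nonneg (1 - 2 * r)) in E1, E2 by lra.
      apply (Hseg (2 * r) s); [lra|auto|]. rewrite <- E1, <- E2, P0, Q0.
      f_equal; ring.
    * rewrite (pos_nonneg (2 * r - 1)), (pos_neg (1 - 2 * r)) in E1, E2 by lra.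
      exists (2 * r - 1), s; repeat split; try lra.
Qed.

(** Failure of [enclosed] refutes every bound, so the distance [M] to be reached is free; it will be
    twice the size of the loop. *)
Lemma not_enclosed_path X T x t M :
  (forall s, 0 <= s <= 1 -> (X s, T s) <> (x, t)) -> ~ enclosed X T x t ->
  exists P Q : R -> R, (forall r, continuity_pt P r) /\ (forall r, continuity_pt Q r) /\
    P 0 = x /\ Q 0 = t /\ M < Rabs (P 1) + Rabs (Q 1) /\
    (forall r s, 0 <= r <= 1 -> 0 <= s <= 1 -> (X s, T s) <> (P r, Q r)).
Proof.
intros Hoff Hn. apply NNPP; intros Hno. apply Hn; split; auto.
exists M. intros P Q HP HQ P0 Q0 Hfar. apply NNPP; intros Hm.
apply Hno; exists P, Q; repeat split; auto using continuous_of_pt.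
intros r s Hr Hs E; injection E as E1 E2. apply Hm; exists r, s; auto.
Qed.

(** A point outside the ball escapes radially: its norm never decreases on the way, so the contour
    is never met. *)
Lemma enclosed_bounded X T S x t :
  (forall s, 0 <= s <= 1 -> Rabs (X s) + Rabs (T s) <= S) -> 0 <= S ->
  enclosed X T x t -> Rabs x + Rabs t <= S.
Proof.
intros HS S0 [Hoff [M HM]]. apply Rnot_lt_le; intros HN.
(* [c] is chosen so that the radial path ends at norm [N + |M|], beyond [M]. *)
set (N := Rabs x + Rabs t) in *. set (c := Rabs M / N).
assert (C0 : 0 <= c) by (apply Rdiv_le_0_compat; [apply Rabs_pos|lra]).
assert (Cc : forall k s, continuous (fun r => (1 + c * r) * k) s).
{ intros k s; apply continuity_pt_filterlim; reg. }
assert (Ab : forall r, 0 <= r -> Rabs ((1 + c * r) * x) + Rabs ((1 + c * r) * t) = (1 + c * r) * N).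
{ intros r Hr; rewrite !Rabs_mult, (Rabs_pos_eq (1 + c * r)) by nra. unfold N; ring. }
destruct (HM (fun r => (1 + c * r) * x) (fun r => (1 + c * r) * t)) as (r & s & Hr & Hs & E1 & E2);
  auto; try ring.
- rewrite Ab by lra. replace ((1 + c * 1) * N) with (N + Rabs M) by (unfold c; field; lra).
  generalize (Rle_abs M); lra.
- specialize (HS s Hs). rewrite <- E1, <- E2, Ab in HS by lra.
  assert (0 <= c * r * N) by (apply Rmult_le_pos; [apply Rmult_le_pos|]; lra).
  lra.
Qed.

Definition hull (X T : R -> R) (x t : R) : Prop :=
  (exists s, 0 <= s <= 1 /\ X s = x /\ T s = t) \/ enclosed X T x t.

Lemma enclosed_nearby X T x t mu x' t' :
  (forall s, mu <= Rabs (X s - x) + Rabs (T s - t)) ->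
  within (mu / 4) x t x' t' ->
  (enclosed X T x t <-> enclosed X T x' t').
Proof.
intros Hmu [W1 W2].
assert (Hb : forall r s, 0 <= r <= 1 ->
  (X s, T s) <> (x + r * (x' - x), t + r * (t' - t))).
{ intros r s Hr E; injection E as E1 E2. specialize (Hmu s).
  rewrite E1, E2 in Hmu.
  replace (x + r * (x' - x) - x) with (r * (x' - x)) in Hmu by ring.
  replace (t + r * (t' - t) - t) with (r * (t' - t)) in Hmu by ring.
  rewrite !Rabs_mult, (Rabs_pos_eq r) in Hmu by lra.
  generalize (Rabs_pos (x' - x)), (Rabs_pos (t' - t)); intros.
  assert (r * Rabs (x' - x) <= 1 * Rabs (x' - x)) by (apply Rmult_le_compat_r; lra).
  assert (r * Rabs (t' - t) <= 1 * Rabs (t' - t)) by (apply Rmult_le_compat_r; lra).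
  lra. }
split; intros He.
- apply enclosed_along_segment with x t; auto.
- apply enclosed_along_segment with x' t'; auto.
  intros r s Hr Hs E; apply (Hb (1 - r) s); [lra|]. rewrite E; f_equal; ring.
Qed.

(** A Lebesgue number for the contour with its interior, extracted from a bounding square. The local
    radii must therefore exist at all points of the plane, also at zeros of the field. *)
Lemma hull_lebesgue_number B X T :
  continuous_field B -> continuous_loop X T ->
  (forall x t, hull X T x t -> B x t <> RtoC 0) ->
  exists d, 0 < d /\ forall x t x1 t1 x2 t2, hull X T x t ->
    within d x t x1 t1 -> within d x t x2 t2 -> near (B x1 t1) (B x2 t2).
Proof.
intros HB HL Hne.
destruct (loop_bounded X T HL) as (S & S0 & HS).
assert (Hloc : forall q : R * R, exists d : posreal,
  forall x t, hull X T x t -> within d (fst q) (snd q) x t ->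
    forall x1 t1 x2 t2, within d x t x1 t1 -> within d x t x2 t2 -> near (B x1 t1) (B x2 t2)).
{ intros [x0 t0]; simpl.
  destruct (classic (B x0 t0 = RtoC 0)) as [Z|Z].
  (* A zero is off the hull, and so is a whole neighbourhood of it: the requirement is vacuous
     there. *)
  - assert (Hh : ~ hull X T x0 t0) by (intros H; apply (Hne _ _ H Z)).
    destruct (loop_distance X T x0 t0 HL) as (mu & Hmu & Hd).
    { intros s Hs E; injection E as E1 E2; apply Hh; left; exists s; auto. }
    assert (Hmu4 : 0 < mu / 4) by lra.
    exists (mkposreal _ Hmu4); simpl. intros x t H W; exfalso.
    destruct H as [(s & Hs & E1 & E2)|H].
    + specialize (Hd s). rewrite E1, E2 in Hd. destruct W; lra.
    + apply Hh; right. apply (enclosed_nearby X T x0 t0 mu x t); auto.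
  - destruct (field_near B x0 t0 HB Z) as (d & Hd & HN).
    assert (Hd2 : 0 < d / 2) by lra.
    exists (mkposreal _ Hd2); simpl. intros x t _ [W1 W2] x1 t1 x2 t2 [W3 W4] [W5 W6].
    apply HN; split.
    + replace (x1 - x0) with ((x1 - x) + (x - x0)) by ring. eapply Rle_lt_trans; [apply Rabs_triang|lra].
    + replace (t1 - t0) with ((t1 - t) + (t - t0)) by ring. eapply Rle_lt_trans; [apply Rabs_triang|lra].
    + replace (x2 - x0) with ((x2 - x) + (x - x0)) by ring. eapply Rle_lt_trans; [apply Rabs_triang|lra].
    + replace (t2 - t0) with ((t2 - t) + (t - t0)) by ring. eapply Rle_lt_trans; [apply Rabs_triang|lra]. }
set (delta := fun u v => proj1_sig (constructive_indefinite_description _ (Hloc (u, v)))).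
destruct (compactness_value_2d (- S) S (- S) S delta) as (d & Hd).
exists d; split; [apply d|]. intros x t x1 t1 x2 t2 Hh W1 W2.
assert (Hbox : Rabs x + Rabs t <= S).
{ destruct Hh as [(s & Hs & <- & <-)|H]; auto.
  apply enclosed_bounded with X T; auto. }
assert (Bx : Rabs x <= S) by (generalize (Rabs_pos t); lra).
assert (Bt : Rabs t <= S) by (generalize (Rabs_pos x); lra).
apply Rabs_le_between in Bx, Bt.
apply NNPP; intros Hcon. apply (Hd x t Bx Bt). intros (u & v & _ & _ & D1 & D2 & D3).
apply Hcon. unfold delta in *.
destruct (constructive_indefinite_description _ (Hloc (u, v))) as [e He]; simpl in *.
apply (He x t Hh); [split; auto| |].
- destruct W1; split; lra.
- destruct W2; split; lra.
Qed.

Lemma loop_sampling X T h : continuous_loop X T -> 0 < h ->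
  exists m, (0 < m)%nat /\ forall k s s', (k < m)%nat ->
    INR k / INR m <= s <= INR (S k) / INR m ->
    INR k / INR m <= s' <= INR (S k) / INR m ->
    within h (X s) (T s) (X s') (T s').
Proof.
intros (HX & HT & _) Hh.
destruct (@Heine_cor2 X 0 1 (fun x _ => HX x) (mkposreal h Hh)) as (d1 & D1).
destruct (@Heine_cor2 T 0 1 (fun x _ => HT x) (mkposreal h Hh)) as (d2 & D2).
simpl in D1, D2.
assert (Hd : 0 < Rmin d1 d2) by (apply Rmin_glb_lt; [apply d1|apply d2]).
destruct (archimed_cor1 _ Hd) as (m & Hm & Hm0).
assert (L1 := Rmin_l d1 d2); assert (L2 := Rmin_r d1 d2).
exists m; split; [lia|]. intros k s s' Hk Hs Hs'.
assert (Mp : 0 < INR m) by (apply lt_0_INR; lia).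
assert (K0 : 0 <= INR k / INR m) by (apply Rdiv_le_0_compat; auto; apply pos_INR).
assert (K1 : INR (S k) / INR m <= 1).
{ apply le_INR in Hk. apply Rmult_le_reg_r with (INR m); auto.
  unfold Rdiv; rewrite Rmult_assoc, Rinv_l; lra. }
assert (KS : INR (S k) / INR m = INR k / INR m + / INR m).
{ rewrite S_INR; field; lra. }
assert (Rabs (s' - s) < Rmin d1 d2) by (apply Rabs_def1; lra).
split; [apply D1|apply D2]; lra.
Qed.

Lemma nearby_floors_adjacent x x' n n' :
  INR n <= x < INR n + 1 -> INR n' <= x' < INR n' + 1 -> Rabs (x' - x) < 1 ->
  adjacent n n'.
Proof.
intros H H' Hx; apply Rabs_def2 in Hx.
split.
- assert (Hlt : INR n' < INR (S (S n))) by (rewrite !S_INR; lra). apply INR_lt in Hlt; lia.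
- assert (Hlt : INR n < INR (S (S n'))) by (rewrite !S_INR; lra). apply INR_lt in Hlt; lia.
Qed.

(** The two routes between opposite corners give angles that agree modulo 2 pi and differ by less
    than pi. *)
Lemma curl_near b q p :
  near (b q p) (b (S q) p) -> near (b (S q) p) (b (S q) (S p)) ->
  near (b q (S p)) (b (S q) (S p)) -> near (b q p) (b q (S p)) -> curl b q p = 0.
Proof.
intros H1 H2 H3 H4. unfold curl.
enough (ang (b q p) (b (S q) p) + ang (b (S q) p) (b (S q) (S p)) =
        ang (b q p) (b q (S p)) + ang (b q (S p)) (b (S q) (S p))) by lra.
apply is_angle_unique with (b q p) (b (S q) (S p)).
- apply is_angle_trans with (b (S q) p); apply is_angle_ang, near_pos; auto.
- apply is_angle_trans with (b q (S p)); apply is_angle_ang, near_pos; auto.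
- apply near_ang in H1, H2, H3, H4. apply Rabs_def1; lra.
Qed.

Lemma within_trans d e f x t x' t' x'' t'' : d + e <= f ->
  within d x t x' t' -> within e x' t' x'' t'' -> within f x t x'' t''.
Proof.
intros Hf [A1 A2] [B1 B2]; split.
- replace (x'' - x) with ((x'' - x') + (x' - x)) by ring.
  eapply Rle_lt_trans; [apply Rabs_triang|lra].
- replace (t'' - t) with ((t'' - t') + (t' - t)) by ring.
  eapply Rle_lt_trans; [apply Rabs_triang|lra].
Qed.

Theorem no_winding_of_nonvanishing_field B X T theta :
  continuous_field B -> continuous_loop X T ->
  (forall x t, hull X T x t -> B x t <> RtoC 0) ->
  phase_lift (fun s => B (X s) (T s)) theta ->
  theta 1 = theta 0.
Proof.
intros HB HL Hne Hth.
destruct (hull_lebesgue_number B X T HB HL Hne) as (d & Hd & HN).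
destruct (loop_bounded X T HL) as (L & L0 & HLb).
(* Grid vertices used along the loop lie within [3h] of it, and [near_perturb] then asks for
   [16 * 3 = 48] times [h] between the loop and a centre that is to be separated from it. A centre
   within [48h] of the hull has its corners within [49h], which has to stay below [d]. *)
set (h := d / 50). assert (Hh : 0 < h) by (unfold h; lra).
destruct (loop_sampling X T h HL Hh) as (m & Hm & Hs).
assert (Mp : 0 < INR m) by (apply lt_0_INR; auto).
assert (HLx : forall s, - L <= X s <= L).
{ intros s; specialize (HLb s); apply Rabs_le_between.
  generalize (Rabs_pos (T s)); lra. }
assert (HLt : forall s, - L <= T s <= L).
{ intros s; specialize (HLb s); apply Rabs_le_between.
  generalize (Rabs_pos (X s)); lra. }
assert (FX : forall s, 0 <= (X s + L) / h).
{ intros s; apply Rdiv_le_0_compat; auto; specialize (HLx s); lra. }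
assert (FT : forall s, 0 <= (T s + L) / h).
{ intros s; apply Rdiv_le_0_compat; auto; specialize (HLt s); lra. }
set (tt := fun k => INR k / INR m).
set (I := fun k => proj1_sig (nfloor_ex _ (FX (tt k)))).
set (J := fun k => proj1_sig (nfloor_ex _ (FT (tt k)))).
assert (HI : forall k, INR (I k) <= (X (tt k) + L) / h < INR (I k) + 1)
  by (intros k; exact (proj2_sig (nfloor_ex _ (FX (tt k))))).
assert (HJ : forall k, INR (J k) <= (T (tt k) + L) / h < INR (J k) + 1)
  by (intros k; exact (proj2_sig (nfloor_ex _ (FT (tt k))))).
destruct (nfloor_ex (2 * L / h)) as (n & Hn); [apply Rdiv_le_0_compat; lra|].
set (gx := fun i => - L + INR i * h).
assert (Flo : forall u i, INR i <= (u + L) / h < INR i + 1 -> Rabs (gx i - u) <= h).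
{ intros u i [H1 H2]. apply Rmult_le_compat_r with (r := h) in H1; [|lra].
  apply Rmult_lt_compat_r with (r := h) in H2; [|lra].
  unfold Rdiv in H1, H2; rewrite Rmult_assoc, Rinv_l in H1, H2 by lra.
  unfold gx; apply Rabs_le_between; lra. }
assert (Bnd : forall u i, u <= L -> INR i <= (u + L) / h < INR i + 1 -> (i <= n)%nat).
{ intros u i Hu [H1 _].
  assert ((u + L) / h <= 2 * L / h).
  { unfold Rdiv; apply Rmult_le_compat_r; [left; now apply Rinv_0_lt_compat|lra]. }
  assert (Hlt : INR i < INR (S n)) by (rewrite S_INR; lra). apply INR_lt in Hlt; lia. }
assert (Adj : forall k, (k < m)%nat -> adjacent (I k) (I (S k)) /\ adjacent (J k) (J (S k))).
{ intros k Hk. destruct (Hs k (tt k) (tt (S k)) Hk) as [W1 W2].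
  - unfold tt; split; [lra|]. unfold Rdiv; apply Rmult_le_compat_r;
      [left; now apply Rinv_0_lt_compat|rewrite S_INR; lra].
  - unfold tt; split; [|lra]. unfold Rdiv; apply Rmult_le_compat_r;
      [left; now apply Rinv_0_lt_compat|rewrite S_INR; lra].
  - assert (Sc : forall u v, Rabs (v - u) < h -> Rabs ((v + L) / h - (u + L) / h) < 1).
    { intros u v Huv. replace ((v + L) / h - (u + L) / h) with ((v - u) / h) by (field; lra).
      unfold Rdiv. rewrite Rabs_mult, (Rabs_pos_eq (/ h)) by (left; now apply Rinv_0_lt_compat).
      apply Rmult_lt_reg_r with h; auto. rewrite Rmult_assoc, Rinv_l; lra. }
    split; [apply (nearby_floors_adjacent _ _ _ _ (HI k) (HI (S k)))|
            apply (nearby_floors_adjacent _ _ _ _ (HJ k) (HJ (S k)))]; auto. }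
destruct HL as (HX & HT & Hcl & EX & ET).
assert (HL : continuous_loop X T) by (repeat split; auto; apply Hcl).
assert (tm : tt m = 1) by (unfold tt; field; lra).
assert (t0 : tt 0%nat = 0) by (unfold tt; simpl; field; lra).
assert (Im : I m = I 0%nat).
{ assert (H1 := HI m); assert (H2 := HI 0%nat). rewrite tm, EX in H1; rewrite t0 in H2.
  apply INR_eq.
  destruct (Nat.lt_trichotomy (I m) (I 0%nat)) as [C|[C|C]].
  - apply le_INR in C; rewrite S_INR in C; lra.
  - now rewrite C.
  - apply le_INR in C; rewrite S_INR in C; lra. }
assert (Jm : J m = J 0%nat).
{ assert (H1 := HJ m); assert (H2 := HJ 0%nat). rewrite tm, ET in H1; rewrite t0 in H2.
  apply INR_eq.
  destruct (Nat.lt_trichotomy (J m) (J 0%nat)) as [C|[C|C]].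
  - apply le_INR in C; rewrite S_INR in C; lra.
  - now rewrite C.
  - apply le_INR in C; rewrite S_INR in C; lra. }
assert (Hstep : forall k, (k < m)%nat -> within h (X (tt k)) (T (tt k)) (X (tt (S k))) (T (tt (S k)))).
{ intros k Hk. apply (Hs k); auto; unfold tt.
  - split; [lra|]. unfold Rdiv; apply Rmult_le_compat_r;
      [left; now apply Rinv_0_lt_compat|rewrite S_INR; lra].
  - split; [|lra]. unfold Rdiv; apply Rmult_le_compat_r;
      [left; now apply Rinv_0_lt_compat|rewrite S_INR; lra]. }
assert (Wv : forall k, within (2 * h) (X (tt k)) (T (tt k)) (gx (I k)) (gx (J k))).
{ intros k; split; eapply Rle_lt_trans; try (apply Flo; auto); lra. }
assert (Ww : forall k, (k < m)%nat ->
  within (3 * h) (X (tt k)) (T (tt k)) (gx (I (S k))) (gx (J k))).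
{ intros k Hk; split.
  - apply (within_trans h (2 * h) (3 * h) _ _ _ _ _ _ ltac:(lra) (Hstep k Hk) (Wv (S k))).
  - destruct (Wv k); lra. }
assert (Ws : forall k, (k < m)%nat ->
  within (3 * h) (X (tt k)) (T (tt k)) (gx (I (S k))) (gx (J (S k)))).
{ intros k Hk. apply (within_trans h (2 * h) (3 * h) _ _ _ _ _ _ ltac:(lra) (Hstep k Hk) (Wv (S k))). }
(* Stated for any field because it is used twice: for [B], and for the displacement from the centre
   of a square, whose winding is then computed from the same grid vertices. *)
assert (Hwin : forall (F : R -> R -> C) th,
  phase_lift (fun s => F (X s) (T s)) th ->
  (forall s x1 t1 x2 t2, 0 <= s <= 1 ->
     within (3 * h) (X s) (T s) x1 t1 -> within (3 * h) (X s) (T s) x2 t2 ->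
     near (F x1 t1) (F x2 t2)) ->
  rsum m (fun k => grid_step (fun i j => F (gx i) (gx j)) (I k) (J k) (I (S k)) (J (S k)))
    = th 1 - th 0
  /\ forall k, (k < m)%nat ->
     near (F (gx (I k)) (gx (J k))) (F (gx (I (S k))) (gx (J k))) /\
     near (F (gx (I (S k))) (gx (J k))) (F (gx (I (S k))) (gx (J (S k))))).
{ intros F th HF HnF.
  assert (T01 : forall k, (k <= m)%nat -> 0 <= tt k <= 1).
  { intros k Hk; unfold tt; split.
    - apply Rdiv_le_0_compat; auto. apply pos_INR.
    - apply le_INR in Hk. apply Rmult_le_reg_r with (INR m); auto.
      unfold Rdiv; rewrite Rmult_assoc, Rinv_l; lra. }
  assert (Hself : forall k, within (3 * h) (X (tt k)) (T (tt k)) (X (tt k)) (T (tt k)))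
    by (intros k; split; rewrite Rminus_diag, Rabs_R0; lra).
  assert (Wv3 : forall k, within (3 * h) (X (tt k)) (T (tt k)) (gx (I k)) (gx (J k)))
    by (intros k; destruct (Wv k); split; lra).
  assert (Hn2 : forall k, (k < m)%nat ->
     near (F (gx (I k)) (gx (J k))) (F (gx (I (S k))) (gx (J k))) /\
     near (F (gx (I (S k))) (gx (J k))) (F (gx (I (S k))) (gx (J (S k))))).
  { intros k Hk; split; apply (HnF (tt k)); auto; apply T01; lia. }
  split; [|exact Hn2].
  apply (winding_by_sampling (fun s => F (X s) (T s)) th m
    (fun k => F (gx (I k)) (gx (J k))) (fun k => F (gx (I (S k))) (gx (J k)))); auto.
  - intros k s s' Hk H1 H2. apply (HnF (tt k)); [apply T01; lia| |].
    + destruct (Hs k (tt k) s Hk) as [W1 W2]; auto; [unfold tt; lra|split; lra].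
    + destruct (Hs k (tt k) s' Hk) as [W1 W2]; auto; [unfold tt; lra|split; lra].
  - intros k Hk. apply (HnF (tt k)); [apply T01; lia| |]; auto.
  - now rewrite EX, ET.
  - now rewrite Im, Jm. }
destruct (Hwin B theta Hth) as [W _].
{ intros s x1 t1 x2 t2 Hs1 [W1 W2] [W3 W4]. apply (HN (X s) (T s)).
  - left; exists s; auto.
  - split; unfold h in *; lra.
  - split; unfold h in *; lra. }
enough (theta 1 - theta 0 = 0) by lra.
rewrite <- W. apply grid_stokes with n; auto.
{ intros k _; split.
  - apply (Bnd (X (tt k))); auto; apply HLx.
  - apply (Bnd (T (tt k))); auto; apply HLt. }
intros q p _ _.
set (cx := gx q + / 2 * h). set (ct := gx p + / 2 * h).
assert (Sx : gx (S q) = gx q + h) by (unfold gx; rewrite S_INR; ring).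
assert (Sp : gx (S p) = gx p + h) by (unfold gx; rewrite S_INR; ring).
destruct (classic (exists x t, hull X T x t /\ within (48 * h) x t cx ct)) as [(x & t & Hxt & W0)|Hfar].
- left.
  assert (Cn : forall x1 t1, within h cx ct x1 t1 -> within d x t x1 t1).
  { intros x1 t1 W1. apply (within_trans (48 * h) h d _ _ _ _ _ _ ltac:(unfold h; lra) W0 W1). }
  assert (C4 : within h cx ct (gx q) (gx p) /\ within h cx ct (gx (S q)) (gx p) /\
               within h cx ct (gx q) (gx (S p)) /\ within h cx ct (gx (S q)) (gx (S p))).
  { unfold within. rewrite Sx, Sp. unfold cx, ct. repeat split; apply Rabs_def1; lra. }
  destruct C4 as (C1 & C2 & C3 & C4).
  apply curl_near; apply (HN x t); auto.
(* The centre is neither on the loop nor enclosed, so it has an escape path and the loop does not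
   wind around it. Sampling the displacement identifies this winding with [crossings], up to the
   factor [- 2 * PI]. *)
- right.
  assert (Hoff : forall s, 0 <= s <= 1 -> ~ within (48 * h) (X s) (T s) cx ct).
  { intros s Hs1 W1; apply Hfar; exists (X s), (T s); split; auto. left; exists s; auto. }
  assert (Hnot : forall s, 0 <= s <= 1 -> (X s, T s) <> (cx, ct)).
  { intros s Hs1 E; injection E as E1 E2. apply (Hoff s Hs1). rewrite E1, E2.
    split; rewrite Rminus_diag, Rabs_R0; lra. }
  destruct (not_enclosed_path X T cx ct (2 * L) Hnot) as (P & Q & HP & HQ & P0 & Q0 & Pf & Poff).
  { intros He; apply Hfar; exists cx, ct; split; [right; auto|].
    split; rewrite Rminus_diag, Rabs_R0; lra. }
  destruct (no_winding_from_outside X T P Q L HL HLb L0 HP HQ Poff Pf) as (th & Hth' & E01).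
  rewrite P0, Q0 in Hth'.
  destruct (Hwin (fun x t => (x - cx, t - ct)) th Hth') as [W' Hn'].
  { intros s x1 t1 x2 t2 Hs1 [W1 W2] [W3 W4].
    apply near_perturb with (X s - cx, T s - ct) (3 * h); simpl.
    - lra.
    - destruct (Rlt_le_dec (Rabs (X s - cx)) (48 * h)) as [A|A].
      + destruct (Rlt_le_dec (Rabs (T s - ct)) (48 * h)) as [A'|A'].
        * exfalso; apply (Hoff s Hs1). split; rewrite Rabs_minus_sym; auto.
        * generalize (Rabs_pos (X s - cx)); lra.
      + generalize (Rabs_pos (T s - ct)); lra.
    - split; simpl; [replace (x1 - cx - (X s - cx)) with (x1 - X s) by ring|
                      replace (t1 - ct - (T s - ct)) with (t1 - T s) by ring]; auto.
    - split; simpl; [replace (x2 - cx - (X s - cx)) with (x2 - X s) by ring|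
                      replace (t2 - ct - (T s - ct)) with (t2 - T s) by ring]; auto. }
  assert (Eb : forall i j, (gx i - cx, gx j - ct) = from_centre h q p i j).
  { intros i j; unfold from_centre, cx, ct, gx; f_equal; ring. }
  assert (Wc := crossings_winding h q p m I J Hh Adj Im Jm).
  enough (- (2 * PI) * crossings m I J q p = 0).
  { assert (PP := PI_RGT_0). apply Rmult_eq_reg_l with (- (2 * PI)); [|lra]. lra. }
  rewrite <- Wc.
  + rewrite (rsum_ext m _ (fun k => grid_step (fun i j => (gx i - cx, gx j - ct))
      (I k) (J k) (I (S k)) (J (S k)))).
    * rewrite W', E01; lra.
    * intros k _. unfold grid_step. now rewrite !Eb.
  + intros k Hk. rewrite <- !Eb. destruct (Hn' k Hk) as [N1 N2].
    split; apply near_pos; auto.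
Qed.

(** * The contour integral of the phase as a continuous lift *)

Definition C1_2d (f fx ft : R -> R -> R) : Prop :=
  (forall x t, is_derive (fun y => f y t) x (fx x t)) /\
  (forall x t, is_derive (fun s => f x s) t (ft x t)) /\
  (forall x t, continuity_2d_pt fx x t) /\ (forall x t, continuity_2d_pt ft x t).

Lemma C1_2d_differentiable f fx ft x t : C1_2d f fx ft ->
  differentiable_pt_lim f x t (fx x t) (ft x t).
Proof.
intros (H1 & H2 & H3 & H4). apply filterdiff_differentiable_pt_lim.
apply (is_derive_filterdiff f x t fx (ft x t)); auto.
- apply filter_forall; intros; apply H1.
- apply continuity_2d_pt_filterlim, H3.
Qed.

Lemma C1_2d_continuous f fx ft x t : C1_2d f fx ft -> continuity_2d_pt f x t.
Proof.
intros H. apply differentiable_continuity_pt. exists (fx x t), (ft x t).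
now apply C1_2d_differentiable.
Qed.

Lemma C1_2d_along f fx ft (X T : R -> R) s dX dT : C1_2d f fx ft ->
  is_derive X s dX -> is_derive T s dT ->
  is_derive (fun u => f (X u) (T u)) s (fx (X s) (T s) * dX + ft (X s) (T s) * dT).
Proof.
intros H HX HT. apply is_derive_Reals. apply derivable_pt_lim_comp_2d.
- now apply C1_2d_differentiable.
- now apply is_derive_Reals.
- now apply is_derive_Reals.
Qed.

Lemma continuity_2d_pt_along f (X T : R -> R) s : continuity_2d_pt f (X s) (T s) ->
  continuity_pt X s -> continuity_pt T s -> continuity_pt (fun u => f (X u) (T u)) s.
Proof.
intros H HX HT. apply continuity_pt_filterlim. apply continuity_2d_pt_filterlim in H.
apply continuity_pt_filterlim in HX. apply continuity_pt_filterlim in HT.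
apply (filterlim_comp _ _ _ (fun u => (X u, T u)) (fun z => f (fst z) (snd z)) _ (locally (X s, T s))); auto.
apply filterlim_locally; intros eps.
assert (A := proj1 (filterlim_locally _ _) HX eps).
assert (B := proj1 (filterlim_locally _ _) HT eps).
generalize (filter_and _ _ A B); apply filter_imp; intros u [U1 U2]; split; auto.
Qed.

(* [F sin Phi = G cos Phi] differentiated *)
Lemma phase_derivative (F G Phi : R -> R) (x dF dG k n : R) :
  is_derive F x dF -> is_derive G x dG -> is_derive Phi x k ->
  locally x (fun y => F y * sin (Phi y) = G y * cos (Phi y)) ->
  F x = n * cos (Phi x) -> G x = n * sin (Phi x) -> n <> 0 ->
  k = (F x * dG - G x * dF) / (F x * F x + G x * G x).
Proof.
intros HF HG HP Hloc EF EG Hn.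
assert (D : is_derive (fun y => F y * sin (Phi y) - G y * cos (Phi y)) x
   (dF * sin (Phi x) + F x * (k * cos (Phi x)) - (dG * cos (Phi x) + G x * (- (k * sin (Phi x)))))).
{ auto_derive.
  - repeat split; eexists; eauto.
  - assert (EF' : Derive (fun y => F y) x = dF) by now apply is_derive_unique.
    assert (EG' : Derive (fun y => G y) x = dG) by now apply is_derive_unique.
    assert (EP' : Derive (fun y => Phi y) x = k) by now apply is_derive_unique.
    rewrite EF', EG', EP'.
    ring. }
assert (D0 : is_derive (fun y => F y * sin (Phi y) - G y * cos (Phi y)) x 0).
{ apply is_derive_ext_loc with (fun _ => 0).
  - revert Hloc; apply filter_imp; intros; lra.
  - auto_derive; auto. }
assert (E := is_derive_unique _ _ _ D). rewrite (is_derive_unique _ _ _ D0) in E.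
assert (S := sin2_cos2 (Phi x)); unfold Rsqr in S.
rewrite EF, EG in *.
replace (n * cos (Phi x) * (n * cos (Phi x)) + n * sin (Phi x) * (n * sin (Phi x))) with (n * n)
  by (transitivity (n * n * (sin (Phi x) * sin (Phi x) + cos (Phi x) * cos (Phi x))); [rewrite S|]; ring).
apply Rmult_eq_reg_r with n; auto.
transitivity (cos (Phi x) * dG - sin (Phi x) * dF); [|field; auto].
transitivity (k * n * (sin (Phi x) * sin (Phi x) + cos (Phi x) * cos (Phi x))); [rewrite S; ring|].
lra.
Qed.

(** The derivative of the argument of [z = f + i g]: the imaginary part of [conj z * z'] over
    [|z|^2]. *)
Definition angular_speed (f g df dg : R) : R := (f * dg - g * df) / (f * f + g * g).

(** Eliminates the local phases, which change from point to point, in favour of expressions in the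
    field that vary continuously along the contour. *)
Lemma wavenumber_frequency_formula (B : R -> R -> C) fx ft gx gt x t k omega :
  C1_2d (fun x t => fst (B x t)) fx ft -> C1_2d (fun x t => snd (B x t)) gx gt ->
  B x t <> RtoC 0 ->
  local_wavenumber_frequency B x t k omega ->
  k = angular_speed (fst (B x t)) (snd (B x t)) (fx x t) (gx x t) /\
  - omega = angular_speed (fst (B x t)) (snd (B x t)) (ft x t) (gt x t).
Proof.
intros (F1 & F2 & _) (G1 & G2 & _) Hne (Phi & HPhi & Hk & Ho).
assert (Hn : Cmod (B x t) <> 0) by (intros E; apply Hne; now apply Cmod_eq_0).
assert (Comp : forall y s, B y s = (RtoC (Cmod (B y s)) * expi (Phi y s))%C ->
  fst (B y s) = Cmod (B y s) * cos (Phi y s) /\ snd (B y s) = Cmod (B y s) * sin (Phi y s)).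
{ intros y s E. split.
  - rewrite E at 1. simpl. ring.
  - rewrite E at 1. simpl. ring. }
destruct (Comp x t) as [E1 E2].
{ apply locally_2d_singleton in HPhi. apply HPhi. }
unfold angular_speed; split.
- apply (phase_derivative (fun y => fst (B y t)) (fun y => snd (B y t)) (fun y => Phi y t))
    with (n := Cmod (B x t)); auto.
  generalize (locally_2d_1d_const_y _ _ _ HPhi); apply filter_imp.
  intros y [E _]. destruct (Comp y t E) as [-> ->]; ring.
- apply (phase_derivative (fun s => fst (B x s)) (fun s => snd (B x s)) (fun s => Phi x s))
    with (n := Cmod (B x t)); auto.
  generalize (locally_2d_1d_const_x _ _ _ HPhi); apply filter_imp.
  intros y [E _]. destruct (Comp x y E) as [-> ->]; ring.
Qed.

Lemma sorted_le (sigma : nat -> R) N i :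
  (forall i, (i < N)%nat -> sigma i < sigma (S i)) -> (i <= N)%nat -> sigma 0%nat <= sigma i.
Proof.
intros H; induction i as [|i IH]; intros Hi; [lra|].
specialize (H i Hi). assert (sigma 0%nat <= sigma i) by (apply IH; lia). lra.
Qed.

(** The function on the first pieces, frozen at [sigma N], plus the increment of the last piece,
    frozen before [sigma N]: a sum of continuous functions, so nothing has to be checked at the
    corners. *)
Lemma continuity_pt_pieces (f : R -> R) (sigma : nat -> R) N :
  (forall i, (i < N)%nat -> sigma i < sigma (S i)) ->
  (forall i, (i < N)%nat -> exists phi, (forall s, continuity_pt phi s) /\
     forall s, sigma i <= s <= sigma (S i) -> f s = phi s) ->
  forall s, continuity_pt (fun u => f (clamp (sigma 0%nat) (sigma N) u)) s.
Proof.
induction N as [|N IH]; intros Hs Hf s.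
- apply continuity_pt_ext with (fun _ => f (sigma 0%nat)).
  + intros u; f_equal; unfold clamp; lra.
  + apply continuity_pt_const; intros ? ?; auto.
- destruct (Hf N) as (phi & Hphi & E); [lia|].
  assert (H0 : sigma 0%nat <= sigma N) by (apply sorted_le with (S N); auto; lia).
  assert (H1 : sigma N < sigma (S N)) by (apply Hs; lia).
  apply continuity_pt_ext with (fun u => f (clamp (sigma 0%nat) (sigma N) u)
    + (phi (clamp (sigma N) (sigma (S N)) u) - phi (sigma N))).
  + intros u. destruct (Rle_lt_dec u (sigma N)) as [L|L].
    * rewrite (clamp_left (sigma N)) by lra.
      destruct (Rle_lt_dec u (sigma 0%nat)) as [L0|L0].
      -- rewrite !clamp_left by lra; ring.
      -- rewrite !clamp_id by lra; ring.
    * rewrite (clamp_right _ (sigma N)) by lra. rewrite (E (sigma N)) by lra.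
      destruct (Rle_lt_dec u (sigma (S N))) as [L1|L1].
      -- rewrite !clamp_id by lra. rewrite E by lra; ring.
      -- rewrite !clamp_right by lra. rewrite E by lra; ring.
  + apply continuity_pt_plus.
    * apply IH; intros; [apply Hs|apply Hf]; lia.
    * apply continuity_pt_minus; [|apply continuity_pt_const; intros ? ?; auto].
      apply (continuity_pt_comp (clamp (sigma N) (sigma (S N))) phi); auto.
      apply continuity_pt_clamp.
Qed.

Lemma contour_continuous_loop X T : contour X T ->
  continuous_loop (fun s => X (clamp 0 1 s)) (fun s => T (clamp 0 1 s)).
Proof.
intros ((N & sigma & S0 & SN & Hs & Hp) & EX & ET & _).
assert (HC : forall f, Defs.C1 f -> forall s, continuity_pt f s).
{ intros f Hf s. apply continuity_pt_filterlim.
  apply (ex_derive_continuous (K := R_AbsRing) (V := R_NormedModule) f s), Hf. }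
repeat split.
- intros s; rewrite <- S0, <- SN; apply (continuity_pt_pieces X); auto.
  intros i Hi; destruct (Hp i Hi) as (Xi & Ti & CX & CT & E).
  exists Xi; split; auto. intros u Hu; now apply E.
- intros s; rewrite <- S0, <- SN; apply (continuity_pt_pieces T); auto.
  intros i Hi; destruct (Hp i Hi) as (Xi & Ti & CX & CT & E).
  exists Ti; split; auto. intros u Hu; now apply E.
- rewrite (clamp_id 0 1 (clamp 0 1 s)); auto; apply clamp_range; lra.
- rewrite (clamp_id 0 1 (clamp 0 1 s)); auto; apply clamp_range; lra.
- rewrite !clamp_id by lra; auto.
- rewrite !clamp_id by lra; auto.
Qed.

(** The integrand is only known to be integrable, with arbitrary values at the corners. Integrable
    functions are bounded, so the integral is Lipschitz in its upper end. *)
Lemma continuity_pt_RInt h :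
  ex_RInt h 0 1 -> forall s, continuity_pt (fun u => RInt h 0 (clamp 0 1 u)) s.
Proof.
intros Hh s.
destruct (ex_RInt_ub h 0 1 Hh) as [M HM].
rewrite Rmin_left, Rmax_right in HM by lra.
assert (Hsub : forall a b, 0 <= a -> a <= b -> b <= 1 -> ex_RInt h a b).
{ intros a b H0 H1 H2. apply ex_RInt_Chasles_2 with 0; [lra|].
  apply ex_RInt_Chasles_1 with 1; [lra|auto]. }
assert (Lip : forall a b, 0 <= a -> a <= b -> b <= 1 ->
   Rabs (RInt h 0 b - RInt h 0 a) <= (b - a) * M).
{ intros a b H0 H1 H2.
  assert (Ch : RInt h 0 a + RInt h a b = RInt h 0 b)
    by (apply (RInt_Chasles h 0 a b); apply Hsub; lra).
  assert (Ab : Rabs (RInt h a b) <= (b - a) * M).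
  { apply abs_RInt_le_const; auto. intros t Ht; apply HM; lra. }
  rewrite <- Ch. eapply Rle_trans; [right|exact Ab]. f_equal; simpl; lra. }
assert (M0 : 0 <= M).
{ apply Rle_trans with (norm (h 0)); [apply norm_ge_0|apply HM; lra]. }
intros eps Heps. exists (eps / (M + 1)); split.
- apply Rdiv_lt_0_compat; lra.
- intros u [_ Hu]. simpl in *. unfold Rdist in *.
  assert (C1' := clamp_range 0 1 u ltac:(lra)). assert (C2' := clamp_range 0 1 s ltac:(lra)).
  assert (Cl : Rabs (clamp 0 1 u - clamp 0 1 s) <= Rabs (u - s)).
  { unfold clamp, Rabs; repeat destruct Rcase_abs; lra. }
  apply Rle_lt_trans with (Rabs (clamp 0 1 u - clamp 0 1 s) * M).
  + destruct (Rle_lt_dec (clamp 0 1 s) (clamp 0 1 u)) as [L|L].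
    * rewrite (Rabs_pos_eq (clamp 0 1 u - clamp 0 1 s)) by lra. apply Lip; lra.
    * rewrite Rabs_minus_sym, (Rabs_minus_sym (clamp 0 1 u)).
      rewrite (Rabs_pos_eq (clamp 0 1 s - clamp 0 1 u)) by lra. apply Lip; lra.
  + apply Rle_lt_trans with (Rabs (u - s) * M); [apply Rmult_le_compat_r; auto|].
    apply Rle_lt_trans with (Rabs (u - s) * (M + 1)).
    * apply Rmult_le_compat_l; [apply Rabs_pos|lra].
    * apply Rmult_lt_compat_r with (r := M + 1) in Hu; [|lra].
      unfold Rdiv in Hu; rewrite Rmult_assoc, Rinv_l in Hu; lra.
Qed.

(** With [sin_offset], the cosine and sine of the difference between the argument of [f + i g] and
    [theta]. Unlike that difference, they are defined without choosing a branch. *)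
Definition cos_offset (f g theta : R) : R := (f * cos theta + g * sin theta) / sqrt (f * f + g * g).
Definition sin_offset (f g theta : R) : R := (g * cos theta - f * sin theta) / sqrt (f * f + g * g).

(** [th] turns exactly as fast as the argument of [F + i G], so their difference is stationary. *)
Lemma offset_derivative (F G th : R -> R) (s dF dG : R) :
  is_derive F s dF -> is_derive G s dG ->
  0 < F s * F s + G s * G s ->
  is_derive th s (angular_speed (F s) (G s) dF dG) ->
  is_derive (fun u => cos_offset (F u) (G u) (th u)) s 0 /\
  is_derive (fun u => sin_offset (F u) (G u) (th u)) s 0.
Proof.
intros HF HG Hp Hth.
assert (Sq : 0 < sqrt (F s * F s + G s * G s)) by now apply sqrt_lt_R0.
assert (SS := sqrt_sqrt (F s * F s + G s * G s) ltac:(lra)).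
assert (EF' : Derive (fun y => F y) s = dF) by now apply is_derive_unique.
assert (EG' : Derive (fun y => G y) s = dG) by now apply is_derive_unique.
assert (EP' : Derive (fun y => th y) s = angular_speed (F s) (G s) dF dG) by now apply is_derive_unique.
unfold cos_offset, sin_offset; split; auto_derive.
- repeat split; try (eexists; eauto; fail); auto; try lra.
- rewrite EF', EG', EP'. unfold angular_speed.
  set (q := sqrt (F s * F s + G s * G s)) in *. rewrite <- SS. field_simplify_eq; [|lra].
  replace (q ^ 2) with (F s * F s + G s * G s) by (rewrite <- SS; ring). ring.
- repeat split; try (eexists; eauto; fail); auto; try lra.
- rewrite EF', EG', EP'. unfold angular_speed.
  set (q := sqrt (F s * F s + G s * G s)) in *. rewrite <- SS. field_simplify_eq; [|lra].
  replace (q ^ 2) with (F s * F s + G s * G s) by (rewrite <- SS; ring). ring.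
Qed.

Lemma constant_of_zero_derivative (c : R -> R) a b :
  a <= b -> (forall s, continuity_pt c s) ->
  (forall s, a < s < b -> is_derive c s 0) -> c b = c a.
Proof.
intros Hab Hc Hd.
destruct (MVT_gen c a b (fun _ => 0)) as (x & _ & E).
- intros x; rewrite Rmin_left, Rmax_right by lra; auto.
- intros; apply Hc.
- lra.
Qed.

Lemma continuity_pt_offset (F G th : R -> R) s :
  continuity_pt F s -> continuity_pt G s -> continuity_pt th s ->
  0 < F s * F s + G s * G s ->
  continuity_pt (fun u => cos_offset (F u) (G u) (th u)) s /\
  continuity_pt (fun u => sin_offset (F u) (G u) (th u)) s.
Proof.
intros HF HG Hth Hp.
assert (Cc : continuity_pt (fun u => cos (th u)) s)
  by (apply (continuity_pt_comp th cos); auto; apply continuity_cos).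
assert (Cs : continuity_pt (fun u => sin (th u)) s)
  by (apply (continuity_pt_comp th sin); auto; apply continuity_sin).
assert (Cn : continuity_pt (fun u => sqrt (F u * F u + G u * G u)) s).
{ apply (continuity_pt_comp (fun u => F u * F u + G u * G u) sqrt).
  - apply continuity_pt_plus; apply continuity_pt_mult; auto.
  - apply continuity_pt_sqrt; lra. }
assert (Sq := sqrt_lt_R0 _ Hp).
unfold cos_offset, sin_offset; split; apply continuity_pt_div; auto; try lra.
- apply continuity_pt_plus; apply continuity_pt_mult; auto.
- apply continuity_pt_minus; apply continuity_pt_mult; auto.
Qed.

(** Constant offsets mean that [F + i G] is a positive multiple of [c + i d] turned by [th], so
    relative angles are differences of [th]. *)
Lemma offset_phase_lift (F G th : R -> R) c d :
  (forall s, continuity_pt th s) ->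
  (forall s, 0 <= s <= 1 -> 0 < F s * F s + G s * G s) ->
  (forall s, 0 <= s <= 1 -> cos_offset (F s) (G s) (th s) = c) ->
  (forall s, 0 <= s <= 1 -> sin_offset (F s) (G s) (th s) = d) ->
  phase_lift (fun s => (F s, G s)) th.
Proof.
intros Ct Hp Hc Hd; split; auto.
assert (H : forall s, 0 <= s <= 1 -> exists n, 0 < n /\ c * c + d * d = 1 /\
  F s = n * (c * cos (th s) - d * sin (th s)) /\
  G s = n * (c * sin (th s) + d * cos (th s))).
{ intros s Hs. specialize (Hp s Hs). specialize (Hc s Hs). specialize (Hd s Hs).
  assert (Sq := sqrt_lt_R0 _ Hp). assert (SS := sqrt_sqrt _ (Rlt_le _ _ Hp)).
  unfold cos_offset in Hc; unfold sin_offset in Hd.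
  set (q := sqrt (F s * F s + G s * G s)) in *.
  assert (S2 := sin2_cos2 (th s)); unfold Rsqr in S2.
  set (C := cos (th s)) in *. set (S := sin (th s)) in *.
  exists q; subst c d; repeat split; auto.
  - transitivity ((F s * F s + G s * G s) * (S * S + C * C) / (q * q)); [field; lra|].
    rewrite S2, SS; field; lra.
  - transitivity (F s * (S * S + C * C)); [rewrite S2; ring|field; lra].
  - transitivity (G s * (S * S + C * C)); [rewrite S2; ring|field; lra]. }
intros s s' Hs Hs'.
destruct (H s Hs) as (n & Hn & Hcd & EF & EG).
destruct (H s' Hs') as (n' & Hn' & _ & EF' & EG').
exists (n * n'); unfold cdot, cdet; simpl. rewrite EF, EG, EF', EG', cos_minus, sin_minus.
repeat split.
- now apply Rmult_lt_0_compat.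
- transitivity (n * n' * (c * c + d * d) *
    (cos (th s') * cos (th s) + sin (th s') * sin (th s))); [ring|rewrite Hcd; ring].
- transitivity (n * n' * (c * c + d * d) *
    (sin (th s') * cos (th s) - cos (th s') * sin (th s))); [ring|rewrite Hcd; ring].
Qed.

Lemma phase_lift_ext E E' theta :
  (forall s, E s = E' s) -> phase_lift E theta -> phase_lift E' theta.
Proof.
intros He [HL Hc]; split; auto.
intros s s' Hs Hs'; rewrite <- !He; auto.
Qed.

(** The lift is the running integral of [k dx - omega dt]. On each smooth piece it has the angular
    speed of the field, so its offset from the argument of the field is constant. *)
Lemma circulation_phase_lift B fx ft gx gt X T I :
  C1_2d (fun x t => fst (B x t)) fx ft -> C1_2d (fun x t => snd (B x t)) gx gt ->
  contour X T ->
  (forall s, 0 <= s <= 1 -> B (X s) (T s) <> RtoC 0) ->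
  phase_circulation B X T I ->
  exists theta,
    phase_lift (fun s => B (X (clamp 0 1 s)) (T (clamp 0 1 s))) theta /\
    theta 1 - theta 0 = I.
Proof.
intros HF HG Hcon Hne (k & omega & Hko & HI).
destruct (contour_continuous_loop X T Hcon) as (CX & CT & _).
set (h := fun s => k (X s) (T s) * Derive X s - omega (X s) (T s) * Derive T s) in *.
set (theta := fun s => RInt h 0 (clamp 0 1 s)).
set (F := fun s => fst (B (X (clamp 0 1 s)) (T (clamp 0 1 s)))).
set (G := fun s => snd (B (X (clamp 0 1 s)) (T (clamp 0 1 s)))).
assert (Hex : ex_RInt h 0 1) by (eexists; eauto).
assert (Ct : forall s, continuity_pt theta s) by now apply continuity_pt_RInt.
assert (CF : forall s, continuity_pt F s).
{ intros s. apply (continuity_2d_pt_along (fun x t => fst (B x t)) (fun s => X (clamp 0 1 s))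
    (fun s => T (clamp 0 1 s))); auto. eapply C1_2d_continuous, HF. }
assert (CG : forall s, continuity_pt G s).
{ intros s. apply (continuity_2d_pt_along (fun x t => snd (B x t)) (fun s => X (clamp 0 1 s))
    (fun s => T (clamp 0 1 s))); auto. eapply C1_2d_continuous, HG. }
assert (Pos : forall s, 0 < F s * F s + G s * G s).
{ intros s. assert (N := Hne (clamp 0 1 s) (clamp_range 0 1 s ltac:(lra))).
  unfold F, G. set (z := B (X (clamp 0 1 s)) (T (clamp 0 1 s))) in *.
  destruct (Req_dec (fst z) 0) as [Q1|Q1]; [destruct (Req_dec (snd z) 0) as [Q2|Q2]|].
  - exfalso; apply N; apply injective_projections; auto.
  - nra.
  - nra. }
destruct Hcon as ((N & sigma & S0 & SN & Hs & Hp) & _).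
assert (Deriv : forall i s, (i < N)%nat -> sigma i < s < sigma (S i) ->
  is_derive (fun u => cos_offset (F u) (G u) (theta u)) s 0 /\
  is_derive (fun u => sin_offset (F u) (G u) (theta u)) s 0).
{ intros i s Hi Hsi. destruct (Hp i Hi) as (Xi & Ti & CXi & CTi & E).
  assert (L0 : 0 <= sigma i) by (rewrite <- S0; apply sorted_le with N; auto; lia).
  assert (L1 : sigma (S i) <= 1).
  { rewrite <- SN. clear - Hs Hi. induction N as [|N IH]; [lia|].
    destruct (Nat.eq_dec i N) as [->|Hn]; [lra|].
    apply Rle_trans with (sigma N); [apply IH; [intros; apply Hs|]; lia|].
    left; apply Hs; lia. }
  assert (Loc : locally s (fun u => sigma i < u < sigma (S i))).
  { apply filter_and; [apply (open_gt (sigma i))|apply (open_lt (sigma (S i)))]; lra. }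
  destruct (CXi s) as [DX CDX]. destruct (CTi s) as [DT CDT].
  apply Derive_correct in DX. apply Derive_correct in DT.
  assert (EFG : forall u, sigma i < u < sigma (S i) ->
     X (clamp 0 1 u) = Xi u /\ T (clamp 0 1 u) = Ti u).
  { intros u Hu. rewrite clamp_id by lra. apply E; lra. }
  destruct (EFG s Hsi) as [EXs ETs].
  apply offset_derivative with
    (dF := fx (Xi s) (Ti s) * Derive Xi s + ft (Xi s) (Ti s) * Derive Ti s)
    (dG := gx (Xi s) (Ti s) * Derive Xi s + gt (Xi s) (Ti s) * Derive Ti s).
  - apply is_derive_ext_loc with (fun u => fst (B (Xi u) (Ti u))).
    + revert Loc; apply filter_imp; intros u Hu. unfold F.
      now destruct (EFG u Hu) as [-> ->].
    + apply (C1_2d_along (fun x t => fst (B x t))); auto.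
  - apply is_derive_ext_loc with (fun u => snd (B (Xi u) (Ti u))).
    + revert Loc; apply filter_imp; intros u Hu. unfold G.
      now destruct (EFG u Hu) as [-> ->].
    + apply (C1_2d_along (fun x t => snd (B x t))); auto.
  - apply Pos.
  - set (H := fun u => angular_speed (F u) (G u)
      (fx (Xi u) (Ti u) * Derive Xi u + ft (Xi u) (Ti u) * Derive Ti u)
      (gx (Xi u) (Ti u) * Derive Xi u + gt (Xi u) (Ti u) * Derive Ti u)).
    (* [H] is a continuous expression for the integrand on an open piece, as the fundamental theorem
       requires; nothing is claimed at the corners, where [Derive X] is arbitrary. *)
    assert (EH : forall u, sigma i < u < sigma (S i) -> h u = H u).
    { intros u Hu. unfold h.
      assert (Lu : locally u (fun v => sigma i < v < sigma (S i))).
      { apply filter_and; [apply (open_gt (sigma i))|apply (open_lt (sigma (S i)))]; lra. }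
      assert (Hu1 : 0 <= u <= 1) by lra.
      rewrite (Derive_ext_loc X Xi), (Derive_ext_loc T Ti).
      2: revert Lu; apply filter_imp; intros v Hv; apply E; lra.
      2: revert Lu; apply filter_imp; intros v Hv; apply E; lra.
      destruct (wavenumber_frequency_formula B fx ft gx gt _ _ _ _ HF HG (Hne u Hu1) (Hko u Hu1))
        as [Ek Eo].
      replace (k (X u) (T u) * Derive Xi u - omega (X u) (T u) * Derive Ti u)
        with (k (X u) (T u) * Derive Xi u + (- omega (X u) (T u)) * Derive Ti u) by ring.
      rewrite Ek, Eo. unfold H, F, G, angular_speed.
      destruct (E u ltac:(lra)) as [E1 E2]. rewrite (clamp_id 0 1 u) by lra. rewrite E1, E2.
      field. assert (P := Pos u). unfold F, G in P.
      rewrite (clamp_id 0 1 u) in P by lra. rewrite E1, E2 in P. lra. }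
    change (is_derive theta s (H s)). rewrite <- EH by auto.
    apply is_derive_ext_loc with (fun u => RInt h 0 u).
    { revert Loc; apply filter_imp; intros u Hu. unfold theta; now rewrite clamp_id by lra. }
    apply (is_derive_RInt h _ 0 s).
    + revert Loc; apply filter_imp; intros u Hu. apply (RInt_correct h).
      apply ex_RInt_Chasles_1 with 1; [lra|auto].
    + apply continuous_ext_loc with H.
      { revert Loc; apply filter_imp; intros u Hu; symmetry; now apply EH. }
      apply continuity_pt_filterlim.
      assert (Cf : forall f, Defs.C1 f -> forall s, continuity_pt f s).
      { intros f Hf u. apply continuity_pt_filterlim.
        apply (ex_derive_continuous (K := R_AbsRing) (V := R_NormedModule) f u), Hf. }
      assert (Cd : forall f, Defs.C1 f -> forall s, continuity_pt (Derive f) s).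
      { intros f Hf u. apply continuity_pt_filterlim, Hf. }
      assert (Ca : forall f, (forall x t, continuity_2d_pt f x t) ->
         continuity_pt (fun u => f (Xi u) (Ti u)) s).
      { intros f Hf; apply continuity_2d_pt_along; auto. }
      destruct HF as (_ & _ & HF3 & HF4). destruct HG as (_ & _ & HG3 & HG4).
      assert (CdF : continuity_pt (fun u =>
        fx (Xi u) (Ti u) * Derive Xi u + ft (Xi u) (Ti u) * Derive Ti u) s).
      { apply continuity_pt_plus; apply continuity_pt_mult; auto. }
      assert (CdG : continuity_pt (fun u =>
        gx (Xi u) (Ti u) * Derive Xi u + gt (Xi u) (Ti u) * Derive Ti u) s).
      { apply continuity_pt_plus; apply continuity_pt_mult; auto. }
      unfold H, angular_speed. apply continuity_pt_div.
      * apply continuity_pt_minus; apply continuity_pt_mult; auto.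
      * apply continuity_pt_plus; apply continuity_pt_mult; auto.
      * assert (P := Pos s); lra. }
(* Zero derivatives inside the pieces and continuity across the corners give one constant for the
   whole interval. *)
assert (Const : forall (c : R -> R), (forall s, continuity_pt c s) ->
  (forall i s, (i < N)%nat -> sigma i < s < sigma (S i) -> is_derive c s 0) ->
  forall s, 0 <= s <= 1 -> c s = c 0).
{ intros c Cc Dc.
  assert (Hi : forall i, (i <= N)%nat -> forall s, 0 <= s <= sigma i -> c s = c 0).
  { induction i as [|i IH]; intros Hi s Hsi.
    - rewrite S0 in Hsi; f_equal; lra.
    - assert (L0 : 0 <= sigma i) by (rewrite <- S0; apply sorted_le with N; auto; lia).
      destruct (Rle_lt_dec s (sigma i)) as [L|L]; [apply IH; [lia|lra]|].
      transitivity (c (sigma i)); [|apply IH; [lia|lra]].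
      apply constant_of_zero_derivative; auto; [lra|].
      intros u Hu; apply (Dc i); [lia|lra]. }
  intros s Hs01; apply (Hi N); [lia|rewrite SN; auto]. }
exists theta; split.
- apply phase_lift_ext with (fun s => (F s, G s)).
  { intros s; unfold F, G. now rewrite <- surjective_pairing. }
  apply offset_phase_lift with (cos_offset (F 0) (G 0) (theta 0)) (sin_offset (F 0) (G 0) (theta 0)); auto.
  + apply (Const (fun s => cos_offset (F s) (G s) (theta s))).
    * intros s; apply continuity_pt_offset; auto.
    * intros i s Hi Hsi; apply (Deriv i); auto.
  + apply (Const (fun s => sin_offset (F s) (G s) (theta s))).
    * intros s; apply continuity_pt_offset; auto.
    * intros i s Hi Hsi; apply (Deriv i); auto.
- unfold theta. rewrite !clamp_id by lra.
  rewrite (is_RInt_unique h 0 1 I) by auto. rewrite RInt_point. apply Rminus_0_r.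
Qed.

(** * The Chu-Mei quotient at a zero *)

Lemma closed_bounded_max (E : R -> Prop) L :
  (forall x, ~ E x -> exists d, 0 < d /\ forall y, Rabs (y - x) < d -> ~ E y) ->
  (forall x, E x -> x <= L) -> (exists x, E x) ->
  exists x, E x /\ forall y, E y -> y <= x.
Proof.
intros Hcl Hb Hne.
destruct (completeness E) as (c & Hub & Hlub).
- exists L; intros x Hx; auto.
- auto.
- exists c; split; [|intros y Hy; now apply Hub].
  apply NNPP; intros Nc. destruct (Hcl c Nc) as (d & Hd & Hy).
  assert (c <= c - d); [|lra]. apply Hlub; intros y Ey.
  apply Rnot_lt_le; intros Hlt. apply (Hy y); auto.
  assert (y <= c) by now apply Hub. apply Rabs_def1; lra.
Qed.

(** The first coordinate is negated so that [closed_bounded_max] serves both times. Compactness of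
    the interval of second coordinates makes the projection of the set closed. *)
Lemma leftmost_topmost (Z : R -> R -> Prop) L :
  (forall x t, ~ Z x t -> exists d, 0 < d /\ forall x' t', within d x t x' t' -> ~ Z x' t') ->
  (forall x t, Z x t -> - L <= x <= L /\ - L <= t <= L) -> (exists x t, Z x t) ->
  exists x t, Z x t /\ (forall x' t', Z x' t' -> x <= x') /\ (forall t', Z x t' -> t' <= t).
Proof.
intros Hcl Hb (x0 & t0 & H0).
destruct (closed_bounded_max (fun y => exists t, Z (- y) t) L) as (y & (t1 & Hy) & Hmax).
- intros y Hy.
  assert (Hd : forall t, exists d : posreal, forall x' t', within d (- y) t x' t' -> ~ Z x' t').
  { intros t. destruct (Hcl (- y) t) as (d & Hd & H).
    - intros HZ; apply Hy; now exists t.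
    - now exists (mkposreal d Hd). }
  set (delta := fun t => proj1_sig (constructive_indefinite_description _ (Hd t))).
  destruct (compactness_value_1d (- L) L delta) as (d & Hdd).
  exists d; split; [apply d|]. intros y' Hy' (t & HZ).
  apply (Hdd t); [apply (Hb _ _ HZ)|]. intros (t' & _ & H1 & H2).
  revert H1 H2; unfold delta.
  destruct (constructive_indefinite_description _ (Hd t')) as (e & He); simpl; intros H1 H2.
  apply (He (- y') t); auto. split; auto.
  replace (- y' - - y) with (- (y' - y)) by ring. rewrite Rabs_Ropp; lra.
- intros y (t & HZ); apply Hb in HZ; lra.
- exists (- x0), t0. now rewrite Ropp_involutive.
- destruct (closed_bounded_max (fun t => Z (- y) t) L) as (t & Ht & Htop).
  + intros t Ht. destruct (Hcl _ _ Ht) as (d & Hd & H). exists d; split; auto.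
    intros t' Ht'; apply H; split; auto. rewrite Rminus_diag, Rabs_R0; lra.
  + intros t Ht; apply Hb in Ht; lra.
  + now exists t1.
  + exists (- y), t; repeat split; auto.
    intros x' t' HZ. assert (- x' <= y); [|lra].
    apply Hmax; exists t'; now rewrite Ropp_involutive.
Qed.

(** * Second derivative of a modulus *)

Definition twice_derivable (f f' f'' : R -> R) : Prop :=
  (forall s, is_derive f s (f' s)) /\ (forall s, is_derive f' s (f'' s)).

Definition modulus (F G : R -> R) (s : R) : R := sqrt (F s * F s + G s * G s).

Definition modulus' (F G F' G' : R -> R) (s : R) : R :=
  (F s * F' s + G s * G' s) / modulus F G s.

(** For [z = r e^(i phi)] the real part of [z''/z] is [r''/r - phi'^2]. Solved for [r''/r], this is
    the formula, with [angular_speed] as [phi']. *)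
Definition modulus_quotient (f g df dg ddf ddg : R) : R :=
  (f * ddf + g * ddg) / (f * f + g * g) + (angular_speed f g df dg) ^ 2.

Lemma modulus_derivative F G F' G' F'' G'' s :
  twice_derivable F F' F'' -> twice_derivable G G' G'' -> 0 < F s * F s + G s * G s ->
  is_derive (modulus F G) s (modulus' F G F' G' s) /\
  is_derive (modulus' F G F' G') s
    (modulus_quotient (F s) (G s) (F' s) (G' s) (F'' s) (G'' s) * modulus F G s).
Proof.
intros [HF HF'] [HG HG'] Hp.
assert (E1 : Derive (fun u => F u) s = F' s) by now apply is_derive_unique.
assert (E2 : Derive (fun u => G u) s = G' s) by now apply is_derive_unique.
assert (E3 : Derive (fun u => F' u) s = F'' s) by now apply is_derive_unique.
assert (E4 : Derive (fun u => G' u) s = G'' s) by now apply is_derive_unique.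
assert (Sq := sqrt_lt_R0 _ Hp). assert (SS := sqrt_sqrt _ (Rlt_le _ _ Hp)).
split; unfold modulus', modulus; auto_derive.
- repeat split; try (eexists; eauto; fail); auto.
- rewrite E1, E2. field. lra.
- repeat split; try (eexists; eauto; fail); auto; lra.
- rewrite E1, E2, E3, E4. unfold modulus_quotient, angular_speed.
  set (q := sqrt (F s * F s + G s * G s)) in *. rewrite <- SS.
  field_simplify_eq; [|lra].
  replace (q ^ 4) with ((F s * F s + G s * G s) * (q * q)) by (rewrite <- SS; ring).
  replace (q ^ 2) with (F s * F s + G s * G s) by (rewrite <- SS; ring).
  rewrite ?SS. ring.
Qed.

Lemma modulus_second_derivative F G F' G' F'' G'' t :
  twice_derivable F F' F'' -> twice_derivable G G' G'' -> 0 < F t * F t + G t * G t ->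
  Derive_n (modulus F G) 2 t / modulus F G t =
    modulus_quotient (F t) (G t) (F' t) (G' t) (F'' t) (G'' t).
Proof.
intros HF HG Hp.
assert (Hloc : locally t (fun s => 0 < F s * F s + G s * G s)).
{ assert (Cc : continuous (fun s => F s * F s + G s * G s) t).
  { apply (ex_derive_continuous (K := R_AbsRing) (V := R_NormedModule)).
    destruct HF as [HF _], HG as [HG _].
    auto_derive; repeat split; eexists; eauto. }
  apply Cc. apply (open_gt 0); auto. }
assert (Sq : 0 < modulus F G t) by now apply sqrt_lt_R0.
assert (E : Derive_n (modulus F G) 2 t =
  modulus_quotient (F t) (G t) (F' t) (G' t) (F'' t) (G'' t) * modulus F G t).
{ simpl. transitivity (Derive (modulus' F G F' G') t).
  - apply Derive_ext_loc. revert Hloc; apply filter_imp; intros s Hs.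
    apply is_derive_unique. destruct (modulus_derivative F G F' G' F'' G'' s); auto.
  - apply is_derive_unique. apply modulus_derivative; auto. }
rewrite E; field; lra.
Qed.

(* Gronwall for the energy [f^2 + f'^2]. *)
Lemma second_order_uniqueness (f f' f'' : R -> R) a b M :
  0 <= M ->
  (forall s, a < s < b -> is_derive f s (f' s) /\ is_derive f' s (f'' s) /\
     Rabs (f'' s) <= M * Rabs (f s)) ->
  (forall eps s, 0 < eps -> a < s -> exists r, a < r < s /\ f r * f r + f' r * f' r < eps) ->
  forall s, a < s < b -> f s = 0.
Proof.
intros M0 Hd Hlim s Hs.
(* [2 f f' + 2 f' f''] is at most [2 (1 + M) |f| |f'|], hence at most [K] times the energy; the
   weight [exp (- K * u)] makes the energy nonincreasing. *)
set (K := 1 + M).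
set (E := fun u => (f u * f u + f' u * f' u) * exp (- K * u)).
set (E' := fun u => (2 * f u * f' u + 2 * f' u * f'' u
     - K * (f u * f u + f' u * f' u)) * exp (- K * u)).
assert (DE : forall u, a < u < b -> is_derive E u (E' u)).
{ intros u Hu. destruct (Hd u Hu) as (H1 & H2 & _). unfold E.
  assert (E1 : Derive (fun u => f u) u = f' u) by now apply is_derive_unique.
  assert (E2 : Derive (fun u => f' u) u = f'' u) by now apply is_derive_unique.
  auto_derive.
  - repeat split; eexists; eauto.
  - rewrite E1, E2; unfold E'. ring. }
assert (Neg : forall u, a < u < b -> E' u <= 0).
{ intros u Hu. destruct (Hd u Hu) as (_ & _ & H3). unfold E'.
  assert (Ex := exp_pos (- K * u)).
  assert (B1 : f u * f' u <= Rabs (f u) * Rabs (f' u)) by (rewrite <- Rabs_mult; apply Rle_abs).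
  assert (B2 : f' u * f'' u <= Rabs (f' u) * (M * Rabs (f u))).
  { eapply Rle_trans; [apply Rle_abs|]. rewrite Rabs_mult.
    apply Rmult_le_compat_l; [apply Rabs_pos|auto]. }
  assert (U : f u * f u = Rabs (f u) * Rabs (f u)) by apply sqr_Rabs.
  assert (V : f' u * f' u = Rabs (f' u) * Rabs (f' u)) by apply sqr_Rabs.
  assert (D := Rle_0_sqr (Rabs (f u) - Rabs (f' u))); unfold Rsqr in D.
  assert (D' := Rmult_le_pos _ _ M0 D).
  rewrite <- (Rmult_0_l (exp (- K * u))). apply Rmult_le_compat_r; [lra|].
  rewrite U, V; unfold K; lra. }
assert (Dec : forall r, a < r < s -> E s <= E r).
{ intros r Hr.
  destruct (MVT_gen E r s E') as (c & Hc & EQ).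
  - intros x Hx; rewrite Rmin_left, Rmax_right in Hx by lra. apply DE; lra.
  - intros x Hx; rewrite Rmin_left, Rmax_right in Hx by lra.
    apply continuity_pt_filterlim. apply (ex_derive_continuous (K := R_AbsRing) (V := R_NormedModule)).
    eexists; apply DE; lra.
  - rewrite Rmin_left, Rmax_right in Hc by lra.
    assert (N := Neg c ltac:(lra)). nra. }
apply NNPP; intros Hne.
assert (Es : 0 < E s).
{ unfold E. apply Rmult_lt_0_compat; [nra|apply exp_pos]. }
assert (Ea := exp_pos (- K * a)).
(* The energy is small only arbitrarily close to [a]: at [a] itself a modulus need not be
   differentiable. The weight is bounded there by its value at [a]. *)
destruct (Hlim (E s / exp (- K * a)) s) as (r & Hr & Lr); [now apply Rdiv_lt_0_compat|lra|].
assert (D := Dec r Hr).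
assert (E r < E s); [|lra].
apply Rle_lt_trans with ((f r * f r + f' r * f' r) * exp (- K * a)).
- unfold E. apply Rmult_le_compat_l; [nra|]. left; apply exp_increasing. unfold K; nra.
- apply Rmult_lt_compat_r with (r := exp (- K * a)) in Lr; auto.
  unfold Rdiv in Lr; rewrite Rmult_assoc, Rinv_l in Lr; lra.
Qed.

Definition C2_in_time (F Ft Ftt : R -> R -> R) : Prop :=
  (forall x, twice_derivable (F x) (Ft x) (Ftt x)) /\
  (forall x t, continuity_2d_pt F x t) /\ (forall x t, continuity_2d_pt Ft x t) /\
  (forall x t, continuity_2d_pt Ftt x t).

(** Multiplying [f + i g] by the constant [b1 - i b2] scales the modulus by a constant factor and
    leaves [r''/r] unchanged. *)
Lemma modulus_quotient_rotation b1 b2 f g df dg ddf ddg :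
  b1 * b1 + b2 * b2 <> 0 -> f * f + g * g <> 0 ->
  modulus_quotient (b1 * f + b2 * g) (b1 * g - b2 * f) (b1 * df + b2 * dg)
    (b1 * dg - b2 * df) (b1 * ddf + b2 * ddg) (b1 * ddg - b2 * ddf) =
  modulus_quotient f g df dg ddf ddg.
Proof.
intros Hb Hn. unfold modulus_quotient, angular_speed.
replace ((b1 * f + b2 * g) * (b1 * f + b2 * g) + (b1 * g - b2 * f) * (b1 * g - b2 * f))
  with ((b1 * b1 + b2 * b2) * (f * f + g * g)) by ring.
replace ((b1 * f + b2 * g) * (b1 * ddf + b2 * ddg) + (b1 * g - b2 * f) * (b1 * ddg - b2 * ddf))
  with ((b1 * b1 + b2 * b2) * (f * ddf + g * ddg)) by ring.
replace ((b1 * f + b2 * g) * (b1 * dg - b2 * df) - (b1 * g - b2 * f) * (b1 * df + b2 * dg))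
  with ((b1 * b1 + b2 * b2) * (f * dg - g * df)) by ring.
field; auto.
Qed.

Lemma chu_mei_formula (a F Ft Ftt G Gt Gtt : R -> R -> R) x t :
  (forall x t, a x t = modulus (F x) (G x) t) ->
  C2_in_time F Ft Ftt -> C2_in_time G Gt Gtt -> 0 < F x t * F x t + G x t * G x t ->
  chu_mei a x t = modulus_quotient (F x t) (G x t) (Ft x t) (Gt x t) (Ftt x t) (Gtt x t).
Proof.
intros Ha [HF _] [HG _] Hp. unfold chu_mei.
rewrite (Derive_n_ext _ (modulus (F x) (G x))) by auto. rewrite Ha.
now apply modulus_second_derivative.
Qed.

Lemma sum_squares_pos f g : ~ (f = 0 /\ g = 0) -> 0 < f * f + g * g.
Proof.
intros H. destruct (Req_dec f 0) as [E|E]; [destruct (Req_dec g 0) as [E'|E']; [tauto|]|]; nra.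
Qed.

Lemma C2_in_time_combination F Ft Ftt G Gt Gtt b1 b2 :
  C2_in_time F Ft Ftt -> C2_in_time G Gt Gtt ->
  C2_in_time (fun x t => b1 * F x t + b2 * G x t) (fun x t => b1 * Ft x t + b2 * Gt x t)
    (fun x t => b1 * Ftt x t + b2 * Gtt x t).
Proof.
intros (HF & CF & CFt & CFtt) (HG & CG & CGt & CGtt).
assert (CL : forall f g : R -> R -> R, (forall x t, continuity_2d_pt f x t) ->
  (forall x t, continuity_2d_pt g x t) ->
  forall x t, continuity_2d_pt (fun x t => b1 * f x t + b2 * g x t) x t).
{ intros f g Hf Hg x t. apply continuity_2d_pt_plus; apply continuity_2d_pt_mult; auto;
  apply continuity_2d_pt_const. }
assert (DL : forall (f g f' g' : R -> R), (forall s, is_derive f s (f' s)) ->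
  (forall s, is_derive g s (g' s)) ->
  forall s, is_derive (fun u => b1 * f u + b2 * g u) s (b1 * f' s + b2 * g' s)).
{ intros f g f' g' Hf Hg s.
  assert (E1 : Derive (fun u => f u) s = f' s) by now apply is_derive_unique.
  assert (E2 : Derive (fun u => g u) s = g' s) by now apply is_derive_unique.
  auto_derive; [repeat split; eexists; eauto|rewrite E1, E2; ring]. }
split; [|split; [|split]]; auto.
intros x; split; apply DL; apply HF || apply HG.
Qed.

Lemma continuity_2d_pt_close f x t e : continuity_2d_pt f x t -> 0 < e ->
  exists d, 0 < d /\ forall x' t', within d x t x' t' -> Rabs (f x' t' - f x t) < e.
Proof.
intros Hf He. destruct (Hf (mkposreal e He)) as (d & Hd). simpl in Hd.
exists d; split; [apply d|]. intros x' t' [H1 H2]; now apply Hd.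
Qed.

Lemma mean_value (f f' : R -> R) a b : (forall s, is_derive f s (f' s)) ->
  exists c, Rmin a b <= c <= Rmax a b /\ f b - f a = f' c * (b - a).
Proof.
intros Hf. apply MVT_gen; auto.
intros x _. apply continuity_pt_filterlim.
apply (ex_derive_continuous (K := R_AbsRing) (V := R_NormedModule)). eexists; apply Hf.
Qed.

(** For [z = F + i G] and [r = |z|], the energy [r^2 + r'^2] is at most [|z|^2 + |z_t|^2], which
    tends to 0 at a flat zero. A bounded quotient gives [|r''| <= M r] above it. *)
Lemma flat_zero_not_bounded a F Ft Ftt G Gt Gtt xh th :
  (forall x t, a x t = modulus (F x) (G x) t) ->
  C2_in_time F Ft Ftt -> C2_in_time G Gt Gtt ->
  F xh th = 0 -> G xh th = 0 -> Ft xh th = 0 -> Gt xh th = 0 ->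
  (exists d, 0 < d /\ forall t, th < t < th + d -> ~ (F xh t = 0 /\ G xh t = 0)) ->
  ~ chu_mei_bounded_at a xh th.
Proof.
intros Ha HF HG F0 G0 Ft0 Gt0 (d & Hd & Htop) (M & d' & HM).
assert (Hd' : 0 < d') by apply d'.
set (e := Rmin d d'). assert (He : 0 < e) by now apply Rmin_glb_lt.
assert (Le1 := Rmin_l d d'). assert (Le2 := Rmin_r d d').
assert (Pos : forall s, th < s < th + e -> 0 < F xh s * F xh s + G xh s * G xh s).
{ intros s Hs; apply sum_squares_pos, Htop; unfold e in *; lra. }
assert (Z : modulus (F xh) (G xh) (th + e / 2) = 0).
{ apply (second_order_uniqueness (modulus (F xh) (G xh))
    (modulus' (F xh) (G xh) (Ft xh) (Gt xh))
    (fun s => modulus_quotient (F xh s) (G xh s) (Ft xh s) (Gt xh s) (Ftt xh s) (Gtt xh s)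
       * modulus (F xh) (G xh) s) th (th + e) (Rabs M)).
  - apply Rabs_pos.
  - intros s Hs. specialize (Pos s Hs).
    destruct (modulus_derivative (F xh) (G xh) (Ft xh) (Gt xh) (Ftt xh) (Gtt xh) s) as [D1 D2];
      [apply HF|apply HG|auto|].
    split; [auto|split; [auto|]].
    rewrite Rabs_mult. apply Rmult_le_compat_r; [apply Rabs_pos|].
    rewrite <- (chu_mei_formula a F Ft Ftt G Gt Gtt xh s); auto.
    eapply Rle_trans; [apply HM|apply Rle_abs].
    + rewrite Rminus_diag, Rabs_R0; auto.
    + unfold e in *; apply Rabs_def1; lra.
    + rewrite Ha. apply Rgt_not_eq, sqrt_lt_R0; auto.
  - intros eps s Heps Hs.
    assert (Cont : continuity_2d_pt (fun x t => F x t * F x t + G x t * G x t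
       + (Ft x t * Ft x t + Gt x t * Gt x t)) xh th).
    { destruct HF as (_ & C1 & C2 & _), HG as (_ & C3 & C4 & _).
      repeat apply continuity_2d_pt_plus; apply continuity_2d_pt_mult; auto. }
    destruct (continuity_2d_pt_close _ _ _ _ Cont Heps) as (r & Hr & Hclose).
    set (r' := Rmin (Rmin (e / 2) (r / 2)) ((s - th) / 2)).
    assert (R0 : 0 < r') by (repeat apply Rmin_glb_lt; lra).
    assert (R1 : r' <= e / 2 /\ r' <= r / 2 /\ r' <= (s - th) / 2).
    { unfold r'. assert (A1 := Rmin_l (Rmin (e / 2) (r / 2)) ((s - th) / 2)).
      assert (A2 := Rmin_r (Rmin (e / 2) (r / 2)) ((s - th) / 2)).
      assert (A3 := Rmin_l (e / 2) (r / 2)). assert (A4 := Rmin_r (e / 2) (r / 2)).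
      repeat split; lra. }
    exists (th + r'); split; [lra|].
    specialize (Pos (th + r') ltac:(lra)).
    assert (Cl := Hclose xh (th + r')).
    rewrite F0, G0, Ft0, Gt0 in Cl.
    assert (Cl' : F xh (th + r') * F xh (th + r') + G xh (th + r') * G xh (th + r') +
      (Ft xh (th + r') * Ft xh (th + r') + Gt xh (th + r') * Gt xh (th + r')) < eps).
    { eapply Rle_lt_trans; [apply Rle_abs|]. eapply Rle_lt_trans; [|apply Cl].
      - right; f_equal; ring.
      - split; [rewrite Rminus_diag, Rabs_R0; auto|apply Rabs_def1; lra]. }
    assert (Sq := sqrt_lt_R0 _ Pos). assert (SS := sqrt_sqrt _ (Rlt_le _ _ Pos)).
    unfold modulus', modulus.
    set (f := F xh (th + r')) in *. set (g := G xh (th + r')) in *.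
    set (f' := Ft xh (th + r')) in *. set (g' := Gt xh (th + r')) in *.
    set (q := sqrt (f * f + g * g)) in *.
    (* Cauchy-Schwarz: the modulus changes no faster than the field. *)
    assert ((f * f' + g * g') / q * ((f * f' + g * g') / q) <= f' * f' + g' * g').
    { apply Rmult_le_reg_r with (q * q); [nra|].
      replace ((f * f' + g * g') / q * ((f * f' + g * g') / q) * (q * q))
        with ((f * f' + g * g') * (f * f' + g * g')) by (field; lra).
      rewrite SS. assert (D := Rle_0_sqr (f * g' - g * f')); unfold Rsqr in D. lra. }
    lra.
  - lra. }
revert Z. apply Rgt_not_eq, sqrt_lt_R0, Pos; lra.
Qed.

(** The rotation is multiplication by the conjugate of the time derivative at the zero, so [u_t]
    equals the squared modulus [beta] of that derivative there. At a zero of [u], the quotient times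
    [v^2] is [u_t^2 + v v_tt], and boundedness would make [u_t] small. *)
Lemma steep_zero_not_bounded a F Ft Ftt G Gt Gtt xh th :
  (forall x t, a x t = modulus (F x) (G x) t) ->
  C2_in_time F Ft Ftt -> C2_in_time G Gt Gtt ->
  F xh th = 0 -> G xh th = 0 -> ~ (Ft xh th = 0 /\ Gt xh th = 0) ->
  (exists d, 0 < d /\ forall x t, x < xh -> within d xh th x t -> ~ (F x t = 0 /\ G x t = 0)) ->
  ~ chu_mei_bounded_at a xh th.
Proof.
intros Ha HF HG F0 G0 Hb (d & Hd & Hleft) (M & d' & HM).
set (b1 := Ft xh th) in *. set (b2 := Gt xh th) in *.
set (u := fun x t => b1 * F x t + b2 * G x t).
set (ut := fun x t => b1 * Ft x t + b2 * Gt x t).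
set (utt := fun x t => b1 * Ftt x t + b2 * Gtt x t).
set (v := fun x t => b1 * G x t + - b2 * F x t).
set (vt := fun x t => b1 * Gt x t + - b2 * Ft x t).
set (vtt := fun x t => b1 * Gtt x t + - b2 * Ftt x t).
assert (Cu : C2_in_time u ut utt) by now apply C2_in_time_combination.
assert (Cv : C2_in_time v vt vtt) by now apply C2_in_time_combination.
set (beta := b1 * b1 + b2 * b2).
assert (Hbeta : 0 < beta) by now apply sum_squares_pos.
assert (U0 : u xh th = 0) by (unfold u; rewrite F0, G0; ring).
assert (V0 : v xh th = 0) by (unfold v; rewrite F0, G0; ring).
assert (Ut0 : ut xh th = beta) by (unfold ut, beta, b1, b2; ring).
set (C := Rabs (vtt xh th) + 1).
assert (C0 : 0 < C) by (generalize (Rabs_pos (vtt xh th)); unfold C; lra).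
set (M' := Rabs M). assert (M0 : 0 <= M') by apply Rabs_pos.
(* At the zero of [u] found below, boundedness gives [ut^2 <= (M' + C) * eps], against
   [ut > beta / 2]. The minimum with 1 turns [|v| < eps] into [v^2 <= eps]. *)
set (eps := Rmin 1 (beta * beta / 4 / (M' + C + 1))).
assert (Heps : 0 < eps).
{ apply Rmin_glb_lt; [lra|]. apply Rdiv_lt_0_compat; [nra|lra]. }
assert (Heps1 : eps <= 1) by apply Rmin_l.
assert (Heps2 : eps * (M' + C + 1) <= beta * beta / 4).
{ apply Rle_trans with (beta * beta / 4 / (M' + C + 1) * (M' + C + 1)).
  - apply Rmult_le_compat_r; [lra|apply Rmin_r].
  - right; field; lra. }
destruct Cu as (Du & Cu & Cut & _). destruct Cv as (_ & Cv & _ & Cvtt).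
destruct (continuity_2d_pt_close ut xh th (beta / 2) (Cut xh th)) as (r1 & R1 & H1); [lra|].
destruct (continuity_2d_pt_close v xh th eps (Cv xh th) Heps) as (r2 & R2 & H2).
destruct (continuity_2d_pt_close vtt xh th 1 (Cvtt xh th)) as (r3 & R3 & H3); [lra|].
assert (Hd' : 0 < d') by apply d'.
set (r := Rmin (Rmin r1 r2) (Rmin r3 (Rmin d d'))).
assert (R0 : 0 < r) by (repeat apply Rmin_glb_lt; auto).
assert (Lr : r <= r1 /\ r <= r2 /\ r <= r3 /\ r <= d /\ r <= d').
{ unfold r. assert (A1 := Rmin_l (Rmin r1 r2) (Rmin r3 (Rmin d d'))).
  assert (A2 := Rmin_r (Rmin r1 r2) (Rmin r3 (Rmin d d'))).
  assert (A3 := Rmin_l r1 r2). assert (A4 := Rmin_r r1 r2).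
  assert (A5 := Rmin_l r3 (Rmin d d')). assert (A6 := Rmin_r r3 (Rmin d d')).
  assert (A7 := Rmin_l d d'). assert (A8 := Rmin_r d d'). repeat split; lra. }
destruct Lr as (L1 & L2 & L3 & L4 & L5).
assert (Win : forall x t q, r <= q -> within r xh th x t -> within q xh th x t)
  by (intros x t q Hq [W1 W2]; split; lra).
assert (Utpos : forall x t, within r xh th x t -> beta / 2 < ut x t).
{ intros x t W. assert (K := H1 x t (Win _ _ _ L1 W)). rewrite Ut0 in K.
  apply Rabs_def2 in K; lra. }
set (h := r / 2).
(* [u] increases in time through its zero at [th]. Its signs at [th - h] and [th + h] persist on a
   vertical line slightly to the left, which therefore carries a zero of [u]. *)
assert (Up : 0 < u xh (th + h)).
{ destruct (mean_value (u xh) (ut xh) th (th + h)) as (c & Hc & E); [exact (proj1 (Du xh))|].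
  rewrite Rmin_left, Rmax_right in Hc by (unfold h; lra).
  assert (K := Utpos xh c). rewrite U0 in E. unfold h in *.
  assert (beta / 2 < ut xh c)
    by (apply K; split; [rewrite Rminus_diag, Rabs_R0; auto|apply Rabs_def1; lra]). nra. }
assert (Um : u xh (th - h) < 0).
{ destruct (mean_value (u xh) (ut xh) (th - h) th) as (c & Hc & E); [exact (proj1 (Du xh))|].
  rewrite Rmin_left, Rmax_right in Hc by (unfold h; lra).
  assert (K := Utpos xh c). rewrite U0 in E. unfold h in *.
  assert (beta / 2 < ut xh c)
    by (apply K; split; [rewrite Rminus_diag, Rabs_R0; auto|apply Rabs_def1; lra]). nra. }
destruct (continuity_2d_pt_close u xh (th + h) _ (Cu _ _) Up) as (r4 & R4 & H4).
destruct (continuity_2d_pt_close u xh (th - h) (- u xh (th - h)) (Cu _ _)) as (r5 & R5 & H5); [lra|].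
set (k := Rmin (r / 2) (Rmin (r4 / 2) (r5 / 2))).
assert (K0 : 0 < k) by (repeat apply Rmin_glb_lt; lra).
assert (Lk : k <= r / 2 /\ k <= r4 / 2 /\ k <= r5 / 2).
{ unfold k. assert (A1 := Rmin_l (r / 2) (Rmin (r4 / 2) (r5 / 2))).
  assert (A2 := Rmin_r (r / 2) (Rmin (r4 / 2) (r5 / 2))).
  assert (A3 := Rmin_l (r4 / 2) (r5 / 2)). assert (A4 := Rmin_r (r4 / 2) (r5 / 2)).
  repeat split; lra. }
set (x := xh - k).
assert (Ux : 0 < u x (th + h)).
{ assert (Q := H4 x (th + h)). apply Rabs_def2 in Q; [lra|].
  split; [unfold x; apply Rabs_def1; lra|rewrite Rminus_diag, Rabs_R0; auto]. }
assert (Uy : u x (th - h) < 0).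
{ assert (Q := H5 x (th - h)). apply Rabs_def2 in Q; [lra|].
  split; [unfold x; apply Rabs_def1; lra|rewrite Rminus_diag, Rabs_R0; auto]. }
destruct (IVT_gen (u x) (th - h) (th + h) 0) as (t & Ht & Et).
{ intros s. apply continuity_pt_filterlim.
  apply (ex_derive_continuous (K := R_AbsRing) (V := R_NormedModule)). exists (ut x s); exact (proj1 (Du x) s). }
{ rewrite Rmin_left, Rmax_right; lra. }
rewrite Rmin_left, Rmax_right in Ht by (unfold h; lra).
assert (W : within r xh th x t).
{ unfold x, h in *; split; apply Rabs_def1; lra. }
assert (Nz : ~ (F x t = 0 /\ G x t = 0)).
{ apply Hleft; [unfold x; lra|apply Win; auto]. }
assert (Np := sum_squares_pos _ _ Nz).
assert (Bd : Rabs (chu_mei a x t) <= M).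
{ apply HM; [destruct W; lra|destruct W; lra|].
  rewrite Ha. apply Rgt_not_eq, sqrt_lt_R0; auto. }
rewrite (chu_mei_formula a F Ft Ftt G Gt Gtt) in Bd; auto.
rewrite <- (modulus_quotient_rotation b1 b2) in Bd; [|unfold beta in *; lra|lra].
assert (Ev : b1 * G x t - b2 * F x t = v x t) by (unfold v; ring).
assert (Evt : b1 * Gt x t - b2 * Ft x t = vt x t) by (unfold vt; ring).
assert (Evtt : b1 * Gtt x t - b2 * Ftt x t = vtt x t) by (unfold vtt; ring).
rewrite Ev, Evt, Evtt in Bd.
change (b1 * F x t + b2 * G x t) with (u x t) in Bd. rewrite Et in Bd.
change (b1 * Ft x t + b2 * Gt x t) with (ut x t) in Bd.
assert (Vn : v x t <> 0).
{ intros Ez. assert (beta * (F x t * F x t + G x t * G x t) = 0);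
    [|assert (P := Rmult_lt_0_compat _ _ Hbeta Np); lra].
  transitivity (u x t * u x t + v x t * v x t); [unfold beta, u, v; ring|rewrite Et, Ez; ring]. }
assert (Eq : modulus_quotient 0 (v x t) (ut x t) (vt x t) (b1 * Ftt x t + b2 * Gtt x t) (vtt x t)
   * (v x t * v x t) = vtt x t * v x t + ut x t * ut x t).
{ unfold modulus_quotient, angular_speed. field. auto. }
assert (Vs := H2 x t (Win _ _ _ L2 W)). rewrite V0, Rminus_0_r in Vs.
assert (Vtts : Rabs (vtt x t) <= C).
{ assert (Q := H3 x t (Win _ _ _ L3 W)). unfold C.
  replace (vtt x t) with ((vtt x t - vtt xh th) + vtt xh th) by ring.
  eapply Rle_trans; [apply Rabs_triang|lra]. }
assert (Up' := Utpos x t W).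
set (Q := modulus_quotient 0 (v x t) (ut x t) (vt x t) (b1 * Ftt x t + b2 * Gtt x t) (vtt x t)) in *.
assert (QM : Q <= M') by (eapply Rle_trans; [apply Rle_abs|]; eapply Rle_trans; [exact Bd|apply Rle_abs]).
assert (V2 : v x t * v x t = Rabs (v x t) * Rabs (v x t)) by apply sqr_Rabs.
assert (Vp := Rabs_pos (v x t)).
assert (B1 : Q * (v x t * v x t) <= M' * eps).
{ apply Rle_trans with (M' * (v x t * v x t)); [apply Rmult_le_compat_r; auto; apply Rle_0_sqr|].
  apply Rmult_le_compat_l; auto. rewrite V2, <- (Rmult_1_l eps).
  apply Rmult_le_compat; lra. }
assert (B2 : - (vtt x t * v x t) <= C * eps).
{ eapply Rle_trans; [apply Rle_abs|]. rewrite Rabs_Ropp. apply Rabs_mult_le; auto; lra. }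
assert (B3 : beta / 2 * (beta / 2) < ut x t * ut x t) by (apply Rmult_le_0_lt_compat; lra).
lra.
Qed.

(** After the rotation [U] is of order [h = |s - th|], while [V] is [O(h^2)] because [Vt] vanishes
    at [th]. The squared modulus is then of order [h^2], the angular speed stays bounded, and
    [U Utt + V Vtt] is of exact order [h]: the quotient grows like [1/h]. *)
Lemma chu_mei_blow_up a F Ft Ftt G Gt Gtt xh th :
  (forall x t, a x t = modulus (F x) (G x) t) ->
  C2_in_time F Ft Ftt -> C2_in_time G Gt Gtt ->
  F xh th = 0 -> G xh th = 0 ->
  Ft xh th * Ftt xh th + Gt xh th * Gtt xh th <> 0 ->
  is_lim (fun t => Rabs (chu_mei a xh t)) th p_infty.
Proof.
intros Ha HF HG F0 G0 Hk.
set (b1 := Ft xh th) in *. set (b2 := Gt xh th) in *.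
set (U := fun x t => b1 * F x t + b2 * G x t).
set (Ut := fun x t => b1 * Ft x t + b2 * Gt x t).
set (Utt := fun x t => b1 * Ftt x t + b2 * Gtt x t).
set (V := fun x t => b1 * G x t + - b2 * F x t).
set (Vt := fun x t => b1 * Gt x t + - b2 * Ft x t).
set (Vtt := fun x t => b1 * Gtt x t + - b2 * Ftt x t).
assert (CU : C2_in_time U Ut Utt) by now apply C2_in_time_combination.
assert (CV : C2_in_time V Vt Vtt) by now apply C2_in_time_combination.
set (beta := b1 * b1 + b2 * b2).
assert (Hbeta : 0 < beta).
{ apply sum_squares_pos; intros [E1 E2]; apply Hk; rewrite E1, E2; ring. }
assert (U0 : U xh th = 0) by (unfold U; rewrite F0, G0; ring).
assert (V0 : V xh th = 0) by (unfold V; rewrite F0, G0; ring).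
assert (Ut0 : Ut xh th = beta) by (unfold Ut, beta, b1, b2; ring).
assert (Vt0 : Vt xh th = 0) by (unfold Vt, b1, b2; ring).
set (kappa := Rabs (Utt xh th)).
assert (Hkappa : 0 < kappa) by (apply Rabs_pos_lt; exact Hk).
set (C := Rabs (Vtt xh th) + 1).
assert (C0 : 0 < C) by (generalize (Rabs_pos (Vtt xh th)); unfold C; lra).
destruct CU as (DU & _ & CUt & CUtt). destruct CV as (DV & _ & _ & CVtt).
destruct (continuity_2d_pt_close Ut xh th (beta / 2) (CUt xh th)) as (r1 & R1 & H1); [lra|].
destruct (continuity_2d_pt_close Utt xh th (kappa / 2) (CUtt xh th)) as (r2 & R2 & H2); [lra|].
destruct (continuity_2d_pt_close Vtt xh th 1 (CVtt xh th)) as (r3 & R3 & H3); [lra|].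
assert (Near : forall q s, Rabs (s - th) < q -> within q xh th xh s).
{ intros q s Hs; split; auto. rewrite Rminus_diag, Rabs_R0. generalize (Rabs_pos (s - th)); lra. }
(* [c0 h] is half of the lower bound [(beta/2) h (kappa/2)] for [|U Utt|]. [K1 h^2] bounds the
   squared modulus for [h <= 1]. [K2] is the square of [4 beta C h^2] over [beta^2 h^2 / 4], the
   bound on the angular speed. *)
set (c0 := beta * kappa / 8). assert (Hc0 : 0 < c0) by (unfold c0; nra).
set (K1 := 4 * (beta * beta) + C * C). assert (HK1 : 0 < K1) by (unfold K1; nra).
set (K2 := (16 * C / beta) ^ 2).
apply is_lim_spec. intros M. 
(* [r4] makes [|V Vtt| <= C^2 h^2] at most [c0 h], the other half of that bound; [r5] makes the pole
   [c0 / (K1 h)] exceed [|M| + K2]. *)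
set (r4 := c0 / (C * C)). assert (R4 : 0 < r4) by (apply Rdiv_lt_0_compat; nra).
set (r5 := c0 / K1 / (Rabs M + K2 + 1)).
assert (HMK : 0 < Rabs M + K2 + 1).
{ generalize (Rabs_pos M), (pow2_ge_0 (16 * C / beta)); unfold K2; lra. }
assert (R5 : 0 < r5) by (apply Rdiv_lt_0_compat; auto; now apply Rdiv_lt_0_compat).
set (r := Rmin (Rmin r1 r2) (Rmin r3 (Rmin 1 (Rmin r4 r5)))).
assert (R0 : 0 < r) by (repeat apply Rmin_glb_lt; auto; lra).
assert (Lr : r <= r1 /\ r <= r2 /\ r <= r3 /\ r <= 1 /\ r <= r4 /\ r <= r5).
{ unfold r. assert (A1 := Rmin_l (Rmin r1 r2) (Rmin r3 (Rmin 1 (Rmin r4 r5)))).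
  assert (A2 := Rmin_r (Rmin r1 r2) (Rmin r3 (Rmin 1 (Rmin r4 r5)))).
  assert (A3 := Rmin_l r1 r2). assert (A4 := Rmin_r r1 r2).
  assert (A5 := Rmin_l r3 (Rmin 1 (Rmin r4 r5))). assert (A6 := Rmin_r r3 (Rmin 1 (Rmin r4 r5))).
  assert (A7 := Rmin_l 1 (Rmin r4 r5)). assert (A8 := Rmin_r 1 (Rmin r4 r5)).
  assert (A9 := Rmin_l r4 r5). assert (A10 := Rmin_r r4 r5). repeat split; lra. }
destruct Lr as (L1 & L2 & L3 & L4 & L5 & L6).
exists (mkposreal r R0). intros s Hs Hne. change (Rabs (s - th) < r) in Hs.
set (h := Rabs (s - th)) in *.
assert (Hh : 0 < h) by (apply Rabs_pos_lt; lra).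
assert (Between : forall c, Rmin th s <= c <= Rmax th s -> Rabs (c - th) <= h).
{ intros c Hc. unfold h. destruct (Rle_dec th s) as [L|L].
  - rewrite Rmin_left, Rmax_right in Hc by lra. rewrite !Rabs_pos_eq; lra.
  - rewrite Rmin_right, Rmax_left in Hc by lra. rewrite !Rabs_left1; lra. }
destruct (mean_value (U xh) (Ut xh) th s) as (c1 & B1 & E1); [exact (proj1 (DU xh))|].
assert (U1 := H1 xh c1 (Near r1 c1 ltac:(specialize (Between c1 B1); lra))).
rewrite Ut0 in U1. rewrite U0, Rminus_0_r in E1.
assert (Uabs : Rabs (U xh s) = Ut xh c1 * h).
{ rewrite E1, Rabs_mult. apply Rabs_def2 in U1. rewrite (Rabs_pos_eq (Ut xh c1)) by lra.
  reflexivity. }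
apply Rabs_def2 in U1.
assert (Ulow : beta / 2 * h <= Rabs (U xh s)) by (rewrite Uabs; apply Rmult_le_compat_r; lra).
assert (Uup : Rabs (U xh s) <= 2 * beta * h) by (rewrite Uabs; apply Rmult_le_compat_r; lra).
assert (VttC : forall c, Rabs (c - th) <= h -> Rabs (Vtt xh c) <= C).
{ intros c Hc. assert (Q := H3 xh c (Near r3 c ltac:(lra))). unfold C.
  replace (Vtt xh c) with ((Vtt xh c - Vtt xh th) + Vtt xh th) by ring.
  eapply Rle_trans; [apply Rabs_triang|lra]. }
assert (VtC : forall c, Rabs (c - th) <= h -> Rabs (Vt xh c) <= C * h).
{ intros c Hc. destruct (mean_value (Vt xh) (Vtt xh) th c) as (c2 & B2 & E2); [exact (proj2 (DV xh))|].
  rewrite Vt0, Rminus_0_r in E2. rewrite E2. apply Rabs_mult_le; auto.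
  apply VttC. apply Rle_trans with (Rabs (c - th)); auto.
  destruct (Rle_dec th c) as [L|L].
  - rewrite Rmin_left, Rmax_right in B2 by lra. rewrite !Rabs_pos_eq; lra.
  - rewrite Rmin_right, Rmax_left in B2 by lra. rewrite !Rabs_left1; lra. }
assert (Vs : Rabs (V xh s) <= C * h * h).
{ destruct (mean_value (V xh) (Vt xh) th s) as (c2 & B2 & E2); [exact (proj1 (DV xh))|].
  rewrite V0, Rminus_0_r in E2. rewrite E2. apply Rabs_mult_le; [apply VtC, Between, B2|unfold h; lra]. }
assert (Vts := VtC s ltac:(unfold h; lra)). assert (Vtts := VttC s ltac:(unfold h; lra)).
assert (Uts : Rabs (Ut xh s) <= 2 * beta).
{ assert (Q := H1 xh s (Near r1 s ltac:(fold h; lra))). rewrite Ut0 in Q.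
  apply Rabs_def2 in Q. rewrite Rabs_pos_eq; lra. }
assert (Utts : kappa / 2 <= Rabs (Utt xh s)).
{ assert (Q := H2 xh s (Near r2 s ltac:(fold h; lra))).
  assert (T := Rabs_triang_inv (Utt xh th) (Utt xh th - Utt xh s)).
  rewrite (Rabs_minus_sym (Utt xh th)) in T. unfold kappa in *.
  replace (Utt xh th - (Utt xh th - Utt xh s)) with (Utt xh s) in T by ring. lra. }
set (u := U xh s) in *. set (v := V xh s) in *. set (ut := Ut xh s) in *.
set (vt := Vt xh s) in *. set (utt := Utt xh s) in *. set (vtt := Vtt xh s) in *.
assert (Un : u <> 0) by (intros Z; rewrite Z, Rabs_R0 in Ulow;
  assert (0 < beta / 2 * h) by (apply Rmult_lt_0_compat; lra); lra).
set (N := u * u + v * v).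
assert (SqU : u * u = Rabs u * Rabs u) by apply sqr_Rabs.
assert (SqV : v * v = Rabs v * Rabs v) by apply sqr_Rabs.
assert (Hh2 : 0 < h * h) by now apply Rmult_lt_0_compat.
assert (Hh1 : h * h <= 1) by (rewrite <- (Rmult_1_l 1); apply Rmult_le_compat; lra).
assert (Nlow : beta * beta / 4 * (h * h) <= N).
{ unfold N. assert (0 <= v * v) by apply Rle_0_sqr. rewrite SqU.
  assert (beta / 2 * h * (beta / 2 * h) <= Rabs u * Rabs u) by
    (apply Rmult_le_compat; try lra; apply Rmult_le_pos; lra). lra. }
assert (Nup : N <= K1 * (h * h)).
{ unfold N, K1. rewrite SqU, SqV.
  assert (P1 := Rabs_pos u). assert (P2 := Rabs_pos v).
  assert (Rabs u * Rabs u <= 2 * beta * h * (2 * beta * h)) by (apply Rmult_le_compat; auto).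
  assert (Rabs v * Rabs v <= C * h * h * (C * h * h)) by (apply Rmult_le_compat; auto).
  assert (C * C * (h * h) * (h * h) <= C * C * (h * h) * 1).
  { apply Rmult_le_compat_l; auto. apply Rmult_le_pos; [apply Rle_0_sqr|lra]. }
  lra. }
assert (Npos : 0 < N) by (assert (0 < beta * beta / 4 * (h * h)) by
  (apply Rmult_lt_0_compat; auto; apply Rmult_lt_0_compat; [now apply Rmult_lt_0_compat|lra]); lra).
assert (T1 : c0 * h <= Rabs (u * utt + v * vtt)).
{ assert (T := Rabs_triang_inv (u * utt) (- (v * vtt))). rewrite Rabs_Ropp in T.
  replace (u * utt - - (v * vtt)) with (u * utt + v * vtt) in T by ring.
  assert (A1 : beta / 2 * h * (kappa / 2) <= Rabs (u * utt)).
  { rewrite Rabs_mult. apply Rmult_le_compat; auto; [apply Rmult_le_pos|]; lra. }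
  assert (A2 : Rabs (v * vtt) <= C * h * h * C) by (apply Rabs_mult_le; auto).
  assert (A3 : h * (C * C) <= c0).
  { apply Rle_trans with (r4 * (C * C)); [apply Rmult_le_compat_r; [apply Rle_0_sqr|lra]|].
    unfold r4; right; field; lra. }
  assert (A4 : C * h * h * C <= c0 * h).
  { replace (C * h * h * C) with (h * (C * C) * h) by ring. apply Rmult_le_compat_r; lra. }
  unfold c0 in *. lra. }
assert (T2 : angular_speed u v ut vt ^ 2 <= K2).
{ unfold K2, angular_speed. fold N.
  rewrite <- (Rabs_pos_eq (16 * C / beta)) by (apply Rlt_le, Rdiv_lt_0_compat; lra).
  rewrite <- (pow2_abs ((u * vt - v * ut) / N)). apply pow_incr; split; [apply Rabs_pos|].
  rewrite (Rabs_pos_eq (16 * C / beta)) by (apply Rlt_le, Rdiv_lt_0_compat; lra).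
  unfold Rdiv at 1. rewrite Rabs_mult, (Rabs_pos_eq (/ N)) by (left; now apply Rinv_0_lt_compat).
  apply Rmult_le_reg_r with N; auto. rewrite Rmult_assoc, Rinv_l, Rmult_1_r by lra.
  assert (A1 : Rabs (u * vt) <= 2 * beta * h * (C * h)) by now apply Rabs_mult_le.
  assert (A2 : Rabs (v * ut) <= C * h * h * (2 * beta)) by now apply Rabs_mult_le.
  assert (A3 : Rabs (u * vt - v * ut) <= 4 * beta * C * (h * h)).
  { unfold Rminus. eapply Rle_trans; [apply Rabs_triang|]. rewrite Rabs_Ropp. lra. }
  eapply Rle_trans; [exact A3|].
  apply Rle_trans with (16 * C / beta * (beta * beta / 4 * (h * h))).
  - right; field; lra.
  - apply Rmult_le_compat_l; auto. apply Rlt_le, Rdiv_lt_0_compat; lra. }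
assert (Np : 0 < F xh s * F xh s + G xh s * G xh s).
{ apply sum_squares_pos; intros [Z1 Z2]. apply Un. unfold u, U. rewrite Z1, Z2; ring. }
rewrite (chu_mei_formula a F Ft Ftt G Gt Gtt); auto.
rewrite <- (modulus_quotient_rotation b1 b2); [|unfold beta in *; lra|lra].
assert (Ev : b1 * G xh s - b2 * F xh s = v) by (unfold v, V; ring).
assert (Evt : b1 * Gt xh s - b2 * Ft xh s = vt) by (unfold vt, Vt; ring).
assert (Evtt : b1 * Gtt xh s - b2 * Ftt xh s = vtt) by (unfold vtt, Vtt; ring).
rewrite Ev, Evt, Evtt.
change (M < Rabs (modulus_quotient u v ut vt utt vtt)). unfold modulus_quotient. fold N.
assert (T3 : c0 / K1 / h <= Rabs ((u * utt + v * vtt) / N)).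
{ unfold Rdiv at 3. rewrite Rabs_mult, (Rabs_pos_eq (/ N)) by (left; now apply Rinv_0_lt_compat).
  apply Rle_trans with (c0 * h * / (K1 * (h * h))).
  - right; field; lra.
  - apply Rmult_le_compat; auto.
    + apply Rmult_le_pos; lra.
    + left; apply Rinv_0_lt_compat, Rmult_lt_0_compat; auto.
    + apply Rinv_le_contravar; auto. }
assert (T4 : Rabs M + K2 + 1 <= c0 / K1 / h).
{ apply Rmult_le_reg_r with h; auto. unfold Rdiv at 1. rewrite Rmult_assoc, Rinv_l, Rmult_1_r by lra.
  apply Rle_trans with ((Rabs M + K2 + 1) * r5); [apply Rmult_le_compat_l; lra|].
  right; unfold r5; field; lra. }
assert (T := Rabs_triang_inv ((u * utt + v * vtt) / N) (- angular_speed u v ut vt ^ 2)).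
replace ((u * utt + v * vtt) / N - - angular_speed u v ut vt ^ 2)
  with ((u * utt + v * vtt) / N + angular_speed u v ut vt ^ 2) in T by ring.
rewrite (Rabs_Ropp (angular_speed u v ut vt ^ 2)) in T.
rewrite (Rabs_pos_eq (angular_speed u v ut vt ^ 2)) in T by apply pow2_ge_0.
generalize (Rle_abs M); lra.
Qed.

(** * The field of a wave group *)

Lemma is_derive_fst (f : R -> C) x (l : C) :
  is_derive (K := R_AbsRing) (V := C_R_NormedModule) f x l ->
  is_derive (fun y => fst (f y)) x (fst l).
Proof.
intros H.
apply (filterdiff_comp' f (fun z : C_R_NormedModule => fst z) x
  (fun y => scal y l) (fun z => fst z) H).
apply filterdiff_linear, (is_linear_fst (U := R_NormedModule) (V := R_NormedModule)).
Qed.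

Lemma is_derive_snd (f : R -> C) x (l : C) :
  is_derive (K := R_AbsRing) (V := C_R_NormedModule) f x l ->
  is_derive (fun y => snd (f y)) x (snd l).
Proof.
intros H.
apply (filterdiff_comp' f (fun z : C_R_NormedModule => snd z) x
  (fun y => scal y l) (fun z => snd z) H).
apply filterdiff_linear, (is_linear_snd (U := R_NormedModule) (V := R_NormedModule)).
Qed.

Lemma jointly_continuous_field f : jointly_continuous f -> continuous_field f.
Proof.
intros H x t; split; apply continuity_2d_pt_filterlim.
- apply (continuous_comp (fun q : R * R => f (fst q) (snd q) : C_R_NormedModule)
    (fun z : C_R_NormedModule => fst z) (x, t)); [apply H|].
  apply (continuous_fst (U := R_UniformSpace) (V := R_UniformSpace)).
- apply (continuous_comp (fun q : R * R => f (fst q) (snd q) : C_R_NormedModule)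
    (fun z : C_R_NormedModule => snd z) (x, t)); [apply H|].
  apply (continuous_snd (U := R_UniformSpace) (V := R_UniformSpace)).
Qed.

Lemma continuity_2d_pt_comp f (g h : R -> R -> R) x t :
  continuity_2d_pt f (g x t) (h x t) -> continuity_2d_pt g x t -> continuity_2d_pt h x t ->
  continuity_2d_pt (fun x t => f (g x t) (h x t)) x t.
Proof.
intros Hf Hg Hh eps. destruct (Hf eps) as (d & Hd).
destruct (Hg d) as (d1 & H1). destruct (Hh d) as (d2 & H2).
assert (Hm : 0 < Rmin d1 d2) by (apply Rmin_glb_lt; [apply d1|apply d2]).
assert (L1 := Rmin_l d1 d2). assert (L2 := Rmin_r d1 d2).
exists (mkposreal _ Hm); simpl; intros u v Hu Hv.
apply Hd; [apply H1|apply H2]; lra.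
Qed.

Definition moving (f : R -> R -> R) (V0 x t : R) : R := f x (t - x / V0).

Lemma continuity_2d_pt_moving f V0 : (forall x t, continuity_2d_pt f x t) ->
  forall x t, continuity_2d_pt (moving f V0) x t.
Proof.
intros Hf x t. apply (continuity_2d_pt_comp f (fun x _ => x) (fun x t => t - x / V0)); auto.
- apply continuity_2d_pt_id1.
- apply continuity_2d_pt_minus; [apply continuity_2d_pt_id2|].
  apply continuity_2d_pt_mult; [apply continuity_2d_pt_id1|apply continuity_2d_pt_const].
Qed.

Lemma is_derive_moving f ft V0 x t : (forall x t, is_derive (fun s => f x s) t (ft x t)) ->
  is_derive (moving f V0 x) t (moving ft V0 x t).
Proof.
intros H. unfold moving.
replace (ft x (t - x / V0)) with (1 * ft x (t - x / V0)) by ring.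
apply (is_derive_comp (fun s => f x s) (fun t => t - x / V0)); auto.
auto_derive; auto; ring.
Qed.

Lemma C1_2d_moving f fx ft V0 : C1_2d f fx ft ->
  C1_2d (moving f V0) (fun x t => moving fx V0 x t - moving ft V0 x t / V0) (moving ft V0).
Proof.
intros H. assert (H' := H). destruct H' as (H1 & H2 & H3 & H4).
split; [|split; [|split]].
- intros x t. unfold moving.
  replace (fx x (t - x / V0) - ft x (t - x / V0) / V0)
    with (fx x (t - x / V0) * 1 + ft x (t - x / V0) * (- / V0)) by (unfold Rdiv; ring).
  apply (C1_2d_along f fx ft (fun y => y) (fun y => t - y / V0)); auto;
    auto_derive; auto; unfold Rdiv; ring.
- intros x t; now apply is_derive_moving.
- intros x t. apply continuity_2d_pt_minus; [now apply continuity_2d_pt_moving|].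
  apply continuity_2d_pt_mult; [now apply continuity_2d_pt_moving|apply continuity_2d_pt_const].
- now apply continuity_2d_pt_moving.
Qed.

Lemma C1_2d_mult f fx ft g gx gt : C1_2d f fx ft -> C1_2d g gx gt ->
  C1_2d (fun x t => f x t * g x t) (fun x t => fx x t * g x t + f x t * gx x t)
    (fun x t => ft x t * g x t + f x t * gt x t).
Proof.
intros HF HG. assert (CF := fun x t => C1_2d_continuous f fx ft x t HF).
assert (CG := fun x t => C1_2d_continuous g gx gt x t HG).
destruct HF as (F1 & F2 & F3 & F4), HG as (G1 & G2 & G3 & G4).
assert (D : forall (u v : R -> R) (s du dv : R), is_derive u s du -> is_derive v s dv ->
  is_derive (fun y => u y * v y) s (du * v s + u s * dv)).
{ intros u v s du dv Hu Hv.
  assert (E1 : Derive (fun y => u y) s = du) by now apply is_derive_unique.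
  assert (E2 : Derive (fun y => v y) s = dv) by now apply is_derive_unique.
  auto_derive; [repeat split; eexists; eauto|rewrite E1, E2; ring]. }
split; [|split; [|split]]; intros x t.
- now apply (D (fun y => f y t) (fun y => g y t)).
- now apply (D (fun s => f x s) (fun s => g x s)).
- apply continuity_2d_pt_plus; apply continuity_2d_pt_mult; auto.
- apply continuity_2d_pt_plus; apply continuity_2d_pt_mult; auto.
Qed.

Lemma C1_2d_combination f fx ft g gx gt c : C1_2d f fx ft -> C1_2d g gx gt ->
  C1_2d (fun x t => f x t + c * g x t) (fun x t => fx x t + c * gx x t)
    (fun x t => ft x t + c * gt x t).
Proof.
intros (F1 & F2 & F3 & F4) (G1 & G2 & G3 & G4).
assert (D : forall (u v : R -> R) (s du dv : R), is_derive u s du -> is_derive v s dv ->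
  is_derive (fun y => u y + c * v y) s (du + c * dv)).
{ intros u v s du dv Hu Hv.
  assert (E1 : Derive (fun y => u y) s = du) by now apply is_derive_unique.
  assert (E2 : Derive (fun y => v y) s = dv) by now apply is_derive_unique.
  auto_derive; [repeat split; eexists; eauto|rewrite E1, E2; ring]. }
split; [|split; [|split]]; intros x t.
- now apply (D (fun y => f y t) (fun y => g y t)).
- now apply (D (fun s => f x s) (fun s => g x s)).
- apply continuity_2d_pt_plus; auto. apply continuity_2d_pt_mult; auto. apply continuity_2d_pt_const.
- apply continuity_2d_pt_plus; auto. apply continuity_2d_pt_mult; auto. apply continuity_2d_pt_const.
Qed.

Definition carrier_cos (k0 omega0 x t : R) : R := cos (k0 * x - omega0 * t).

Definition carrier_sin (k0 omega0 x t : R) : R := sin (k0 * x - omega0 * t).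

Lemma continuity_2d_pt_carrier k0 omega0 x t :
  continuity_2d_pt (carrier_cos k0 omega0) x t /\ continuity_2d_pt (carrier_sin k0 omega0) x t.
Proof.
assert (Cp : continuity_2d_pt (fun x t => k0 * x - omega0 * t) x t).
{ apply continuity_2d_pt_minus; apply continuity_2d_pt_mult; try apply continuity_2d_pt_const.
  - apply continuity_2d_pt_id1.
  - apply continuity_2d_pt_id2. }
split.
- apply (continuity_1d_2d_pt_comp cos); auto. apply continuity_cos.
- apply (continuity_1d_2d_pt_comp sin); auto. apply continuity_sin.
Qed.

Lemma C1_2d_carrier k0 omega0 :
  C1_2d (carrier_cos k0 omega0) (fun x t => - k0 * carrier_sin k0 omega0 x t)
    (fun x t => omega0 * carrier_sin k0 omega0 x t) /\
  C1_2d (carrier_sin k0 omega0) (fun x t => k0 * carrier_cos k0 omega0 x t)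
    (fun x t => - omega0 * carrier_cos k0 omega0 x t).
Proof.
split; (split; [|split; [|split]]); intros x t;
  try (apply continuity_2d_pt_mult; [apply continuity_2d_pt_const|apply continuity_2d_pt_carrier]);
  unfold carrier_cos, carrier_sin; auto_derive; auto; unfold Rminus; ring.
Qed.

(** * Zeros inside a dislocated contour *)

Lemma enclosed_ext X T X' T' x t :
  (forall s, 0 <= s <= 1 -> X s = X' s /\ T s = T' s) ->
  enclosed X T x t -> enclosed X' T' x t.
Proof.
intros E [Hoff [M HM]]; split.
- intros s Hs; destruct (E s Hs) as [<- <-]; auto.
- exists M; intros P Q HP HQ P0 Q0 Hfar.
  destruct (HM P Q HP HQ P0 Q0 Hfar) as (r & s & Hr & Hs & E1 & E2).
  exists r, s. destruct (E s Hs) as [<- <-]; auto.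
Qed.

(** Being enclosed is locally constant off the contour, and the contour carries no zeros, so
    enclosed zeros cannot accumulate at a zero that is not enclosed. *)
Lemma enclosed_zeros_closed B X T : continuous_field B -> continuous_loop X T ->
  (forall s, 0 <= s <= 1 -> B (X s) (T s) <> RtoC 0) ->
  forall x t, ~ (enclosed X T x t /\ B x t = RtoC 0) ->
  exists d, 0 < d /\ forall x' t', within d x t x' t' ->
    ~ (enclosed X T x' t' /\ B x' t' = RtoC 0).
Proof.
intros HB HL Hne x t Hn.
destruct (classic (B x t = RtoC 0)) as [Z|Z].
- destruct (loop_distance X T x t HL) as (mu & Hmu & Hd).
  + intros s Hs E; injection E as E1 E2. apply (Hne s Hs). now rewrite E1, E2.
  + exists (mu / 4); split; [lra|]. intros x' t' W [He _]. apply Hn; split; auto.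
    apply (enclosed_nearby X T x t mu x' t' Hd W); auto.
- destruct (field_near B x t HB Z) as (d & Hd & HN).
  exists d; split; auto. intros x' t' W [_ E].
  assert (P := near_pos _ _ (HN x' t' x' t' W W)). rewrite E in P.
  unfold cdot in P; simpl in P; lra.
Qed.

Lemma dislocation_encloses_zero B fx ft gx gt X T n :
  C1_2d (fun x t => fst (B x t)) fx ft -> C1_2d (fun x t => snd (B x t)) gx gt ->
  wavefront_dislocation B X T n -> exists x t, enclosed X T x t /\ B x t = RtoC 0.
Proof.
intros HF HG (Hcon & Hne & Hn & Hcirc).
destruct (circulation_phase_lift B fx ft gx gt X T _ HF HG Hcon Hne Hcirc) as (theta & Hth & E).
apply NNPP; intros Hno.
assert (Hw : theta 1 = theta 0).
{ apply (no_winding_of_nonvanishing_field B (fun s => X (clamp 0 1 s)) (fun s => T (clamp 0 1 s)) theta); auto.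
  - intros x t; split; [eapply C1_2d_continuous, HF|eapply C1_2d_continuous, HG].
  - now apply contour_continuous_loop.
  - intros x t [(s & Hs & <- & <-)|He].
    + apply Hne, clamp_range; lra.
    + intros Z; apply Hno; exists x, t; split; auto.
      apply enclosed_ext with (2 := He). intros s Hs; now rewrite clamp_id. }
assert (IZR n <> 0) by (intros Z; apply Hn, eq_IZR; auto).
assert (PP := PI_RGT_0). nra.
Qed.

(** At a zero of [A] the cubic term drops out whatever [gamma] is; the last clause is what remains
    of the equation, in real and imaginary parts. *)
Lemma NLS_components beta gamma A V0 : spatial_NLS beta gamma A ->
  exists p_xi p_tau p_tautau q_xi q_tau q_tautau : R -> R -> R,
    C1_2d (fun xi tau => fst (A xi tau)) p_xi p_tau /\
    C1_2d (fun xi tau => snd (A xi tau)) q_xi q_tau /\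
    C2_in_time (moving (fun xi tau => fst (A xi tau)) V0) (moving p_tau V0) (moving p_tautau V0) /\
    C2_in_time (moving (fun xi tau => snd (A xi tau)) V0) (moving q_tau V0) (moving q_tautau V0) /\
    forall xi tau, A xi tau = RtoC 0 ->
      p_xi xi tau = beta * q_tautau xi tau /\ q_xi xi tau = - beta * p_tautau xi tau.
Proof.
intros (A_xi & A_tau & A_tautau & D1 & D2 & D3 & J1 & J2 & J3 & E).
apply jointly_continuous_field in J1. apply jointly_continuous_field in J2.
apply jointly_continuous_field in J3.
assert (HF : C1_2d (fun xi tau => fst (A xi tau)) (fun xi tau => fst (A_xi xi tau))
                   (fun xi tau => fst (A_tau xi tau))).
{ split; [|split; [|split]]; intros x t.
  - apply (is_derive_fst (fun y => A y t)), D1.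
  - apply (is_derive_fst (fun s => A x s)), D2.
  - apply J1.
  - apply J2. }
assert (HG : C1_2d (fun xi tau => snd (A xi tau)) (fun xi tau => snd (A_xi xi tau))
                   (fun xi tau => snd (A_tau xi tau))).
{ split; [|split; [|split]]; intros x t.
  - apply (is_derive_snd (fun y => A y t)), D1.
  - apply (is_derive_snd (fun s => A x s)), D2.
  - apply J1.
  - apply J2. }
exists (fun xi tau => fst (A_xi xi tau)), (fun xi tau => fst (A_tau xi tau)),
  (fun xi tau => fst (A_tautau xi tau)), (fun xi tau => snd (A_xi xi tau)),
  (fun xi tau => snd (A_tau xi tau)), (fun xi tau => snd (A_tautau xi tau)).
split; [exact HF|split; [exact HG|split; [|split]]].
- split; [|split; [|split]].
  + intros x; split; intros t; apply is_derive_moving; intros x' t'.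
    * apply (is_derive_fst (fun s => A x' s)), D2.
    * apply (is_derive_fst (fun s => A_tau x' s)), D3.
  + apply continuity_2d_pt_moving; intros; eapply C1_2d_continuous, HF.
  + apply continuity_2d_pt_moving; intros; apply J2.
  + apply continuity_2d_pt_moving; intros; apply J3.
- split; [|split; [|split]].
  + intros x; split; intros t; apply is_derive_moving; intros x' t'.
    * apply (is_derive_snd (fun s => A x' s)), D2.
    * apply (is_derive_snd (fun s => A_tau x' s)), D3.
  + apply continuity_2d_pt_moving; intros; eapply C1_2d_continuous, HG.
  + apply continuity_2d_pt_moving; intros; apply J2.
  + apply continuity_2d_pt_moving; intros; apply J3.
- intros xi tau Z. specialize (E xi tau). rewrite Z in E.
  assert (E1 := f_equal fst E). assert (E2 := f_equal snd E). simpl in E1, E2.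
  split; lra.
Qed.

(** At a zero of [A] the derivatives of the carrier drop out, so the Jacobian matrix of the field is
    that of [A] composed with the shear [tau = t - x/V0] and a rotation. Both have determinant 1. *)
Lemma complex_field_C1 A p_xi p_tau q_xi q_tau V0 k0 omega0 :
  C1_2d (fun xi tau => fst (A xi tau)) p_xi p_tau ->
  C1_2d (fun xi tau => snd (A xi tau)) q_xi q_tau ->
  exists fx ft gx gt,
    C1_2d (fun x t => fst (complex_field A V0 k0 omega0 x t)) fx ft /\
    C1_2d (fun x t => snd (complex_field A V0 k0 omega0 x t)) gx gt /\
    forall x t, A x (t - x / V0) = RtoC 0 ->
      fx x t * gt x t - gx x t * ft x t =
        p_xi x (t - x / V0) * q_tau x (t - x / V0) - q_xi x (t - x / V0) * p_tau x (t - x / V0).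
Proof.
intros HF HG.
assert (MF := C1_2d_moving _ _ _ V0 HF). assert (MG := C1_2d_moving _ _ _ V0 HG).
destruct (C1_2d_carrier k0 omega0) as [Cc Cs].
(* Real and imaginary part of the product with the carrier: [p cos - q sin] and [p sin + q cos]. *)
assert (H1 := C1_2d_combination _ _ _ _ _ _ (-1) (C1_2d_mult _ _ _ _ _ _ MF Cc) (C1_2d_mult _ _ _ _ _ _ MG Cs)).
assert (H2 := C1_2d_combination _ _ _ _ _ _ 1 (C1_2d_mult _ _ _ _ _ _ MF Cs) (C1_2d_mult _ _ _ _ _ _ MG Cc)).
assert (Ext : forall f f' fx ft, (forall x t, f x t = f' x t) -> C1_2d f fx ft -> C1_2d f' fx ft).
{ intros f f' fx ft E (A1 & A2 & A3 & A4). split; [|split; [|split]]; auto; intros x t.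
  - apply is_derive_ext with (fun y => f y t); auto.
  - apply is_derive_ext with (fun s => f x s); auto. }
do 4 eexists. split; [|split].
- eapply Ext; [|exact H1]. intros x t. simpl. unfold moving, carrier_cos, carrier_sin. ring.
- eapply Ext; [|exact H2]. intros x t. simpl. unfold moving, carrier_cos, carrier_sin. ring.
- intros x t Z. cbv beta. unfold moving, carrier_cos, carrier_sin. rewrite Z. simpl.
  assert (S := sin2_cos2 (k0 * x - omega0 * t)); unfold Rsqr in S.
  set (px := p_xi x (t - x / V0)). set (pt := p_tau x (t - x / V0)).
  set (qx := q_xi x (t - x / V0)). set (qt := q_tau x (t - x / V0)).
  set (s := sin (k0 * x - omega0 * t)) in *. set (c := cos (k0 * x - omega0 * t)) in *.
  transitivity ((px * qt - qx * pt) * (s * s + c * c)); [unfold Rdiv; ring|rewrite S; ring].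
Qed.

Lemma complex_field_zero A V0 k0 omega0 x t :
  complex_field A V0 k0 omega0 x t = RtoC 0 <-> A x (t - x / V0) = RtoC 0.
Proof.
unfold complex_field; split; intros E.
- apply Cmod_eq_0. assert (M := f_equal Cmod E). rewrite Cmod_mult, Cmod_0 in M.
  replace (Cmod (expi (k0 * x - omega0 * t))) with 1 in M; [lra|].
  unfold Cmod, expi; simpl.
  assert (S := sin2_cos2 (k0 * x - omega0 * t)); unfold Rsqr in S.
  rewrite <- sqrt_1 at 1. f_equal. lra.
- rewrite E. apply Cmult_0_l.
Qed.

Theorem proposition4p3p1
  (Omega : R -> R) (k0 omega0 V0 beta gamma : R)
  (HOmega : dispersion_relation Omega k0)
  (Homega0 : omega0 = Omega k0)
  (HV0 : V0 = group_velocity Omega k0)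
  (Hbeta : beta = dispersion_coefficient Omega k0)
  (A : R -> R -> C)
  (HA : spatial_NLS beta gamma A)
  (eta : R -> R -> R)
  (Heta : wave_group A V0 k0 omega0 eta)
  (X T : R -> R) (n : Z)
  (Hdisl : wavefront_dislocation (complex_field A V0 k0 omega0) X T n) :
  exists xh th : R,
    enclosed X T xh th /\
    singular_point (amplitude A V0) xh th /\
    ~ chu_mei_bounded_at (amplitude A V0) xh th /\
    (transverse_zero (complex_field A V0 k0 omega0) xh th ->
     is_lim (fun t => Rabs (chu_mei (amplitude A V0) xh t)) th p_infty).
Proof.
set (B := complex_field A V0 k0 omega0) in *.
destruct (NLS_components beta gamma A V0 HA) as
  (p_xi & p_tau & p_tautau & q_xi & q_tau & q_tautau & HF & HG & HU & HV & HNLS).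
destruct (complex_field_C1 A p_xi p_tau q_xi q_tau V0 k0 omega0 HF HG) as
  (fx & ft & gx & gt & HBf & HBg & Hdet).
fold B in HBf, HBg.
(* The amplitude is the modulus of [U + i V], the field without its carrier; the quotient is
   computed from these, the winding from [B]. *)
set (U := moving (fun xi tau => fst (A xi tau)) V0) in *.
set (V := moving (fun xi tau => snd (A xi tau)) V0) in *.
assert (HB : continuous_field B).
{ intros x t; split; [eapply C1_2d_continuous, HBf|eapply C1_2d_continuous, HBg]. }
assert (Hamp : forall x t, amplitude A V0 x t = modulus (U x) (V x) t).
{ intros x t; unfold amplitude, Cmod, modulus, U, V, moving. f_equal; ring. }
assert (HZ : forall x t, B x t = RtoC 0 <-> U x t = 0 /\ V x t = 0).
{ intros x t; unfold B. rewrite complex_field_zero. unfold U, V, moving; split.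
  - now intros ->.
  - intros [E1 E2]; now apply injective_projections. }
pose proof Hdisl as (Hcon & Hne & _).
set (Xc := fun s => X (clamp 0 1 s)). set (Tc := fun s => T (clamp 0 1 s)).
assert (HL : continuous_loop Xc Tc) by now apply contour_continuous_loop.
assert (Hc : forall s, 0 <= s <= 1 -> X s = Xc s /\ T s = Tc s)
  by (intros s Hs; unfold Xc, Tc; now rewrite clamp_id).
assert (Hne' : forall s, 0 <= s <= 1 -> B (Xc s) (Tc s) <> RtoC 0)
  by (intros s Hs; destruct (Hc s Hs) as [<- <-]; auto).
destruct (loop_bounded Xc Tc HL) as (L & L0 & HLb).
destruct (leftmost_topmost (fun x t => enclosed Xc Tc x t /\ B x t = RtoC 0) L)
  as (xh & th & (Hin & Hzero) & Hleft & Htop).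
{ now apply enclosed_zeros_closed. }
{ intros x t [He _]. assert (Bd := enclosed_bounded Xc Tc L x t (fun s _ => HLb s) L0 He).
  split; apply Rabs_le_between; [generalize (Rabs_pos t)|generalize (Rabs_pos x)]; lra. }
{ destruct (dislocation_encloses_zero B fx ft gx gt X T n HBf HBg Hdisl) as (x & t & He & E).
  exists x, t; split; auto. now apply enclosed_ext with (1 := Hc). }
destruct (loop_distance Xc Tc xh th HL) as (mu & Hmu & Hd); [apply Hin|].
(* Zeros close to the extremal one are themselves enclosed, so extremality excludes all zeros just
   to its left and straight above it. *)
assert (Hopen : forall x t, within (mu / 4) xh th x t -> enclosed Xc Tc x t)
  by (intros x t W; now apply (enclosed_nearby Xc Tc xh th mu x t)).
destruct (proj1 (HZ xh th) Hzero) as [U0 V0'].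
exists xh, th; split; [|split; [|split]].
- apply enclosed_ext with (2 := Hin). intros s Hs; destruct (Hc s Hs); auto.
- unfold singular_point. rewrite Hamp. unfold modulus. rewrite U0, V0'.
  rewrite Rmult_0_l, Rplus_0_l. apply sqrt_0.
- destruct (classic (moving p_tau V0 xh th = 0 /\ moving q_tau V0 xh th = 0)) as [[E1 E2]|Hst].
  + apply (flat_zero_not_bounded _ U _ _ V _ _ xh th Hamp HU HV U0 V0' E1 E2).
    exists (mu / 4); split; [lra|]. intros t Ht E.
    assert (t <= th); [|lra]. apply Htop; split; [|now apply HZ].
    apply Hopen; split; [rewrite Rminus_diag, Rabs_R0; lra|apply Rabs_def1; lra].
  + apply (steep_zero_not_bounded _ U _ _ V _ _ xh th Hamp HU HV U0 V0' Hst).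
    exists (mu / 4); split; [lra|]. intros x t Hx W E.
    assert (xh <= x); [|lra]. apply (Hleft x t); split; [auto|now apply HZ].
- intros (_ & Bx & Bt & DBx & DBt & Htr).
  apply (chu_mei_blow_up _ U _ _ V _ _ xh th Hamp HU HV U0 V0').
  assert (HA0 : A xh (th - xh / V0) = RtoC 0) by now apply (complex_field_zero A V0 k0 omega0).
  destruct (HNLS _ _ HA0) as [N1 N2]. specialize (Hdet xh th HA0).
  assert (E1 := is_derive_fst _ _ _ DBx). assert (E2 := is_derive_snd _ _ _ DBx).
  assert (E3 := is_derive_fst _ _ _ DBt). assert (E4 := is_derive_snd _ _ _ DBt).
  apply is_derive_unique in E1, E2, E3, E4.
  assert (F1 := is_derive_unique _ _ _ (proj1 HBf xh th)).
  assert (F2 := is_derive_unique _ _ _ (proj1 HBg xh th)).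
  assert (F3 := is_derive_unique _ _ _ (proj1 (proj2 HBf) xh th)).
  assert (F4 := is_derive_unique _ _ _ (proj1 (proj2 HBg) xh th)).
  assert (G1 : fst Bx = fx xh th) by (rewrite <- E1, <- F1; reflexivity).
  assert (G2 : snd Bx = gx xh th) by (rewrite <- E2, <- F2; reflexivity).
  assert (G3 : fst Bt = ft xh th) by (rewrite <- E3, <- F3; reflexivity).
  assert (G4 : snd Bt = gt xh th) by (rewrite <- E4, <- F4; reflexivity).
  (* By the equation the Jacobian at the zero is [beta] times the scalar product of [A_tau] and
     [A_tautau]; if that product vanished, the zero would not be transverse. *)
  intros Z. apply Htr. unfold Im; simpl. rewrite G1, G2, G3, G4.
  transitivity (fx xh th * gt xh th - gx xh th * ft xh th); [ring|].
  rewrite Hdet, N1, N2. unfold moving in Z.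
  transitivity (beta * (p_tau xh (th - xh / V0) * p_tautau xh (th - xh / V0)
    + q_tau xh (th - xh / V0) * q_tautau xh (th - xh / V0))); [ring|rewrite Z; ring].
Qed.
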